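(* Consider mass migration zero range processes (MM-ZRP) on $\mathbb Z^d$ with rates $p(x,y)g^k_\alpha$; say the rates satisfy the growth bound if there is $C>0$ with $\sum_{k=1}^\alpha k\,g^k_\alpha\le C(\alpha+\beta)$ for all $\alpha>0,\beta\ge0$. (a) Let $\mu$ be a probability measure on $\mathbb N$ with $\mu(\alpha)>0$ for all $\alpha\in\mathbb N$. Choose $g^k_k>0$, $k\ge1$, arbitrarily such that the rates defined by $$g^k_{\alpha+k}\,\mu(\alpha+k)=\mu(\alpha)\frac{\mu(k)}{\mu(0)}\,g^k_k\qquad\text{for all }k\ge1,\ \alpha\ge1$$ satisfy the growth bound, and assume that $\mu$ has a finite first moment (or else that the alternative assumptions (A1)–(A2) stated in the context hold). Then the product measure $\bar\mu$ with single site marginal $\mu$ is invariant for the MM-ZRP with these rates. (b) If an MM-ZRP has rates satisfying the growth bound, $g^1_\alpha>0$ for all $\alpha\ge1$, and $$g^k_\alpha=\frac{(g^1_\alpha)!}{(g^1_{\alpha-k})!\,(g^1_k)!}\,g^k_k\qquad\text{for all }1\le k\le\alpha,$$ then it possesses a one-parameter family of product invariant probability measures $\bar\mu_\varphi$ with single site marginals $$\mu_\varphi(\alpha)=\frac{\mu(0)}{Z_\varphi}\,\frac{(\varphi\varphi_\mu)^\alpha}{(g^1_\alpha)!},\quad\alpha\ge0,\qquad Z_\varphi=\mu(0)\sum_{k=0}^\infty\frac{(\varphi\varphi_\mu)^k}{(g^1_k)!},$$ for $\varphi\in\mathrm{Rad}(Z')$ or $\varphi\in\mathrm{Rad}(Z)$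 (the latter when the alternative assumptions (A1)–(A2) hold). Both (a) and (b) hold independently of $p(\cdot,\cdot)$. If $p(\cdot,\cdot)$ is asymmetric (and the rates satisfy the growth bound and $g^1_\alpha>0$ for all $\alpha\ge1$), then the displayed condition on $g^k_\alpha$ in (b) is also necessary for the existence of product translation-invariant invariant measures (with single site marginal positive on $\mathbb N$ and of finite first moment, or under (A1)–(A2)).
   Context: $\mathbb N=\{0,1,2,\dots\}$ and $X=\mathbb Z^d$. Mass migration process (MMP): $p(\cdot,\cdot)$ is an irreducible translation-invariant transition probability on $\mathbb Z^d$ (asymmetric if $p(x,y)\ne p(y,x)$ for some $x,y$). The rates are numbers $g^k_{\alpha,\beta}\ge0$ with $g^0_{\alpha,\beta}=0$ and $g^k_{\alpha,\beta}=0$ if $k>\alpha$ or $\alpha=0$; $k$ particles jump together from $x$ to $y$ at rate $p(x,y)g^k_{\eta(x),\eta(y)}$. An MM-ZRP is an MMP with $g^k_{\alpha,\beta}=g^k_\alpha$. Notation: $(g^1_0)!=1$, $(g^1_k)!=g^1_kg^1_{k-1}\cdots g^1_1$ for $k>0$. In (b), $\mu$ is a reference probability measure $\mu(\alpha)=\mu(0)\varphi_\mu^\alpha/(g^1_\alpha)!$ on $\mathbb N$, with $\varphi_\mu=g^1_1\mu(1)/\mu(0)>0$. $\varphi_c$ is the radius of convergence of $Z_\varphi=\sum_n\varphi^n\mu(n)$ ($\varphi_c\ge1$). $\mathrm{Rad}(Z)=(0,\varphi_c]$ if $Z_{\varphi_c}<\infty$ and $(0,\varphi_c)$ otherwise;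 $\mathrm{Rad}(Z')=(0,\varphi_c]$ if $\sum_nn\varphi_c^n\mu(n)<\infty$ and $(0,\varphi_c)$ otherwise. Fix a positive function $a$ on $X$ and $M>0$ with $\sum_yp(x,y)a_y+\sum_ya_yp(y,x)\le Ma_x$ for all $x$, and $\sum_xa_x<\infty$. Set $\|\eta\|=\sum_x\eta(x)a_x$, $\|\eta-\zeta\|=\sum_x|\eta(x)-\zeta(x)|a_x$, $\mathfrak X=\{\eta\in\mathbb N^X:\|\eta\|<\infty\}$, and let $\mathbf L$ be the set of $f:\mathfrak X\to\mathbb R$ such that $|f(\eta)-f(\zeta)|\le L_f\|\eta-\zeta\|$ for some $L_f>0$. Generator: $\mathcal Lf(\eta)=\sum_{x,y}\sum_{k>0}p(x,y)g^k_{\eta(x),\eta(y)}\big(f(\mathcal S^k_{x,y}\eta)-f(\eta)\big)$, where $\mathcal S^k_{x,y}\eta$ is $\eta$ with $k$ particles moved from $x$ to $y$ if $\eta(x)\ge k$ and $x\neq y$, and $\eta$ otherwise. The process is assumed constructed, i.e. there is a Markov semigroup $(S(t))_{t\ge0}$ on $\mathbf L$ such that for $f\in\mathbf L$, $\eta\in\mathfrak X$: $S(t_1+t_2)=S(t_1)S(t_2)$, $S(0)=I$; $S(t)f(\eta)=f(\eta)+\int_0^t\mathcal LS(s)f(\eta)\,ds$; $|S(t)f(\eta)-f(\eta)|\le\|\eta\|L_f(e^{ct}-1)$ for a constant $c>0$; $S(t)f(\eta)$ and $\mathcal LS(t)f(\eta)$ are continuous in $t$; $\lim_{t\searrow0}(S(t)f(\eta)-f(\eta))/t=\mathcal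 Lf(\eta)$; $\mathcal LS(t)f(\eta)=S(t)\mathcal Lf(\eta)$. (Under (A1) below another construction is allowed.) A probability measure $\bar\mu$ on $\mathbb N^X$ is invariant if it is supported on $\mathfrak X$ and $\int S(t)f\,d\bar\mu=\int f\,d\bar\mu$ for every bounded $f\in\mathbf L$ and $t\ge0$. Alternative assumptions: (A1) a probability measure $\bar\mu$ on $\mathbb N^X$ is called invariant when $\int S(t)f\,d\bar\mu=\int f\,d\bar\mu$ for every bounded $f\in\mathbf L$, $t\ge0$, and this is equivalent to $\int\mathcal Lf\,d\bar\mu=0$ for every bounded cylinder function $f$ on $\mathbb N^X$; (A2) there is $C>0$ with $\sum_{k\le\alpha}g^k_{\alpha,\beta}\le C$ for all $\alpha,\beta$. *)

(* Defs.v *)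
From HB Require Import structures.
From mathcomp Require Import all_boot all_order all_algebra.
From mathcomp Require Import all_classical all_reals all_analysis.

Set Implicit Arguments.
Unset Strict Implicit.
Unset Printing Implicit Defensive.

Import Order.TTheory GRing.Theory Num.Theory.
Import numFieldNormedType.Exports.

Local Open Scope classical_set_scope.
Local Open Scope ring_scope.

Definition lattice (d : nat) := 'rV[int]_d.

Definition coordinate_sets (d : nat) : set (set (lattice d -> nat)) :=
  [set A | exists x n, A = [set eta | eta x = n]].

(* N^X with its product sigma-algebra; an element is a function on the lattice *)
Definition config (d : nat) := g_sigma_algebraType (@coordinate_sets d).

Section transition_probability.
Context {R : realType} {d : nat}.
Implicit Types (p : lattice d -> lattice d -> R) (x y z : lattice d).

Definition transition_probability p :=
  (forall x y, 0 <= p x y) /\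
  (forall x, \esum_(y in [set: lattice d]) (p x y)%:E = 1%E).

Definition kernel_translation_invariant p :=
  forall x y z, p (x + z) (y + z) = p x y.

Fixpoint kernel_iter p (n : nat) x y : \bar R :=
  if n is m.+1
  then (\esum_(z in [set: lattice d]) ((p x z)%:E * kernel_iter p m z y))%E
  else ((x == y)%:R)%:E.

Definition irreducible_kernel p :=
  forall x y, exists n, (0 < kernel_iter p n x y)%E.

Definition asymmetric_kernel p := exists x y, p x y != p y x.

End transition_probability.

Section rates.
Context {R : realType}.

(* g k alpha beta is the rate g^k_{alpha,beta} *)
Definition mmp_rates (g : nat -> nat -> nat -> R) :=
  [/\ forall k alpha beta, 0 <= g k alpha beta,
      forall alpha beta, g 0%N alpha beta = 0,
      forall k beta, g k 0%N beta = 0 &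
      forall k alpha beta, (alpha < k)%N -> g k alpha beta = 0].

Definition zrp (g : nat -> nat -> R) : nat -> nat -> nat -> R :=
  fun k alpha _ => g k alpha.

Definition growth_bound (g : nat -> nat -> nat -> R) :=
  exists2 C : R, 0 < C &
    forall alpha beta, (0 < alpha)%N ->
      \sum_(1 <= k < alpha.+1) k%:R * g k alpha beta <= C * (alpha + beta)%:R.

Definition bounded_rates (g : nat -> nat -> nat -> R) :=
  exists2 C : R, 0 < C &
    forall alpha beta, \sum_(0 <= k < alpha.+1) g k alpha beta <= C.

(* (g^1_n)! *)
Definition rate_fact (g : nat -> nat -> R) (n : nat) : R :=
  \prod_(1 <= i < n.+1) g 1%N i.

Definition factorized_rates (g : nat -> nat -> R) :=
  forall k alpha, (1 <= k <= alpha)%N ->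
    g k alpha =
      rate_fact g alpha / (rate_fact g (alpha - k) * rate_fact g k) * g k k.

End rates.

Section configurations.
Context {R : realType} {d : nat}.
Implicit Types (a : lattice d -> R) (eta zeta : config d).

Definition admissible_weight (p : lattice d -> lattice d -> R) a (M : R) :=
  [/\ forall x, 0 < a x,
      0 < M,
      forall x, (\esum_(y in [set: lattice d]) (p x y * a y)%:E +
                 \esum_(y in [set: lattice d]) (a y * p y x)%:E
                   <= (M * a x)%:E)%E &
      (\esum_(x in [set: lattice d]) (a x)%:E < +oo)%E].

Definition config_norm a eta : \bar R :=
  \esum_(x in [set: lattice d]) ((eta x)%:R * a x)%:E.

Definition config_dist a eta zeta : \bar R :=
  \esum_(x in [set: lattice d]) (`|(eta x)%:R - (zeta x)%:R| * a x)%:E.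

Definition finite_configs a : set (config d) :=
  [set eta | (config_norm a eta < +oo)%E].

(* Functions on a set Y of configurations are represented by total functions
   of which only the values on Y are used. *)
Definition is_lipschitz a (Y : set (config d)) (L : R) (f : config d -> R) :=
  0 < L /\
  forall eta zeta, Y eta -> Y zeta ->
    (`|f eta - f zeta|%:E <= L%:E * config_dist a eta zeta)%E.

Definition lipschitz_functions a (Y : set (config d)) : set (config d -> R) :=
  [set f | exists L, is_lipschitz a Y L f].

Definition bounded_on (Y : set (config d)) (f : config d -> R) :=
  exists K : R, forall eta, Y eta -> `|f eta| <= K.

Definition cylinder_function (f : config d -> R) :=
  exists F : seq (lattice d), forall eta zeta : config d,
    (forall x, x \in F -> eta x = zeta x) -> f eta = f zeta.

Definition move_particles (k : nat) (x y : lattice d) eta : config d :=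
  if (k <= eta x)%N && (x != y)
  then fun z => if z == x then (eta x - k)%N
                else if z == y then (eta y + k)%N else eta z
  else eta.

(* sum of an absolutely summable real family over a countable type *)
Definition unordered_sum (I : choiceType) (u : I -> R) : R :=
  fine (\esum_(i in [set: I]) (Num.max (u i) 0)%:E) -
  fine (\esum_(i in [set: I]) (Num.max (- u i) 0)%:E).

(* The sum over k > 0 stops at eta x, since g^k_{alpha,beta} = 0 if k > alpha. *)
Definition mmp_generator (p : lattice d -> lattice d -> R)
    (g : nat -> nat -> nat -> R) (f : config d -> R) (eta : config d) : R :=
  unordered_sum (fun xy : lattice d * lattice d =>
    \sum_(1 <= k < (eta xy.1).+1)
      p xy.1 xy.2 * g k (eta xy.1) (eta xy.2) *
        (f (move_particles k xy.1 xy.2 eta) - f eta)).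

End configurations.

Section semigroups.
Context {R : realType} {d : nat}.
Implicit Types (p : lattice d -> lattice d -> R) (a : lattice d -> R).
Implicit Types (g : nat -> nat -> nat -> R).
Implicit Types (S : R -> (config d -> R) -> config d -> R).

(* Markov semigroup with state space Y on the class D of functions on Y *)
Record markov_semigroup (Y : set (config d)) (D : set (config d -> R)) S :
    Prop := {
  semigroup_stable : forall (t : R) f, 0 <= t -> D f -> D (S t f) ;
  semigroup_local : forall (t : R) f h, 0 <= t -> {in Y, f =1 h} ->
    {in Y, S t f =1 S t h} ;
  semigroup0 : forall f, D f -> {in Y, S 0 f =1 f} ;
  semigroupD : forall (t1 t2 : R) f, 0 <= t1 -> 0 <= t2 -> D f ->
    {in Y, S (t1 + t2) f =1 S t1 (S t2 f)} ;
  semigroup_linear : forall (t c : R) f h, 0 <= t -> D f -> D h ->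
    {in Y, S t (fun eta => c * f eta + h eta) =1
           (fun eta => c * S t f eta + S t h eta)} ;
  semigroup_ge0 : forall (t : R) f, 0 <= t -> D f ->
    (forall eta, Y eta -> 0 <= f eta) ->
    forall eta, Y eta -> 0 <= S t f eta ;
  semigroup_cst1 : forall t : R, 0 <= t -> {in Y, S t (fun=> 1) =1 (fun=> 1)}
}.

(* In the last field, mmp_generator p g f need not be Lipschitz; S t is a total
   operator and the field constrains its value there. *)
Record mmp_semigroup p a g S : Prop := {
  mmp_markov :
    markov_semigroup (finite_configs a)
      (lipschitz_functions a (finite_configs a)) S ;
  mmp_integral : forall f eta (t : R),
    lipschitz_functions a (finite_configs a) f -> finite_configs a eta ->
    0 <= t ->
    S t f eta = f eta +
      \int[lebesgue_measure]_(s in `[0, t]) (mmp_generator p g (S s f) eta) ;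
  mmp_bound : exists2 c : R, 0 < c & forall f L eta (t : R),
    is_lipschitz a (finite_configs a) L f -> finite_configs a eta -> 0 <= t ->
    (`|S t f eta - f eta|%:E
       <= config_norm a eta * (L * (expR (c * t) - 1))%:E)%E ;
  mmp_continuous : forall f eta,
    lipschitz_functions a (finite_configs a) f -> finite_configs a eta ->
    {within `[0, +oo[, continuous (fun t : R => S t f eta)} ;
  mmp_generator_continuous : forall f eta,
    lipschitz_functions a (finite_configs a) f -> finite_configs a eta ->
    {within `[0, +oo[, continuous (fun t : R => mmp_generator p g (S t f) eta)} ;
  mmp_derivative : forall f eta,
    lipschitz_functions a (finite_configs a) f -> finite_configs a eta ->
    (S t f eta - f eta) / t @[t --> (0:R)^'+] --> mmp_generator p g f eta ;
  mmp_commute : forall f eta (t : R),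
    lipschitz_functions a (finite_configs a) f -> finite_configs a eta ->
    0 <= t ->
    mmp_generator p g (S t f) eta = S t (mmp_generator p g f) eta
}.

Definition mmp_invariant a S (mubar : probability (config d) R) :=
  mubar (finite_configs a) = 1%E /\
  forall f (t : R), lipschitz_functions a (finite_configs a) f ->
    bounded_on (finite_configs a) f -> 0 <= t ->
    (\int[mubar]_(eta in finite_configs a) (S t f eta)%:E =
     \int[mubar]_(eta in finite_configs a) (f eta)%:E)%E.

(* Alternative construction, with all of N^X as state space. There,
   config_dist may be infinite, and then the Lipschitz condition is void. *)
Definition bounded_measurable : set (config d -> R) :=
  [set f | measurable_fun setT f /\ bounded_on setT f].

Definition alt_invariant a S (mubar : probability (config d) R) :=
  forall f (t : R), lipschitz_functions a setT f -> bounded_measurable f -> 0 <= t ->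
    (\int[mubar]_eta (S t f eta)%:E = \int[mubar]_eta (f eta)%:E)%E.

Record alt_semigroup p a g S : Prop := {
  alt_markov : markov_semigroup setT bounded_measurable S ;
  alt_invariantP : forall mubar : probability (config d) R,
    alt_invariant a S mubar <->
    forall f, cylinder_function f -> bounded_on setT f ->
      (\int[mubar]_eta (mmp_generator p g f eta)%:E = 0)%E
}.

End semigroups.

Section measures.
Context {R : realType} {d : nat}.

Definition mass (mu : probability nat R) (n : nat) : R := fine (mu [set n]).

Definition finite_mean (mu : probability nat R) :=
  (\sum_(0 <= n <oo) (n%:R * mass mu n)%:E < +oo)%E.

(* mubar is the product of the m x; the sets below form a pi-system generating
   the sigma-algebra, hence determine mubar *)
Definition product_measure (m : lattice d -> probability nat R)
    (mubar : probability (config d) R) :=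
  forall (F : seq (lattice d)) (xi : lattice d -> nat), uniq F ->
    mubar [set eta : config d | forall x, x \in F -> eta x = xi x] =
    (\prod_(x <- F) mass (m x) (xi x))%:E.

Definition shift_config (z : lattice d) (eta : config d) : config d :=
  fun x => eta (x + z).

Definition translation_invariant (mubar : probability (config d) R) :=
  forall (z : lattice d) (A : set (config d)), measurable A ->
    mubar (shift_config z @^-1` A) = mubar A.

End measures.

Section partition_functions.
Context {R : realType}.
Implicit Types (mu : probability nat R) (phi : R).

Definition Zseries mu phi : \bar R :=
  (\sum_(0 <= n <oo) (phi ^+ n * mass mu n)%:E)%E.

Definition Zseries' mu phi : \bar R :=
  (\sum_(0 <= n <oo) (n%:R * phi ^+ n * mass mu n)%:E)%E.

(* radius of convergence of Zseries, whose coefficients are nonnegative *)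
Definition phi_c mu : \bar R :=
  ereal_sup [set phi%:E | phi in [set phi | 0 <= phi /\ (Zseries mu phi < +oo)%E]].

(* phi_c may be infinite, in which case both intervals are (0, +oo) *)
Definition interval_to_phi_c mu (Z : R -> \bar R) : set R :=
  [set phi | 0 < phi /\
    ((phi%:E < phi_c mu)%E \/
     (phi%:E = phi_c mu /\ (Z phi < +oo)%E))].

Definition RadZ mu : set R := interval_to_phi_c mu (Zseries mu).
Definition RadZ' mu : set R := interval_to_phi_c mu (Zseries' mu).

(* varphi_mu *)
Definition fugacity (g : nat -> nat -> R) mu : R :=
  g 1%N 1%N * mass mu 1 / mass mu 0.

Definition reference_measure (g : nat -> nat -> R) mu :=
  0 < fugacity g mu /\
  forall alpha,
    mass mu alpha = mass mu 0 * fugacity g mu ^+ alpha / rate_fact g alpha.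

Definition Zpartition (g : nat -> nat -> R) mu phi : \bar R :=
  ((mass mu 0)%:E *
   \sum_(0 <= k <oo) ((phi * fugacity g mu) ^+ k / rate_fact g k)%:E)%E.

Definition mu_phi (g : nat -> nat -> R) mu phi (alpha : nat) : R :=
  mass mu 0 / fine (Zpartition g mu phi) *
  ((phi * fugacity g mu) ^+ alpha / rate_fact g alpha).

End partition_functions.

(* Main.v *)
Require Import Defs.
From HB Require Import structures.
From mathcomp Require Import all_boot all_order all_algebra.
From mathcomp Require Import all_classical all_reals all_analysis.
From mathcomp Require Import measurable_realfun.
From mathcomp Require Import ring lra.

(** Why the theorem holds.

    Write [xi] for the configuration that remains when [k] particles have left
    the site [x]. A jump of [k] particles from [x] to [y] adds them to [xi] at [y],
    whereas the configuration before the jump is [xi] with [k] particles added at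
    [x]. Under a product measure with marginal [mu], removing [k] particles from
    [x] only changes the law by a density: for a rate [g k n], the integral over the
    configuration before the jump becomes an integral over [xi] with the weight
    [back_rate g mu k n], the rate of the reversed move, where [n] is the content
    of [x] in [xi] ([integral_rem_particles]). The mean of the generator is thus the
    sum over [x], [y] and [k] of [p x y] times the mean of
    [back_rate g mu k (xi x) * (f (xi + k at y) - f (xi + k at x))]; the lemma
    [integral_generator] computes it in terms of nonnegative sums, which may be
    rearranged freely.

    Sufficiency. The relation of part (a), and likewise the factorized rates with
    the marginals of part (b), say exactly that the backward rate does not depend on
    the content [n]. The departure site then no longer matters, and the two
    terms cancel because the rows and the columns of [p] have sum one; the columns
    do so by translation invariance ([stationary_constant_back_rate]). For the
    construction on configurations of finite norm, the mean of [S t f] is a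
    continuous function of [t] whose right derivative is the mean of the generator
    applied to [S t f], by dominated convergence, so it is constant as soon as
    the generator has mean zero on bounded Lipschitz functions ([mmp_invariantP]).
    For the other construction, invariance is tested on cylinder functions. The
    product measures exist because a uniform point of the unit interval has
    independent digits of any prescribed positive law ([product_measure_exists]),
    and in part (b) a finite mean follows by comparison with a larger convergent
    power series.

    Necessity. Conversely, the generator has mean zero on the indicators of
    cylinders ([cylinder_balance]). For one site this identifies the flow a site
    receives from itself with the flow from distant sites. For two sites [u] and
    [v] with contents [a] and [b], what remains is
    [p u v * h a b + p v u * h b a = 0], where [h a b] compares the backward rates
    at content [a] with their means. Exchanging the contents gives a second
    equation, and asymmetry of [p] makes the system invertible, so [h] vanishes
    ([pair_flowE]). As [b] grows these equations are triangular in the number of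
    jumping particles and show that the backward rates equal their means
    ([back_rate_mean]). Constancy for single jumps determines [mu], and constancy
    for [k] particles is then the factorization of the rates. *)

Set Implicit Arguments.
Unset Strict Implicit.
Unset Printing Implicit Defensive.

Import Order.TTheory GRing.Theory Num.Theory.
Import numFieldNormedType.Exports.
Local Open Scope classical_set_scope.
Local Open Scope ring_scope.

(** * Unordered sums over countable types *)

Section countable_sums.
Context {R : realType}.
Local Open Scope ereal_scope.

(** Enumerating a countable type by its coding into [nat] turns unordered sums
    into series, for which monotone convergence is available. *)
Lemma esum_countE (I : countType) (u : I -> \bar R) : (forall i, 0 <= u i) ->
  \esum_(i in [set: I]) u i = \sum_(n <oo) oapp u 0 (@pickle_inv I n).
Proof.
move=> u0; rewrite nneseries_esumT; last by move=> n; case: pickle_inv => /=.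
rewrite (esumID (range (@pickle I))); last by move=> n _; case: pickle_inv => /=.
rewrite !setTI [X in _ = _ + X]esum1 ?adde0.
  rewrite esum_image; last by move=> x y _ _; exact: (pcan_inj (@pickleK I)).
  by apply: eq_esum => i _; rewrite pickleK_inv.
move=> n /= nI; case E : (pickle_inv n) => [i|//]; exfalso; apply: nI.
by exists i => //; have := pickle_invK (T := I) n; rewrite E.
Qed.

Lemma measurable_esum d (T : measurableType d) (I : countType) (D : set T)
    (f : I -> T -> \bar R) : (forall i x, D x -> 0 <= f i x) ->
  (forall i, measurable_fun D (f i)) ->
  measurable_fun D (fun x => \esum_(i in [set: I]) f i x).
Proof.
move=> f0 mf.
apply: (@eq_measurable_fun _ _ _ _ D
  (fun x => \sum_(n <oo) oapp (fun i => f i x) 0 (@pickle_inv I n))).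
  by move=> x; rewrite inE => Dx; rewrite esum_countE// => i; exact: f0.
apply: ge0_emeasurable_sum => [n x Dx _|n _].
  by case: pickle_inv => //= i; exact: f0.
by case: pickle_inv => //= i; exact: mf.
Qed.

Lemma ge0_integral_esum d (T : measurableType d)
    (mu : {measure set T -> \bar R}) (D : set T) (I : countType)
    (f : I -> T -> \bar R) : measurable D ->
  (forall i, measurable_fun D (f i)) -> (forall i x, D x -> 0 <= f i x) ->
  \int[mu]_(x in D) (\esum_(i in [set: I]) f i x) =
  \esum_(i in [set: I]) (\int[mu]_(x in D) f i x).
Proof.
move=> mD mf f0; rewrite esum_countE; last first.
  by move=> i; apply: integral_ge0 => x Dx; exact: f0.
under eq_integral => x xD.
  rewrite esum_countE; last by move=> i; apply: f0; rewrite inE in xD.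
  over.
rewrite integral_nneseries//.
- apply: eq_eseriesr => n _; case: pickle_inv => //=.
  by rewrite integral0.
- by move=> n; case: pickle_inv => //= i; exact: mf.
- by move=> n x Dx; case: pickle_inv => //= i; exact: f0.
Qed.

Lemma esumZl (I : countType) (c : R) (u : I -> \bar R) : (forall i, 0 <= u i) ->
  (0 <= c)%R ->
  \esum_(i in [set: I]) (c%:E * u i) = c%:E * \esum_(i in [set: I]) u i.
Proof.
move=> u0 c0; rewrite !esum_countE//; last by move=> i; rewrite mule_ge0.
rewrite -nneseriesZl; last by move=> n _; case: pickle_inv => /=.
by apply: eq_eseriesr => n _; case: pickle_inv => //=; rewrite mule0.
Qed.

Lemma esumZr (I : countType) (c : R) (u : I -> \bar R) : (forall i, 0 <= u i) ->
  (0 <= c)%R ->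
  \esum_(i in [set: I]) (u i * c%:E) = (\esum_(i in [set: I]) u i) * c%:E.
Proof.
move=> u0 c0; rewrite muleC -esumZl//.
by apply: eq_esum => i _; rewrite muleC.
Qed.

Lemma esum_prod (I J : choiceType) (u : I -> J -> \bar R) :
  (forall i j, 0 <= u i j) ->
  \esum_(k in [set: I * J]) u k.1 k.2 =
  \esum_(i in [set: I]) \esum_(j in [set: J]) u i j.
Proof.
move=> u0; rewrite esum_esum//; congr (esum _ _).
by apply/seteqP; split => // -[i j].
Qed.

Lemma esumC (I J : choiceType) (u : I -> J -> \bar R) :
  (forall i j, 0 <= u i j) ->
  \esum_(i in [set: I]) \esum_(j in [set: J]) u i j =
  \esum_(j in [set: J]) \esum_(i in [set: I]) u i j.
Proof.
move=> u0; rewrite -!esum_prod//.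
rewrite (reindex_esum setT setT (fun k : I * J => (k.2, k.1)))//.
by split=> // [[i j] [i' j'] _ _ [-> ->]//|[j i] _]; exists (i, j).
Qed.

Lemma esum_unique (I : choiceType) (i0 : I) (u : I -> \bar R) : 0 <= u i0 ->
  (forall i, i != i0 -> u i = 0) -> \esum_(i in [set: I]) u i = u i0.
Proof.
move=> u0 ui; rewrite (esumID [set i0]).
  rewrite setTI esum_set1// [X in _ + X]esum1 ?adde0//.
  by move=> i [_ /eqP]; exact: ui.
by move=> i _; have [->//|/ui ->] := eqVneq i i0.
Qed.

Lemma esum_seq (I : choiceType) (F : seq I) (u : I -> \bar R) : uniq F ->
  (forall i, 0 <= u i) -> (forall i, i \notin F -> u i = 0) ->
  \esum_(i in [set: I]) u i = \sum_(i <- F) u i.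
Proof.
move=> uF u0 uF0; rewrite (esumID [set` F]); last by move=> *.
rewrite setTI [X in _ + X]esum1 ?adde0; last first.
  by move=> i [_ /negP]; exact: uF0.
rewrite esum_fset//; exact/esym/fsbig_seq.
Qed.

Lemma le_esum_term (I : choiceType) (i0 : I) (u : I -> \bar R) :
  (forall i, 0 <= u i) -> u i0 <= \esum_(i in [set: I]) u i.
Proof.
move=> u0; rewrite (esumID [set i0])// setTI esum_set1// leeDl//.
exact: esum_ge0.
Qed.

(** Only the differences of two summable nonnegative families matter for the
    signed unordered sum, not the Jordan decomposition used to define it. *)
Lemma unordered_sumB (I : choiceType) (u v : I -> R) :
  (forall i, 0 <= u i)%R -> (forall i, 0 <= v i)%R ->
  \esum_(i in [set: I]) (u i)%:E < +oo -> \esum_(i in [set: I]) (v i)%:E < +oo ->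
  unordered_sum (fun i => u i - v i)%R =
  (fine (\esum_(i in [set: I]) (u i)%:E) -
   fine (\esum_(i in [set: I]) (v i)%:E))%R.
Proof.
move=> u0 v0 su sv; rewrite /unordered_sum.
set P := \esum_(i in _) (Num.max (u i - v i) 0)%:E.
set N := \esum_(i in _) (Num.max (- (u i - v i)) 0)%:E.
set U := esum _ _; set V := esum _ _.
have P0 : 0 <= P by apply: esum_ge0 => i _; rewrite lee_fin le_max lexx orbT.
have N0 : 0 <= N by apply: esum_ge0 => i _; rewrite lee_fin le_max lexx orbT.
have U0 : 0 <= U by apply: esum_ge0 => i _; rewrite lee_fin.
have V0 : 0 <= V by apply: esum_ge0 => i _; rewrite lee_fin.
have PU : P <= U.
  by apply: le_esum => i _; rewrite lee_fin ge_max u0 lerBlDr lerDl v0.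
have NV : N <= V.
  by apply: le_esum => i _; rewrite lee_fin ge_max v0 opprB lerBlDr lerDl u0.
have E : P + V = N + U.
  rewrite /P /V /N /U -!esumD; try by move=> i _; rewrite lee_fin ?le_max ?lexx ?orbT.
  apply: eq_esum => i _; rewrite -!EFinD; congr (_%:E).
  by rewrite !maxEle; case: ifPn; case: ifPn; lra.
move: E; rewrite -[P]fineK ?ge0_fin_numE ?(le_lt_trans PU)//.
rewrite -[N]fineK ?ge0_fin_numE ?(le_lt_trans NV)//.
rewrite -[U]fineK ?ge0_fin_numE// -[V]fineK ?ge0_fin_numE//.
by rewrite -!EFinD => -[] /=; lra.
Qed.

End countable_sums.

(** * Measurability on the space of configurations *)

Definition cylinder_set d (F : seq (lattice d)) (xi : lattice d -> nat) :
  set (config d) := [set eta | forall x, x \in F -> eta x = xi x].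

(** [rem_particles k x eta] truncates at zero; it is used when [eta] has at
    least [k] particles at [x]. *)
Definition add_particles d (k : nat) (x : lattice d) (eta : config d) :
  config d := fun z => if z == x then (eta x + k)%N else eta z.
Definition rem_particles d (k : nat) (x : lattice d) (eta : config d) :
  config d := fun z => if z == x then (eta x - k)%N else eta z.

Section config_measurability.
Context {R : realType} {d : nat}.
Implicit Types (x y z : lattice d) (F : seq (lattice d)).

Lemma measurable_coord_set x n : measurable [set eta : config d | eta x = n].
Proof. by apply: sub_sigma_algebra; exists x, n. Qed.

Lemma measurable_to_config dT (T : measurableType dT) (f : T -> config d) :
  (forall x n, measurable [set t | f t x = n]) -> measurable_fun setT f.
Proof.
move=> mf; apply: (@measurability _ _ _ _ setT f (@coordinate_sets d)) => //.
by move=> _ [_ [x [n ->]] <-]; rewrite setTI; exact: mf.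
Qed.

Lemma measurable_coord x :
  measurable_fun [set: config d] (fun eta : config d => eta x : nat).
Proof.
move=> _ A _; rewrite setTI.
have -> : (fun eta : config d => eta x : nat) @^-1` A =
    \bigcup_(n in A) [set eta : config d | eta x = n].
  by apply/seteqP; split=> eta /= => [Ax|[n An ->]]; [exists (eta x)|].
by apply: bigcup_measurable => n _; exact: measurable_coord_set.
Qed.

Lemma measurable_fun_coord dU (U : measurableType dU) (h : nat -> U) x :
  measurable_fun [set: config d] (fun eta : config d => h (eta x)).
Proof. by apply: (@measurableT_comp _ _ _ _ _ _ h) => //; exact: measurable_coord. Qed.

Lemma cylinder_set_cons x F (xi : lattice d -> nat) :
  cylinder_set (x :: F) xi =
  [set eta : config d | eta x = xi x] `&` cylinder_set F xi.
Proof.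
apply/seteqP; split=> eta /= H.
  by split=> [|y yF]; apply: H; rewrite in_cons ?eqxx// yF orbT.
by case: H => Hx HF y; rewrite in_cons => /predU1P[->//|]; exact: HF.
Qed.

Lemma cylinder_set_nil (xi : lattice d -> nat) : cylinder_set [::] xi = setT.
Proof. by apply/seteqP; split. Qed.

Lemma measurable_cylinder_set F (xi : lattice d -> nat) :
  measurable (cylinder_set F xi).
Proof.
elim: F => [|x F IH]; first by rewrite cylinder_set_nil.
by rewrite cylinder_set_cons; apply: measurableI => //; exact: measurable_coord_set.
Qed.

(** A finite set of sites carries only countably many local configurations. *)
Lemma measurable_cylinder_function (f : config d -> R) :
  cylinder_function f -> measurable_fun setT f.
Proof.
move=> [F Ff] _ B mB; rewrite setTI.
pose P := [set xi : seq nat | exists2 eta : config d, map eta F = xi & B (f eta)].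
have -> : f @^-1` B = \bigcup_(s : seq nat)
    (if s \in P then [set eta : config d | map eta F = s] else set0).
  apply/seteqP; split=> eta /= => [Bf|[s _]].
    by exists (map eta F) => //; rewrite mem_set//; exists eta.
  case: ifPn => // /set_mem[zeta zs Bz] /= es.
  suff -> : f eta = f zeta by [].
  apply: Ff => x xF.
  by apply: (@eq_in_map _ _ eta zeta F).2 => //; rewrite es zs.
apply: countable_bigcupT_measurable => [|s]; first exact: countableP.
case: ifP => // _; elim: F s {Ff P} => [|x F IH] [|n s] /=.
- by rewrite [X in measurable X](_ : _ = setT)//; apply/seteqP.
- by rewrite [X in measurable X](_ : _ = set0)//; apply/seteqP; split.
- by rewrite [X in measurable X](_ : _ = set0)//; apply/seteqP; split.
- rewrite [X in measurable X](_ : _ = [set eta : config d | eta x = n] `&`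
                             [set eta : config d | map eta F = s]).
    by apply: measurableI => //; exact: measurable_coord_set.
  by apply/seteqP; split=> eta /= => [[-> ->]|[-> ->]].
Qed.

Lemma measurable_add_particles k x :
  measurable_fun setT (add_particles k x : config d -> config d).
Proof.
apply: measurable_to_config => y n; rewrite /add_particles.
case: (y == x); last exact: measurable_coord_set.
have := @measurable_coord x measurableT [set m | (m + k)%N = n] I.
by rewrite setTI.
Qed.

Lemma measurable_rem_particles k x :
  measurable_fun setT (rem_particles k x : config d -> config d).
Proof.
apply: measurable_to_config => y n; rewrite /rem_particles.
case: (y == x); last exact: measurable_coord_set.
have := @measurable_coord x measurableT [set m | (m - k)%N = n] I.
by rewrite setTI.
Qed.

(** Together with the empty set, the cylinder sets form a pi-system: two of them
    either prescribe different contents for some site, or intersect in a cylinder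
    set over the union of their sites. *)
Lemma config_measure_unique (m1 m2 : {measure set (config d) -> \bar R}) :
  (forall F xi, uniq F -> m1 (cylinder_set F xi) = m2 (cylinder_set F xi)) ->
  (m1 setT < +oo)%E -> forall A, measurable A -> m1 A = m2 A.
Proof.
move=> m12 m1oo A mA.
pose G : set (set (config d)) :=
  [set B | B = set0 \/ exists F xi, uniq F /\ B = cylinder_set F xi].
have Gm : G `<=` @measurable _ (config d).
  move=> _ [->//|[F [xi [_ ->]]]]; exact: measurable_cylinder_set.
have GT : G setT by right; exists [::], (fun=> 0%N); rewrite cylinder_set_nil.
apply: (g_sigma_algebra_measure_unique G Gm (fun=> setT)) => //.
- by rewrite bigcup_const.
- move=> B1 B2 [->|[F1 [xi1 [u1 ->]]]]; first by rewrite set0I; left.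
  move=> [->|[F2 [xi2 [u2 ->]]]]; first by rewrite setI0; left.
  have [/hasP[x xF /andP[xF2 /eqP ne]]|/hasPn agree] :=
      boolP (has (fun x => (x \in F2) && (xi1 x != xi2 x)) F1).
    left; apply/seteqP; split=> // eta [/= /(_ _ xF) e1 /(_ _ xF2) e2].
    by apply: ne; rewrite -e1 -e2.
  right; exists (undup (F1 ++ F2)), (fun x => if x \in F1 then xi1 x else xi2 x).
  rewrite undup_uniq; split=> //; apply/seteqP; split=> eta /=.
    by move=> [e1 e2] x; rewrite mem_undup mem_cat; case: ifP => [/e1|_ /e2].
  move=> e; split=> x xF; rewrite e ?mem_undup ?mem_cat ?xF ?orbT//.
  by case: ifP => // /agree; rewrite xF /= negbK => /eqP.
- by move=> _ [->|[F [xi [u ->]]]]; rewrite ?measure0// m12.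
have : <<s @coordinate_sets d >> A by [].
apply: smallest_sub; first exact: smallest_sigma_algebra.
move=> _ [x [n ->]]; apply: sub_sigma_algebra; right.
exists [:: x], (fun=> n); split=> //; apply/seteqP; split=> eta /=.
  by move=> ex y; rewrite inE => /eqP ->.
by apply; rewrite inE.
Qed.

End config_measurability.

(** * Moving particles under a product measure *)

Section integral_restriction.
Context d (T : measurableType d) {R : realType}.
Variable mu : {measure set T -> \bar R}.
Local Open Scope ereal_scope.

Lemma ge0_integral_mrestr (D : set T) (mD : measurable D) (f : T -> \bar R) :
  measurable_fun setT f -> (forall x, 0 <= f x) ->
  \int[mrestr mu mD]_x f x = \int[mu]_(x in D) f x.
Proof.
move=> mf f0; have mDC := measurableC mD.
rewrite -(setUv D) ge0_integral_setU//; first last.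
- by rewrite disj_set2E setICr.
- exact: measurable_funTS.
rewrite (eq_measure_integral mu); last first.
  by move=> A _ AD; rewrite /= /mrestr setIidl.
rewrite [X in _ + X](eq_measure_integral mzero); last first.
  move=> A _ AD; rewrite /= /mrestr (_ : A `&` D = set0) ?measure0//.
  by apply/seteqP; split=> // x [/AD].
by rewrite integral_measure_zero adde0.
Qed.

End integral_restriction.

Section product_measure_theory.
Context {R : realType} {d : nat}.
Variables (mu : probability nat R) (mubar : probability (config d) R).
Hypothesis mubarE : product_measure (fun=> mu) mubar.
Hypothesis mu_gt0 : forall n, 0 < mass mu n.
Implicit Types (x y z : lattice d) (F : seq (lattice d)) (k n : nat).

Lemma mass_ge0 (nu : probability nat R) n : 0 <= mass nu n.
Proof. exact/fine_ge0/measure_ge0. Qed.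

Lemma product_cylinder F (xi : lattice d -> nat) : uniq F ->
  mubar (cylinder_set F xi) = (\prod_(x <- F) mass mu (xi x))%:E.
Proof. exact: mubarE. Qed.

(** Conditioning on the content of [x] merges that site into the cylinder, whose
    other sites are then the members of [F] different from [x]. *)
Lemma site_cylinder x n F (xi : lattice d -> nat) :
  (x \in F -> xi x = n) ->
  cylinder_set F xi `&` [set eta | eta x = n] =
  cylinder_set (x :: [seq y <- F | y != x]) (fun y => if y == x then n else xi y).
Proof.
move=> xn; apply/seteqP; split=> eta /=.
  move=> [eF ex] y; rewrite in_cons mem_filter.
  by have [->//|_ /=] := eqVneq y x; exact: eF.
move=> e; split; last by rewrite e ?in_cons ?eqxx.
move=> y yF; rewrite e; last by rewrite in_cons mem_filter yF andbT orbN.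
by have [yx|//] := eqVneq y x; rewrite yx xn// -yx.
Qed.

Lemma rem_site_cylinder k x n F (xi : lattice d -> nat) :
  (x \in F -> xi x = n) ->
  rem_particles k x @^-1` cylinder_set F xi `&`
    [set eta : config d | eta x = (n + k)%N] =
  cylinder_set (x :: [seq y <- F | y != x])
    (fun y => if y == x then (n + k)%N else xi y).
Proof.
move=> xn; apply/seteqP; split=> eta /=.
  move=> [eF ex] y; rewrite in_cons mem_filter.
  have [->//|yx /= yF] := eqVneq y x.
  by have := eF _ yF; rewrite /rem_particles (negbTE yx).
move=> e; have ex : eta x = (n + k)%N by rewrite e ?in_cons ?eqxx.
split=> // y yF; rewrite /rem_particles.
have [yx|yx] := eqVneq y x; first by rewrite ex addnK yx xn// -yx.
by rewrite e ?(negbTE yx)// in_cons mem_filter yF yx orbT.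
Qed.

Lemma site_cylinder_mass x n F (xi : lattice d -> nat) : uniq F ->
  mubar (cylinder_set (x :: [seq y <- F | y != x])
           (fun y => if y == x then n else xi y)) =
  (mass mu n * \prod_(y <- F | y != x) mass mu (xi y))%:E.
Proof.
move=> uF; rewrite product_cylinder; last first.
  by rewrite /= mem_filter eqxx /= filter_uniq.
rewrite big_cons eqxx big_filter; congr (_ * _)%:E.
by apply: eq_bigr => y /negbTE ->.
Qed.

Local Open Scope ereal_scope.

(** Removing [k] particles from a site holding [n + k] of them changes the mass of
    a cylinder only by the factor of that site; uniqueness of measures extends
    this from cylinders to all measurable sets. *)
Lemma integral_rem_particles_site k x n (h : config d -> \bar R) :
  measurable_fun setT h -> (forall eta, 0 <= h eta) ->
  (mass mu n)%:E * \int[mubar]_(eta in [set eta | eta x = (n + k)%N])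
                     h (rem_particles k x eta) =
  (mass mu (n + k))%:E * \int[mubar]_(eta in [set eta | eta x = n]) h eta.
Proof.
move=> mh h0; pose D := @measurable_coord_set d x.
pose c m := NngNum (mass_ge0 mu m).
have mrem := @measurable_rem_particles d k x.
pose m1m : {measure set (config d) -> \bar R} :=
  measure_function_pushforward__canonical__measure_function_Measure
    (mscale (c n) (mrestr mubar (D (n + k)%N))) mrem.
pose m2 : {measure set (config d) -> \bar R} :=
  mscale (c (n + k)%N) (mrestr mubar (D n)).
have m1E A : m1m A = (mass mu n)%:E * mubar (rem_particles k x @^-1` A `&`
    [set eta : config d | eta x = (n + k)%N]) by [].
have m2E A : m2 A = (mass mu (n + k))%:E * mubar (A `&`
    [set eta : config d | eta x = n]) by [].
have m12 : forall A, measurable A -> m1m A = m2 A.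
  apply: config_measure_unique => [F xi uF|].
    have [|xn] := boolP ((x \in F) && (xi x != n)).
      move=> /andP[xF /eqP xn].
      have E1 : rem_particles k x @^-1` cylinder_set F xi `&`
          [set eta : config d | eta x = (n + k)%N] = set0.
        apply/seteqP; split=> // eta [/= /(_ _ xF)].
        by rewrite /rem_particles eqxx => + en; rewrite en addnK => /esym.
      have E2 : cylinder_set F xi `&` [set eta : config d | eta x = n] = set0.
        by apply/seteqP; split=> // eta [/= /(_ _ xF) -> ?]; exact: xn.
      rewrite m1E m2E E1 E2.
      by rewrite measure0 !mule0.
    have {}xn : x \in F -> xi x = n.
      by move=> xF; move: xn; rewrite xF /= negbK => /eqP.
    rewrite m1E m2E rem_site_cylinder// site_cylinder// !site_cylinder_mass//=.
    by rewrite -!EFinM; congr _%:E; rewrite mulrCA.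
  rewrite m1E lte_mul_pinfty ?lee_fin ?mass_ge0//.
  by rewrite preimage_setT setTI (le_lt_trans (probability_le1 _ (D _))) ?ltry.
have mhr : measurable_fun setT (h \o rem_particles k x).
  exact: measurableT_comp.
have hr0 eta : 0 <= (h \o rem_particles k x) eta by exact: h0.
rewrite -(ge0_integral_mrestr mubar (D (n + k)%N) mhr)//.
rewrite -(ge0_integral_mrestr mubar (D n) mh)//.
transitivity (\int[m1m]_eta h eta).
  rewrite /m1m (ge0_integral_pushforward mrem _ measurableT mh)// preimage_setT.
  by rewrite (ge0_integral_mscale _ measurableT (c n) mhr).
rewrite (eq_measure_integral m2); last by move=> A mA _; exact: m12.
by rewrite (ge0_integral_mscale _ measurableT (c (n + k)%N) mh).
Qed.

(** Summing over what remains at [x] turns the rate [G] of removing [k] particles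
    into a weight on the remaining configuration, whose law is again [mubar]. *)
Lemma integral_rem_particles k x (G : nat -> R) (h : config d -> \bar R) :
  (forall n, 0 <= G n)%R ->
  measurable_fun setT h -> (forall eta, 0 <= h eta) ->
  \int[mubar]_(eta in [set eta | (k <= eta x)%N])
    ((G (eta x))%:E * h (rem_particles k x eta)) =
  \int[mubar]_eta
    ((G (eta x + k)%N * mass mu (eta x + k)%N / mass mu (eta x))%:E * h eta).
Proof.
move=> G0 mh h0.
have -> : [set eta : config d | (k <= eta x)%N] =
    \bigcup_n [set eta : config d | eta x = (n + k)%N].
  apply/seteqP; split=> eta /=; last by move=> [n _ ->]; rewrite leq_addl.
  by move=> kx; exists (eta x - k)%N; rewrite // subnK.
have -> : [set: config d] = \bigcup_n [set eta : config d | eta x = n].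
  by apply/seteqP; split=> // eta _; exists (eta x).
have mhr : measurable_fun setT (h \o rem_particles k x).
  by apply: measurableT_comp => //; exact: measurable_rem_particles.
have mL : measurable_fun setT
    (fun eta : config d => (G (eta x))%:E * h (rem_particles k x eta)).
  apply: emeasurable_funM => //.
  exact: (measurable_fun_coord (fun n => (G n)%:E) x).
have mR : measurable_fun setT (fun eta : config d =>
    (G (eta x + k)%N * mass mu (eta x + k)%N / mass mu (eta x))%:E * h eta).
  apply: emeasurable_funM => //.
  exact: (measurable_fun_coord
    (fun n => (G (n + k)%N * mass mu (n + k) / mass mu n)%:E) x).
rewrite ge0_integral_bigcup; first last.
- by apply/trivIsetP => i j _ _ /eqP ij; apply/seteqP; split=> // eta [/= -> /addIn].
- by move=> eta _; rewrite mule_ge0// lee_fin.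
- exact: measurable_funTS.
- by move=> n; exact: measurable_coord_set.
rewrite ge0_integral_bigcup; first last.
- by apply/trivIsetP => i j _ _ /eqP ij; apply/seteqP; split=> // eta [/= ->].
- by move=> eta _; rewrite mule_ge0// lee_fin !mulr_ge0 ?invr_ge0 ?mass_ge0.
- exact: measurable_funTS.
- by move=> n; exact: measurable_coord_set.
apply: eq_eseriesr => n _.
under eq_integral => eta /[!inE] /= en do rewrite en.
under [RHS]eq_integral => eta /[!inE] /= en do rewrite en.
have mD m := @measurable_coord_set d x m.
rewrite ge0_integralZl ?lee_fin//; last exact: measurable_funTS.
rewrite ge0_integralZl ?lee_fin//; first last.
- by rewrite !mulr_ge0 ?invr_ge0 ?mass_ge0.
- exact: measurable_funTS.
rewrite mulrAC EFinM -muleA -integral_rem_particles_site// muleA -EFinM.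
by rewrite -mulrA mulVf ?mulr1// gt_eqF.
Qed.

End product_measure_theory.

(** * The integral of the generator *)

Section generator_integral.
Context {R : realType} {d : nat}.
Variables (p : lattice d -> lattice d -> R) (g : nat -> nat -> R).
Hypothesis p_ge0 : forall x y, 0 <= p x y.
Hypothesis p_row : forall x, \esum_(y in [set: lattice d]) (p x y)%:E = 1%E.
Hypothesis p_col : forall y, \esum_(x in [set: lattice d]) (p x y)%:E = 1%E.
Hypothesis g_rates : mmp_rates (zrp g).
Implicit Types (x y z : lattice d) (k n : nat) (eta xi : config d).

Lemma rate_ge0 k n : 0 <= g k n.
Proof. by have [g0 _ _ _] := g_rates; exact: (g0 k n 0%N). Qed.

(** Since [g k n] vanishes for [k = 0] and for [k > n], the number of particles
    that jump may range over all of [nat], independently of the configuration. *)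
Lemma rate_sumE n (q : nat -> R) : (forall k, 0 <= q k) ->
  (\sum_(1 <= k < n.+1) g k n * q k)%:E =
  (\esum_(k in [set: nat]) (g k n * q k)%:E)%E.
Proof.
move=> q0; have [_ g0 _ glarge] := g_rates.
rewrite (@esum_seq _ _ (index_iota 1 n.+1)); first by rewrite sumEFin.
- exact: iota_uniq.
- by move=> k; rewrite lee_fin mulr_ge0 ?rate_ge0.
move=> k; rewrite mem_index_iota ltnS negb_and -ltnNge ltnS leqn0 -ltnNge.
case/orP => [/eqP ->|kn]; first by rewrite [g _ _](g0 n 0%N) mul0r.
by rewrite [g _ _](glarge k n 0%N kn) mul0r.
Qed.

Lemma move_particlesE k x y eta : (k <= eta x)%N ->
  move_particles k x y eta = add_particles k y (rem_particles k x eta).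
Proof.
move=> kx; rewrite /move_particles kx /=; apply/funext => z.
rewrite /add_particles /rem_particles.
have [<-|xy] /= := eqVneq x y.
  by have [->|//] := eqVneq z x; rewrite ?eqxx subnK.
have [->|zx] := eqVneq z x; first by rewrite ?eqxx ?(negbTE xy).
by have [zy|] := eqVneq z y; rewrite // -zy (negbTE zx).
Qed.

Lemma add_rem_particles k x eta : (k <= eta x)%N ->
  add_particles k x (rem_particles k x eta) = eta.
Proof.
move=> kx; apply/funext => z; rewrite /add_particles /rem_particles.
by have [->|//] := eqVneq z x; rewrite ?eqxx subnK.
Qed.

Variables (f : config d -> R) (om : nat -> R) (b : lattice d -> R).
Hypothesis mf : measurable_fun setT f.
Hypothesis om_ge0 : forall k, 0 <= om k.
Hypothesis b_ge0 : forall x, 0 <= b x.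
Hypothesis fD : forall k x xi, `|f (add_particles k x xi) - f xi| <= om k * b x.

(** The effect of adding [k] particles at [x], made nonnegative by adding its
    a priori bound. *)
Definition shifted_gain k x xi : R :=
  f (add_particles k x xi) - f xi + om k * b x.

Lemma shifted_gain_ge0 k x xi : 0 <= shifted_gain k x xi.
Proof. by have := fD k x xi; rewrite ler_norml /shifted_gain => /andP[]; lra. Qed.

Lemma shifted_gain_le k x xi : shifted_gain k x xi <= om k * (2 * b x).
Proof. by have := fD k x xi; rewrite ler_norml /shifted_gain => /andP[]; lra. Qed.

Lemma measurable_shifted_gain k x : measurable_fun setT (shifted_gain k x).
Proof.
apply: measurable_funD; last exact: measurable_cst.
apply: measurable_funB => //; apply: measurableT_comp => //.
exact: measurable_add_particles.
Qed.

(** Particles leave [x] and arrive at [y]; the choice [y = x] gives the loss term. *)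
Definition site_gain x y eta : R :=
  \sum_(1 <= k < (eta x).+1) g k (eta x) * shifted_gain k y (rem_particles k x eta).
Definition site_rate x eta : R := \sum_(1 <= k < (eta x).+1) g k (eta x) * om k.

Lemma site_gain_ge0 x y eta : 0 <= site_gain x y eta.
Proof. by apply: sumr_ge0 => k _; rewrite mulr_ge0 ?rate_ge0 ?shifted_gain_ge0. Qed.

Lemma site_rate_ge0 x eta : 0 <= site_rate x eta.
Proof. by apply: sumr_ge0 => k _; rewrite mulr_ge0 ?rate_ge0. Qed.

Lemma site_gain_le x y eta : site_gain x y eta <= site_rate x eta * (2 * b y).
Proof.
rewrite /site_rate mulr_suml; apply: ler_sum => k _.
by rewrite -mulrA ler_wpM2l ?rate_ge0 ?shifted_gain_le.
Qed.

Lemma site_gainE x y eta : (site_gain x y eta)%:E =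
  (\esum_(k in [set: nat])
     ((g k (eta x))%:E * (shifted_gain k y (rem_particles k x eta))%:E))%E.
Proof. by rewrite rate_sumE// => k; exact: shifted_gain_ge0. Qed.

Lemma site_rateE x eta : (site_rate x eta)%:E =
  (\esum_(k in [set: nat]) (g k (eta x) * om k)%:E)%E.
Proof. exact: rate_sumE. Qed.

Lemma measurable_site_gain x y : measurable_fun setT (fun eta => (site_gain x y eta)%:E).
Proof.
have -> : (fun eta => (site_gain x y eta)%:E) = (fun eta => \esum_(k in [set: nat])
    ((g k (eta x))%:E * (shifted_gain k y (rem_particles k x eta))%:E))%E.
  by apply/funext => eta; exact: site_gainE.
apply: measurable_esum => [k eta _|k].
  by rewrite mule_ge0 ?lee_fin ?rate_ge0 ?shifted_gain_ge0.
apply: emeasurable_funM.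
  exact: (measurable_fun_coord (fun n => (g k n)%:E) x).
apply/measurable_EFinP; apply: measurableT_comp.
  exact: measurable_shifted_gain.
exact: measurable_rem_particles.
Qed.

Lemma measurable_site_rate x : measurable_fun setT (fun eta => (site_rate x eta)%:E).
Proof.
exact: (measurable_fun_coord
  (fun n => (\sum_(1 <= k < n.+1) g k n * om k)%:E) x).
Qed.

(** Moving [k] particles from [x] to [y] removes them at [x], then adds them at
    [y]; comparing both endpoints with the configuration in between splits each
    term of the generator into a difference of nonnegative terms. *)
Lemma generator_term x y eta :
  \sum_(1 <= k < (eta x).+1)
    p x y * zrp g k (eta x) (eta y) * (f (move_particles k x y eta) - f eta) =
  p x y * (site_gain x y eta + site_rate x eta * b x) -
  p x y * (site_gain x x eta + site_rate x eta * b y).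
Proof.
rewrite -mulrBr /site_gain /site_rate !mulr_suml -!big_split /= -sumrB mulr_sumr.
apply: eq_big_nat => k /andP[_]; rewrite ltnS => kx.
have fE : f eta = f (add_particles k x (rem_particles k x eta)).
  by rewrite add_rem_particles.
rewrite move_particlesE// fE /shifted_gain /zrp.
by ring.
Qed.

Variable mubar : probability (config d) R.
Variable Y : set (config d).
Hypothesis mY : measurable Y.
Hypothesis mubarY : mubar Y = 1%E.
Variable vbar : R.
Local Open Scope ereal_scope.
Hypothesis site_rate_mean : forall x, \int[mubar]_eta (site_rate x eta)%:E = vbar%:E.
Hypothesis b_sum : \esum_(x in [set: lattice d]) (b x)%:E < +oo.
Hypothesis rate_row_sum : forall eta, Y eta ->
  \esum_(x in [set: lattice d]) (site_rate x eta * b x)%:E < +oo.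
Hypothesis rate_col_sum : forall eta, Y eta ->
  \esum_(xy in [set: lattice d * lattice d])
     (p xy.1 xy.2 * (site_rate xy.1 eta * b xy.2))%:E < +oo.

Definition gain x y := \int[mubar]_eta (site_gain x y eta)%:E.

Lemma gain_ge0 x y : 0 <= gain x y.
Proof. by apply: integral_ge0 => eta _; rewrite lee_fin site_gain_ge0. Qed.

Lemma vbar_ge0 : (0 <= vbar)%R.
Proof.
rewrite -lee_fin -(site_rate_mean (0 : lattice d)%R); apply: integral_ge0 => eta _.
by rewrite lee_fin site_rate_ge0.
Qed.

Lemma gain_le x y : gain x y <= (vbar * (2 * b y))%:E.
Proof.
rewrite EFinM -(site_rate_mean x) muleC -ge0_integralZl_EFin//; first last.
- by rewrite mulr_ge0.
- exact: measurable_site_rate.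
- by move=> eta _; rewrite lee_fin site_rate_ge0.
apply: ge0_le_integral => //.
- by move=> eta _; rewrite lee_fin site_gain_ge0.
- exact: measurable_site_gain.
- by apply: measurable_funeM; exact: measurable_site_rate.
- by move=> eta _; rewrite -EFinM lee_fin mulrC site_gain_le.
Qed.

Lemma integral_full (h : config d -> \bar R) : measurable_fun setT h ->
  (forall eta, 0 <= h eta) -> \int[mubar]_(eta in Y) h eta = \int[mubar]_eta h eta.
Proof.
move=> mh h0; rewrite [RHS](@ge0_negligible_integral _ _ _ _ _ (~` Y))//.
- by rewrite setTD setCK.
- exact: measurableC.
- by have := probability_setC mubar mY; rewrite mubarY subee.
Qed.

Let A (xy : lattice d * lattice d) eta : R :=
  (p xy.1 xy.2 * (site_gain xy.1 xy.2 eta + site_rate xy.1 eta * b xy.1))%R.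
Let B (xy : lattice d * lattice d) eta : R :=
  (p xy.1 xy.2 * (site_gain xy.1 xy.1 eta + site_rate xy.1 eta * b xy.2))%R.

Let A0 xy eta : (0 <= A xy eta)%R.
Proof. by rewrite mulr_ge0 ?addr_ge0 ?mulr_ge0 ?site_gain_ge0 ?site_rate_ge0. Qed.
Let B0 xy eta : (0 <= B xy eta)%R.
Proof. by rewrite mulr_ge0 ?addr_ge0 ?mulr_ge0 ?site_gain_ge0 ?site_rate_ge0. Qed.

Let mA xy : measurable_fun setT (fun eta => (A xy eta)%:E).
Proof.
have -> : (fun eta => (A xy eta)%:E) = (fun eta => (p xy.1 xy.2)%:E *
    ((site_gain xy.1 xy.2 eta)%:E + (site_rate xy.1 eta)%:E * (b xy.1)%:E)).
  by apply/funext => eta; rewrite /A EFinM EFinD EFinM.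
apply: measurable_funeM; apply: emeasurable_funD.
  exact: measurable_site_gain.
apply: emeasurable_funM; first exact: measurable_site_rate.
exact: measurable_cst.
Qed.
Let mB xy : measurable_fun setT (fun eta => (B xy eta)%:E).
Proof.
have -> : (fun eta => (B xy eta)%:E) = (fun eta => (p xy.1 xy.2)%:E *
    ((site_gain xy.1 xy.1 eta)%:E + (site_rate xy.1 eta)%:E * (b xy.2)%:E)).
  by apply/funext => eta; rewrite /B EFinM EFinD EFinM.
apply: measurable_funeM; apply: emeasurable_funD.
  exact: measurable_site_gain.
apply: emeasurable_funM; first exact: measurable_site_rate.
exact: measurable_cst.
Qed.

Lemma esum_row (u : lattice d -> R) : (forall x, 0 <= u x)%R ->
  \esum_(xy in [set: lattice d * lattice d]) (p xy.1 xy.2 * u xy.1)%:E =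
  \esum_(x in [set: lattice d]) (u x)%:E.
Proof.
move=> u0; rewrite (esum_prod (u := fun x y => (p x y * u x)%:E)).
  apply: eq_esum => x _; under eq_esum do rewrite EFinM.
  by rewrite esumZr ?p_row ?mul1e// => y; rewrite lee_fin.
by move=> x y; rewrite lee_fin mulr_ge0.
Qed.

Lemma esum_col (u : lattice d -> \bar R) : (forall y, 0 <= u y) ->
  (forall y, u y \is a fin_num) ->
  \esum_(xy in [set: lattice d * lattice d]) ((p xy.1 xy.2)%:E * u xy.2) =
  \esum_(y in [set: lattice d]) u y.
Proof.
move=> u0 uf; rewrite (esum_prod (u := fun x y => (p x y)%:E * u y)).
  rewrite esumC; last by move=> x y; rewrite mule_ge0 ?lee_fin.
  apply: eq_esum => y _; rewrite -(fineK (uf y)).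
  by rewrite esumZr ?p_col ?mul1e ?fine_ge0// => x; rewrite lee_fin.
by move=> x y; rewrite mule_ge0 ?lee_fin.
Qed.

(** Each row of [p] has sum one, so the part of the terms that depends on the
    departure site alone reduces to a sum over that site. *)
Let sumA eta : Y eta -> \esum_(xy in [set: lattice d * lattice d]) (A xy eta)%:E < +oo.
Proof.
move=> Yeta; under eq_esum do rewrite /A mulrDr EFinD.
rewrite esumD; [|by move=> xy _; rewrite lee_fin !mulr_ge0 ?site_gain_ge0 ?site_rate_ge0..].
apply: lte_add_pinfty; last first.
  rewrite (esum_row (u := fun x => site_rate x eta * b x)%R) ?rate_row_sum//.
  by move=> x; rewrite mulr_ge0 ?site_rate_ge0.
apply: (@le_lt_trans _ _ (\esum_(xy in [set: lattice d * lattice d])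
    (2%:E * (p xy.1 xy.2 * (site_rate xy.1 eta * b xy.2))%:E))).
  apply: le_esum => -[x y] _ /=; rewrite -EFinM lee_fin mulrCA ler_wpM2l//.
  by rewrite (le_trans (site_gain_le _ _ _))// mulrCA.
rewrite esumZl//; last by move=> xy; rewrite lee_fin !mulr_ge0 ?site_rate_ge0.
by rewrite lte_mul_pinfty ?rate_col_sum ?lee_fin.
Qed.

Let sumB eta : Y eta -> \esum_(xy in [set: lattice d * lattice d]) (B xy eta)%:E < +oo.
Proof.
move=> Yeta; under eq_esum do rewrite /B mulrDr EFinD.
rewrite esumD; [|by move=> xy _; rewrite lee_fin !mulr_ge0 ?site_gain_ge0 ?site_rate_ge0..].
apply: lte_add_pinfty; last exact: rate_col_sum.
rewrite (esum_row (u := fun x => site_gain x x eta)); last first.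
  by move=> x; exact: site_gain_ge0.
apply: (@le_lt_trans _ _ (\esum_(x in [set: lattice d])
    (2%:E * (site_rate x eta * b x)%:E))).
  apply: le_esum => x _ /=; rewrite -EFinM lee_fin.
  by rewrite (le_trans (site_gain_le _ _ _))// mulrCA.
rewrite esumZl//; last by move=> x; rewrite lee_fin !mulr_ge0 ?site_rate_ge0.
by rewrite lte_mul_pinfty ?rate_row_sum ?lee_fin.
Qed.

Lemma gain_sum_lty :
  \esum_(xy in [set: lattice d * lattice d]) ((p xy.1 xy.2)%:E * gain xy.1 xy.2) < +oo.
Proof.
apply: (@le_lt_trans _ _ (\esum_(xy in [set: lattice d * lattice d])
    ((p xy.1 xy.2)%:E * (vbar * 2 * b xy.2)%:E))).
  by apply: le_esum => xy _; rewrite lee_wpmul2l ?lee_fin// -mulrA gain_le.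
rewrite (esum_col (u := fun y => (vbar * 2 * b y)%:E))//; last first.
  by move=> y; rewrite lee_fin !mulr_ge0 ?vbar_ge0.
under eq_esum do rewrite EFinM.
rewrite esumZl ?mulr_ge0 ?vbar_ge0//.
by apply: lte_mul_pinfty => //; rewrite lee_fin mulr_ge0 ?vbar_ge0.
Qed.

Lemma gain_diag_lty : \esum_(x in [set: lattice d]) gain x x < +oo.
Proof.
apply: (@le_lt_trans _ _ (\esum_(x in [set: lattice d]) ((vbar * 2)%:E * (b x)%:E))).
  by apply: le_esum => x _; rewrite -EFinM -mulrA gain_le.
rewrite esumZl ?mulr_ge0 ?vbar_ge0//.
by apply: lte_mul_pinfty => //; rewrite lee_fin mulr_ge0 ?vbar_ge0.
Qed.

Let S := \esum_(x in [set: lattice d]) (b x)%:E.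

Let integral_shifted (c : R) x y z : (0 <= c)%R ->
  \int[mubar]_eta (c * (site_gain x z eta + site_rate x eta * b y))%:E =
  c%:E * gain x z + (c * (vbar * b y))%:E.
Proof.
move=> c0; under eq_integral do rewrite EFinM EFinD EFinM.
have mSb : measurable_fun setT (fun eta => (site_rate x eta)%:E * (b y)%:E).
  by apply: emeasurable_funM; [exact: measurable_site_rate|exact: measurable_cst].
rewrite ge0_integralZl_EFin//; first last.
- by apply: emeasurable_funD => //; exact: measurable_site_gain.
- by move=> eta _; rewrite adde_ge0 ?mule_ge0 ?lee_fin ?site_gain_ge0 ?site_rate_ge0.
rewrite ge0_integralD//; first last.
- by move=> eta _; rewrite mule_ge0 ?lee_fin ?site_rate_ge0.
- exact: measurable_site_gain.
- by move=> eta _; rewrite lee_fin site_gain_ge0.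
rewrite ge0_muleDr ?gain_ge0//; last first.
  by apply: integral_ge0 => eta _; rewrite mule_ge0 ?lee_fin ?site_rate_ge0.
congr (_ + _); under eq_integral do rewrite muleC.
rewrite ge0_integralZl_EFin//; first last.
- exact: measurable_site_rate.
- by move=> eta _; rewrite lee_fin site_rate_ge0.
by rewrite site_rate_mean -!EFinM (mulrC vbar).
Qed.

Let intA : \int[mubar]_(eta in Y) (\esum_(xy in [set: lattice d * lattice d]) (A xy eta)%:E) =
  \esum_(xy in [set: lattice d * lattice d]) ((p xy.1 xy.2)%:E * gain xy.1 xy.2) +
  vbar%:E * S.
Proof.
rewrite integral_full; first last.
- by move=> eta; apply: esum_ge0 => xy _; rewrite lee_fin.
- by apply: measurable_esum => // xy eta _; rewrite lee_fin.
rewrite ge0_integral_esum//; last by move=> xy eta _; rewrite lee_fin.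
under eq_esum do rewrite /A integral_shifted//.
rewrite esumD; first last.
- by move=> xy _; rewrite lee_fin !mulr_ge0 ?vbar_ge0.
- by move=> xy _; rewrite mule_ge0 ?gain_ge0 ?lee_fin.
congr (_ + _); rewrite (esum_row (u := fun x => vbar * b x)%R); last first.
  by move=> x; rewrite mulr_ge0 ?vbar_ge0.
by under eq_esum do rewrite EFinM; rewrite esumZl ?vbar_ge0.
Qed.

Let intB : \int[mubar]_(eta in Y) (\esum_(xy in [set: lattice d * lattice d]) (B xy eta)%:E) =
  \esum_(x in [set: lattice d]) gain x x + vbar%:E * S.
Proof.
rewrite integral_full; first last.
- by move=> eta; apply: esum_ge0 => xy _; rewrite lee_fin.
- by apply: measurable_esum => // xy eta _; rewrite lee_fin.
rewrite ge0_integral_esum//; last by move=> xy eta _; rewrite lee_fin.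
under eq_esum do rewrite /B integral_shifted//.
rewrite esumD; first last.
- by move=> xy _; rewrite lee_fin !mulr_ge0 ?vbar_ge0.
- by move=> xy _; rewrite mule_ge0 ?gain_ge0 ?lee_fin.
have gf x : gain x x = (fine (gain x x))%:E.
  rewrite fineK// ge0_fin_numE ?gain_ge0//.
  by rewrite (le_lt_trans (gain_le x x)) ?ltry.
congr (_ + _).
  under eq_esum => xy _ do rewrite gf -EFinM.
  rewrite (esum_row (u := fun x => fine (gain x x))).
    by apply: eq_esum => x _; rewrite -gf.
  by move=> x; rewrite fine_ge0 ?gain_ge0.
under eq_esum do rewrite EFinM.
rewrite (esum_col (u := fun x => (vbar * b x)%:E))//; last first.
  by move=> x; rewrite lee_fin mulr_ge0 ?vbar_ge0.
by under eq_esum do rewrite EFinM; rewrite esumZl ?vbar_ge0.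
Qed.

(** The a priori bounds contribute equally to both sides because each row and
    each column of [p] sums to one, so they cancel. *)
Lemma integral_generator :
  \int[mubar]_(eta in Y) (mmp_generator p (zrp g) f eta)%:E =
  \esum_(xy in [set: lattice d * lattice d]) ((p xy.1 xy.2)%:E * gain xy.1 xy.2) -
  \esum_(x in [set: lattice d]) gain x x.
Proof.
have S_ge0 : 0 <= S by apply: esum_ge0 => x _; rewrite lee_fin.
have vSfin : vbar%:E * S \is a fin_num.
  by rewrite fin_numM// ge0_fin_numE.
pose SA eta := \esum_(xy in [set: lattice d * lattice d]) (A xy eta)%:E.
pose SB eta := \esum_(xy in [set: lattice d * lattice d]) (B xy eta)%:E.
have SA0 eta : 0 <= SA eta by apply: esum_ge0 => xy _; rewrite lee_fin.
have SB0 eta : 0 <= SB eta by apply: esum_ge0 => xy _; rewrite lee_fin.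
have mSA : measurable_fun setT SA.
  by apply: measurable_esum => // xy eta _; rewrite lee_fin.
have mSB : measurable_fun setT SB.
  by apply: measurable_esum => // xy eta _; rewrite lee_fin.
have genE eta : Y eta -> (mmp_generator p (zrp g) f eta)%:E = SA eta - SB eta.
  move=> Yeta; rewrite /mmp_generator.
  rewrite (_ : (fun xy : lattice d * lattice d => _) = (fun xy => A xy eta - B xy eta)%R).
    have := @unordered_sumB R (lattice d * lattice d)%type (A ^~ eta) (B ^~ eta).
    move=> /(_ (fun xy => A0 xy eta) (fun xy => B0 xy eta) (sumA Yeta) (sumB Yeta)) ->.
    have fA : SA eta \is a fin_num by rewrite (ge0_fin_numE (SA0 eta)); exact: sumA.
    have fB : SB eta \is a fin_num by rewrite (ge0_fin_numE (SB0 eta)); exact: sumB.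
    by rewrite EFinB (fineK fA) (fineK fB).
  by apply/funext => -[x y]; exact: generator_term.
under eq_integral => eta /[!inE] Yeta do rewrite genE//.
have Afin : \int[mubar]_(eta in Y) SA eta < +oo.
  by rewrite intA lte_add_pinfty ?gain_sum_lty// -ge0_fin_numE// mule_ge0 ?lee_fin ?vbar_ge0.
have Bfin : \int[mubar]_(eta in Y) SB eta < +oo.
  by rewrite intB lte_add_pinfty ?gain_diag_lty// -ge0_fin_numE// mule_ge0 ?lee_fin ?vbar_ge0.
rewrite integralB//; first last.
- apply/integrableP; split; first exact: measurable_funTS.
  by under eq_integral do rewrite gee0_abs//.
- apply/integrableP; split; first exact: measurable_funTS.
  by under eq_integral do rewrite gee0_abs//.
by rewrite intA intB fin_num_oppeD// addeACA subee// adde0.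
Qed.


End generator_integral.

(** * Stationarity under product measures *)

Section columns.
Context {R : realType} {d : nat}.
Variable p : lattice d -> lattice d -> R.

(** The point reflection [x |-> 2 y - x] exchanges the rows and the columns of a
    translation-invariant kernel. *)
Lemma translation_invariant_col : kernel_translation_invariant p ->
  (forall x, \esum_(y in [set: lattice d]) (p x y)%:E = 1%E) ->
  forall y, \esum_(x in [set: lattice d]) (p x y)%:E = 1%E.
Proof.
move=> pinv prow y; rewrite -(prow y).
rewrite [RHS](reindex_esum setT setT (fun x => y + y - x)).
  apply: eq_esum => x _; rewrite -(pinv x y (y - x)).
  by rewrite addrC subrK addrA.
split=> // [x x' _ _ /addrI /oppr_inj//|x _].
by exists (y + y - x) => //; rewrite opprB addrC subrK.
Qed.

End columns.

Section back_rates.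
Context {R : realType}.

(** [back_rate g mu k n] is the rate at which, in the time-reversed dynamics,
    [k] particles are put back on a site which holds [n] of them. *)
Definition back_rate (g : nat -> nat -> R) (mu : probability nat R) k n : R :=
  g k (n + k)%N * mass mu (n + k) / mass mu n.

End back_rates.

Section product_gain.
Context {R : realType} {d : nat}.
Variables (p : lattice d -> lattice d -> R) (g : nat -> nat -> R).
Hypothesis p_ge0 : forall x y, 0 <= p x y.
Hypothesis p_row : forall x, \esum_(y in [set: lattice d]) (p x y)%:E = 1%E.
Hypothesis p_col : forall y, \esum_(x in [set: lattice d]) (p x y)%:E = 1%E.
Hypothesis g_rates : mmp_rates (zrp g).
Variables (mu : probability nat R) (mubar : probability (config d) R).
Hypothesis mubarE : product_measure (fun=> mu) mubar.
Hypothesis mu_gt0 : forall n, 0 < mass mu n.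
Implicit Types (x y z : lattice d) (k n : nat) (eta xi : config d).

Lemma back_rate_ge0 k n : 0 <= back_rate g mu k n.
Proof. by rewrite mulr_ge0 ?invr_ge0 ?mulr_ge0 ?mass_ge0 ?(rate_ge0 g_rates). Qed.

Local Open Scope ereal_scope.

Lemma mubar_coord x n : mubar [set eta | eta x = n] = (mass mu n)%:E.
Proof.
have := product_cylinder mubarE (F := [:: x]) (fun=> n) isT.
by rewrite big_seq1 cylinder_set_cons cylinder_set_nil setIT.
Qed.

Lemma integral_coord x (h : nat -> \bar R) : (forall n, 0 <= h n) ->
  \int[mubar]_eta h (eta x) = \esum_(n in [set: nat]) (h n * (mass mu n)%:E).
Proof.
move=> h0; have -> : [set: config d] = \bigcup_n [set eta : config d | eta x = n].
  by apply/seteqP; split=> // eta _; exists (eta x).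
rewrite ge0_integral_bigcup; first last.
- by apply/trivIsetP => i j _ _ /eqP ij; apply/seteqP; split=> // eta [/= ->].
- by move=> eta _; exact: h0.
- by apply: measurable_funTS; exact: (measurable_fun_coord h x).
- by move=> n; exact: measurable_coord_set.
rewrite nneseries_esumT; last by move=> n; apply: integral_ge0 => eta _.
apply: eq_esum => n _.
under eq_integral => eta /[!inE] /= en do rewrite en.
rewrite integral_cst; last exact: measurable_coord_set.
by rewrite [X in _ * X]mubar_coord.
Qed.

Variables (f : config d -> R) (om : nat -> R) (b : lattice d -> R).
Hypothesis mf : measurable_fun setT f.
Hypothesis om_ge0 : forall k, (0 <= om k)%R.
Hypothesis b_ge0 : forall x, (0 <= b x)%R.
Hypothesis fD : forall k x xi, (`|f (add_particles k x xi) - f xi| <= om k * b x)%R.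

(** The change of variables that removes the particles at the departure site. *)
Lemma gainE x y : gain g f om b mubar x y = \esum_(k in [set: nat])
  (\int[mubar]_xi ((back_rate g mu k (xi x))%:E * (shifted_gain f om b k y xi)%:E)).
Proof.
rewrite /gain; under eq_integral => eta _ do rewrite (site_gainE g_rates fD).
have P0 k z xi : (0 <= shifted_gain f om b k z xi)%R by exact: shifted_gain_ge0.
have mP k z : measurable_fun setT (fun xi => (shifted_gain f om b k z xi)%:E).
  by apply/measurable_EFinP; exact: measurable_shifted_gain.
have mgP k : measurable_fun setT (fun eta : config d => (g k (eta x))%:E *
    (shifted_gain f om b k y (rem_particles k x eta))%:E).
  apply: emeasurable_funM; first exact: (measurable_fun_coord (fun n => (g k n)%:E) x).
  apply/measurable_EFinP; apply: measurableT_comp.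
    exact: measurable_shifted_gain.
  exact: measurable_rem_particles.
rewrite ge0_integral_esum//; last first.
  by move=> k eta _; rewrite mule_ge0 ?lee_fin// (rate_ge0 g_rates).
apply: eq_esum => k _.
rewrite -(integral_rem_particles mubarE mu_gt0 k x (rate_ge0 g_rates k) (mP k y)); last first.
  by move=> xi; rewrite lee_fin.
have mD : measurable [set eta : config d | (k <= eta x)%N].
  have := @measurable_coord d x measurableT [set m | (k <= m)%N] I.
  by rewrite setTI.
rewrite [RHS]integral_mkcond; apply: eq_integral => eta _; rewrite patchE.
case: ifPn => // /negP; rewrite inE /= => /negP; rewrite -ltnNge => kx.
by have [_ _ _ /(_ k (eta x) 0%N kx)] := g_rates; rewrite /zrp => ->; rewrite mul0e.
Qed.

Variables (Y : set (config d)) (vbar : R).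
Hypothesis mY : measurable Y.
Hypothesis mubarY : mubar Y = 1.
Hypothesis site_rate_mean : forall x, \int[mubar]_eta (site_rate g om x eta)%:E = vbar%:E.
Hypothesis b_sum : \esum_(x in [set: lattice d]) (b x)%:E < +oo.
Hypothesis rate_row_sum : forall eta, Y eta ->
  \esum_(x in [set: lattice d]) (site_rate g om x eta * b x)%:E < +oo.
Hypothesis rate_col_sum : forall eta, Y eta ->
  \esum_(xy in [set: lattice d * lattice d])
     (p xy.1 xy.2 * (site_rate g om xy.1 eta * b xy.2))%:E < +oo.

(** If the backward rates do not depend on the number of particles, then the
    departure site does not influence what it sends out, and only the column
    sums of [p] matter. *)
Lemma stationary_constant_back_rate :
  (forall k n, back_rate g mu k n = back_rate g mu k 0) ->
  \int[mubar]_(eta in Y) (mmp_generator p (zrp g) f eta)%:E = 0.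
Proof.
move=> wconst.
rewrite (integral_generator p_ge0 p_row p_col g_rates mf om_ge0 b_ge0 fD mY mubarY
  site_rate_mean b_sum rate_row_sum rate_col_sum).
have gainx x y : gain g f om b mubar x y = gain g f om b mubar y y.
  rewrite !gainE; apply: eq_esum => k _; apply: eq_integral => xi _.
  by rewrite wconst (wconst k (xi y)).
have diag_lty := gain_diag_lty g_rates mf om_ge0 b_ge0 fD site_rate_mean b_sum.
have g0 x y := gain_ge0 g_rates fD mubar x y.
under eq_esum do rewrite gainx.
rewrite (esum_col p_ge0 p_col (u := fun y => gain g f om b mubar y y)).
- rewrite subee// ge0_fin_numE//; apply: esum_ge0 => x _; exact: g0.
- by move=> y; exact: g0.
move=> y; rewrite ge0_fin_numE//.
by rewrite (le_lt_trans (gain_le g_rates mf om_ge0 b_ge0 fD site_rate_mean y y)) ?ltry.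
Qed.

End product_gain.

(** * Summability of the jump rates *)

Section summability_conditions.
Context {R : realType} {d : nat}.
Variables (p : lattice d -> lattice d -> R) (g : nat -> nat -> R).
Hypothesis p_ge0 : forall x y, 0 <= p x y.
Hypothesis p_col : forall y, \esum_(x in [set: lattice d]) (p x y)%:E = 1%E.
Hypothesis g_rates : mmp_rates (zrp g).
Variables (mu : probability nat R) (mubar : probability (config d) R).
Hypothesis mubarE : product_measure (fun=> mu) mubar.
Implicit Types (x y z : lattice d) (k n : nat) (eta xi : config d).
Implicit Types (om : nat -> R) (b : lattice d -> R).

Local Open Scope ereal_scope.

(** The bounds [om k * b x] on the effect of adding [k] particles at [x] make the
    generator an absolutely convergent sum, on the configurations of [Y] and in
    the mean. *)
Record admissible_bound om b (Y : set (config d)) (vbar : R) : Prop := {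
  bound_mean : forall x, \int[mubar]_eta (site_rate g om x eta)%:E = vbar%:E ;
  bound_sum : \esum_(x in [set: lattice d]) (b x)%:E < +oo ;
  bound_row : forall eta, Y eta ->
    \esum_(x in [set: lattice d]) (site_rate g om x eta * b x)%:E < +oo ;
  bound_col : forall eta, Y eta ->
    \esum_(xy in [set: lattice d * lattice d])
      (p xy.1 xy.2 * (site_rate g om xy.1 eta * b xy.2))%:E < +oo
}.

(** All sites have the same law, hence the same mean rate. *)
Lemma site_rate_meanE om (B : nat -> R) : (forall k, 0 <= om k)%R ->
  (forall x eta, site_rate g om x eta <= B (eta x))%R ->
  \esum_(n in [set: nat]) (B n * mass mu n)%:E < +oo ->
  exists vbar : R, forall x, \int[mubar]_eta (site_rate g om x eta)%:E = vbar%:E.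
Proof.
move=> om0 rB Blty.
pose h n := (\sum_(1 <= k < n.+1) g k n * om k)%:E.
have h0 n : 0 <= h n.
  by rewrite lee_fin sumr_ge0// => k _; rewrite mulr_ge0 ?(rate_ge0 g_rates).
have hE x : \int[mubar]_eta (site_rate g om x eta)%:E =
    \esum_(n in [set: nat]) (h n * (mass mu n)%:E).
  exact: (integral_coord mubarE x h0).
have hlty : \esum_(n in [set: nat]) (h n * (mass mu n)%:E) < +oo.
  apply: le_lt_trans Blty; apply: le_esum => n _.
  rewrite -EFinM lee_fin ler_wpM2r ?mass_ge0//.
  exact: (rB (0 : lattice d)%R (fun=> n)).
exists (fine (\esum_(n in [set: nat]) (h n * (mass mu n)%:E))) => x.
rewrite hE fineK// ge0_fin_numE//; apply: esum_ge0 => n _.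
by apply: mule_ge0 => //; rewrite lee_fin mass_ge0.
Qed.

Lemma esum_mass : \esum_(n in [set: nat]) (mass mu n)%:E = 1.
Proof.
have := integral_coord mubarE (0 : lattice d)%R (h := fun=> 1) (fun=> lee01).
rewrite integral_cst// mul1e => E; rewrite -[RHS](probability_setT mubar) [RHS]E.
by apply: eq_esum => n _; rewrite mul1e.
Qed.

Lemma bounded_admissible b : bounded_rates (zrp g) -> (forall x, 0 <= b x)%R ->
  \esum_(x in [set: lattice d]) (b x)%:E < +oo ->
  exists vbar, admissible_bound (fun=> 1%R) b setT vbar.
Proof.
move=> [C C0 gC] b0 bsum.
have om0 k : (0 <= (fun=> 1 : R) k)%R by [].
have rC x eta : (site_rate g (fun=> 1%R) x eta <= C)%R.
  apply: le_trans (gC (eta x) 0%N).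
  have [_ z0 _ _] := g_rates.
  rewrite big_nat_recl//= z0 add0r /zrp /site_rate big_add1 /=.
  by under eq_bigr do rewrite mulr1.
have [|vbar vE] := @site_rate_meanE (fun=> 1%R) (fun=> C) om0 rC.
  under eq_esum do rewrite EFinM.
  rewrite esumZl; last exact: ltW.
    by rewrite esum_mass mule1 ltry.
  by move=> n; rewrite lee_fin mass_ge0.
exists vbar; split=> // eta _.
  apply: (@le_lt_trans _ _ (\esum_(x in [set: lattice d]) (C%:E * (b x)%:E))).
    by apply: le_esum => x _; rewrite -EFinM lee_fin ler_wpM2r.
  rewrite esumZl; [|by move=> x; rewrite lee_fin|exact: ltW].
  by apply: lte_mul_pinfty => //; rewrite lee_fin ltW.
apply: (@le_lt_trans _ _ (\esum_(xy in [set: lattice d * lattice d])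
    ((p xy.1 xy.2)%:E * (C * b xy.2)%:E))).
  by apply: le_esum => xy _; rewrite -EFinM lee_fin ler_wpM2l// ler_wpM2r.
rewrite (esum_col p_ge0 p_col (u := fun y => (C * b y)%:E))//; last first.
  by move=> y; rewrite lee_fin mulr_ge0// ltW.
under eq_esum do rewrite EFinM.
rewrite esumZl; [|by move=> x; rewrite lee_fin|exact: ltW].
by apply: lte_mul_pinfty => //; rewrite lee_fin ltW.
Qed.

Section weights.
Variables (a : lattice d -> R) (M : R).
Hypothesis aM : admissible_weight p a M.

Lemma weight_gt0 x : (0 < a x)%R. Proof. by have [a0 _ _ _] := aM. Qed.
Lemma weight_ge0 x : (0 <= a x)%R. Proof. exact/ltW/weight_gt0. Qed.

Lemma config_norm_ge0 eta : 0 <= config_norm a eta.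
Proof. by apply: esum_ge0 => x _; rewrite lee_fin mulr_ge0 ?weight_ge0. Qed.

Lemma measurable_config_norm :
  measurable_fun setT (fun eta : config d => config_norm a eta).
Proof.
apply: measurable_esum => [x eta _|x].
  by rewrite lee_fin mulr_ge0 ?weight_ge0.
exact: (measurable_fun_coord (fun n => (n%:R * a x)%:E) x).
Qed.

Lemma measurable_finite_configs : measurable (finite_configs a).
Proof.
rewrite -[finite_configs a]setTI.
apply: (@measurable_config_norm measurableT [set y : \bar R | y < +oo]).
rewrite (_ : [set y | _] = [set` Interval -oo%O (BLeft (+oo : \bar R))]); first exact: emeasurable_itv.
by apply/seteqP; split=> y; rewrite /= in_itv.
Qed.

Hypothesis mu_mean : finite_mean mu.

Lemma esum_mean_lty : \esum_(n in [set: nat]) (n%:R * mass mu n)%:E < +oo.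
Proof.
rewrite -nneseries_esumT//.
by move=> n; rewrite lee_fin mulr_ge0 ?mass_ge0.
Qed.

Lemma config_norm_mean : \int[mubar]_eta config_norm a eta < +oo.
Proof.
rewrite ge0_integral_esum//; first last.
- by move=> x eta _; rewrite lee_fin mulr_ge0 ?weight_ge0.
- by move=> x; exact: (measurable_fun_coord (fun n => (n%:R * a x)%:E) x).
pose m := \esum_(n in [set: nat]) (n%:R * mass mu n)%:E.
have m0 : 0 <= m by apply: esum_ge0 => n _; rewrite lee_fin mulr_ge0 ?mass_ge0.
have mfin : m \is a fin_num by rewrite ge0_fin_numE ?esum_mean_lty.
rewrite [X in X < _](_ : _ = \esum_(x in [set: lattice d]) (m * (a x)%:E)).
  rewrite -(fineK mfin) esumZl ?fine_ge0//; last first.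
    by move=> x; rewrite lee_fin weight_ge0.
  by have [_ _ _ asum] := aM; apply: lte_mul_pinfty => //; rewrite lee_fin fine_ge0.
apply: eq_esum => x _.
rewrite (integral_coord mubarE x (h := fun n => (n%:R * a x)%:E)); last first.
  by move=> n; rewrite lee_fin mulr_ge0 ?weight_ge0.
rewrite -esumZr ?weight_ge0//; last by move=> n; rewrite lee_fin mulr_ge0 ?mass_ge0.
by apply: eq_esum => n _; rewrite -!EFinM mulrAC.
Qed.

Lemma mubar_finite_configs : mubar (finite_configs a) = 1.
Proof.
have mN := measurable_config_norm.
have /integrable_ae : mubar.-integrable setT (fun eta => config_norm a eta).
  apply/integrableP; split=> //.
  by under eq_integral do rewrite gee0_abs ?config_norm_ge0//; exact: config_norm_mean.
move=> /(_ measurableT)[N [mNN N0 subN]].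
have {}N0 : mubar (~` finite_configs a) = 0.
  apply: (subset_measure0 _ mNN _ N0); first by apply: measurableC; exact: measurable_finite_configs.
  move=> eta Neta; apply: subN => /(_ I) fin; apply: Neta.
  by rewrite /finite_configs /= -ge0_fin_numE ?config_norm_ge0.
have := probability_setC mubar (measurable_finite_configs).
have mfin : mubar (finite_configs a) \is a fin_num.
  exact: (fin_num_measure mubar _ measurable_finite_configs).
rewrite N0 -(fineK mfin) => /esym; rewrite -EFinB => -[] E; congr _%:E.
by lra.
Qed.

(** The growth bound makes the rate at [x] at most proportional to [eta x], and the
    weight condition bounds the weights of the arrival sites, averaged over [p],
    by the weight of the departure site; both sums are thus dominated by the norm
    of the configuration. *)
Lemma growth_admissible om b (L c : R) : growth_bound (zrp g) ->
  (forall k, 0 <= om k)%R -> (forall k, (0 < k)%N -> om k <= L * k%:R)%R ->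
  (0 <= c)%R -> (forall x, 0 <= b x)%R -> (forall x, b x <= c * a x)%R ->
  exists vbar, admissible_bound om b (finite_configs a) vbar.
Proof.
move=> [C C0 gC] om0 omL c0 b0 bc.
have L0 : (0 <= L)%R by have := omL 1%N isT; rewrite mulr1; exact: le_trans.
pose D := (L * C)%R.
have D0 : (0 <= D)%R by rewrite mulr_ge0// ltW.
have rD x eta : (site_rate g om x eta <= D * (eta x)%:R)%R.
  rewrite /site_rate; case: (posnP (eta x)) => [->|etax].
    by rewrite big_geq// mulr0.
  apply: (@le_trans _ _ (\sum_(1 <= k < (eta x).+1) L * (k%:R * g k (eta x)))%R).
    apply: ler_sum_nat => k /andP[k0 _].
    by rewrite mulrA mulrC ler_wpM2r ?(rate_ge0 g_rates)// omL.
  rewrite -mulr_sumr -mulrA ler_wpM2l//.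
  by have := gC (eta x) 0%N etax; rewrite addn0.
have [_ M0 aMx asum] := aM.
have [|vbar vE] := @site_rate_meanE om (fun n => D * n%:R)%R om0 rD.
  under eq_esum do rewrite -mulrA EFinM.
  rewrite esumZl//; last by move=> n; rewrite lee_fin mulr_ge0 ?mass_ge0.
  by apply: lte_mul_pinfty; rewrite ?lee_fin ?esum_mean_lty.
have Dc0 : (0 <= D * c)%R by rewrite mulr_ge0.
exists vbar; split=> //.
- apply: (@le_lt_trans _ _ (\esum_(x in [set: lattice d]) (c%:E * (a x)%:E))).
    by apply: le_esum => x _; rewrite -EFinM lee_fin.
  rewrite esumZl//; last by move=> x; rewrite lee_fin weight_ge0.
  by apply: lte_mul_pinfty.
- move=> eta Yeta.
  apply: (@le_lt_trans _ _ (\esum_(x in [set: lattice d])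
      ((D * c)%:E * ((eta x)%:R * a x)%:E))).
    apply: le_esum => x _; rewrite -EFinM lee_fin mulrACA.
    by rewrite ler_pM// /site_rate sumr_ge0// => k _; rewrite mulr_ge0 ?(rate_ge0 g_rates).
  rewrite esumZl//; last by move=> x; rewrite lee_fin mulr_ge0 ?weight_ge0.
  by apply: lte_mul_pinfty.
- move=> eta Yeta.
  apply: (@le_lt_trans _ _ (\esum_(xy in [set: lattice d * lattice d])
      ((D * c)%:E * ((eta xy.1)%:R * (p xy.1 xy.2 * a xy.2))%:E))).
    apply: le_esum => -[x y] _ /=; rewrite -EFinM lee_fin.
    rewrite (_ : D * c * _ = p x y * ((D * (eta x)%:R) * (c * a y)))%R; last by ring.
    rewrite ler_wpM2l// ler_pM//.
    by rewrite /site_rate sumr_ge0// => k _; rewrite mulr_ge0 ?(rate_ge0 g_rates).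
  rewrite esumZl//; last first.
    by move=> xy; rewrite lee_fin !mulr_ge0 ?weight_ge0.
  apply: lte_mul_pinfty => //.
  rewrite (esum_prod (u := fun x y => ((eta x)%:R * (p x y * a y))%:E)); last first.
    by move=> x y; rewrite lee_fin !mulr_ge0 ?weight_ge0.
  apply: (@le_lt_trans _ _ (\esum_(x in [set: lattice d])
      (M%:E * ((eta x)%:R * a x)%:E))).
    apply: le_esum => x _; under eq_esum do rewrite EFinM.
    rewrite esumZl//; last by move=> y; rewrite lee_fin mulr_ge0 ?weight_ge0.
    rewrite -EFinM mulrCA EFinM lee_wpmul2l ?lee_fin//.
    apply: le_trans (aMx x); rewrite leeDl//.
    by apply: esum_ge0 => y _; rewrite lee_fin mulr_ge0 ?weight_ge0.
  rewrite esumZl//; [|by move=> x; rewrite lee_fin mulr_ge0 ?weight_ge0|exact: ltW].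
  by apply: lte_mul_pinfty => //; rewrite lee_fin ltW.
Qed.

End weights.
End summability_conditions.

(** * Lipschitz functions of configurations *)

Section lipschitz_functions_theory.
Context {R : realType} {d : nat}.
Variables (p : lattice d -> lattice d -> R) (a : lattice d -> R) (M : R).
Hypothesis aM : admissible_weight p a M.
Implicit Types (x y z : lattice d) (k n : nat) (eta xi : config d).
Local Notation Y := (finite_configs a).
Local Notation D := (lipschitz_functions a Y).

Let a_gt0 x : 0 < a x := weight_gt0 aM x.
Let a_ge0 x : 0 <= a x := weight_ge0 aM x.

Local Open Scope ereal_scope.

Lemma config_dist_ge0 eta xi : 0 <= config_dist a eta xi.
Proof. by apply: esum_ge0 => x _; rewrite lee_fin mulr_ge0. Qed.

Lemma config_norm_le eta xi : (forall x, (eta x <= xi x)%N) ->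
  config_norm a eta <= config_norm a xi.
Proof.
move=> le; apply: le_esum => x _; rewrite lee_fin ler_wpM2r//.
by rewrite ler_nat.
Qed.

Lemma config_norm_add k z xi :
  config_norm a (add_particles k z xi) = config_norm a xi + (k%:R * a z)%:E.
Proof.
pose u x : \bar R := if x == z then (k%:R * a z)%:E else 0.
have u0 x : 0 <= u x by rewrite /u; case: ifP => // _; rewrite lee_fin mulr_ge0.
transitivity (\esum_(x in [set: lattice d]) (((xi x)%:R * a x)%:E + u x)).
  apply: eq_esum => x _; rewrite /u /add_particles.
  by case: eqVneq => [->|_]; rewrite ?adde0// natrD mulrDl EFinD.
rewrite esumD => [|x _|x _]; [|by rewrite lee_fin mulr_ge0|exact: u0].
congr (_ + _); rewrite (esum_unique (i0 := z)) ?u0//; first by rewrite /u eqxx.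
by move=> x /negbTE xz; rewrite /u xz.
Qed.

Lemma config_dist_add k z xi :
  config_dist a (add_particles k z xi) xi = (k%:R * a z)%:E.
Proof.
rewrite /config_dist (esum_unique (i0 := z)).
- by rewrite /add_particles eqxx natrD addrAC subrr add0r normr_nat.
- by rewrite lee_fin mulr_ge0.
by move=> x /negbTE xz; rewrite /add_particles xz subrr normr0 mul0r.
Qed.

Lemma finite_configs_add k z xi : Y (add_particles k z xi) <-> Y xi.
Proof.
rewrite /finite_configs /= config_norm_add; split; last first.
  by move=> ?; rewrite lte_add_pinfty ?ltry.
by apply: le_lt_trans; rewrite leeDl// lee_fin mulr_ge0.
Qed.

Lemma finite_configs_rem k x eta : Y eta -> Y (rem_particles k x eta).
Proof.
apply: le_lt_trans; apply: config_norm_le => z; rewrite /rem_particles.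
by case: eqP => [->|//]; exact: leq_subr.
Qed.

Lemma finite_configs_move k x y eta : Y eta -> Y (move_particles k x y eta).
Proof.
move=> Yeta; have [kx|kx] := leqP k (eta x).
  by rewrite move_particlesE//; apply/finite_configs_add/finite_configs_rem.
by rewrite /move_particles leqNgt kx.
Qed.

(** Restricting a configuration of finite norm to larger and larger boxes
    approximates it in the distance, which makes every Lipschitz function a
    pointwise limit of cylinder functions. *)
Definition box d (n : nat) : seq (lattice d) := pmap (@pickle_inv (lattice d)) (iota 0 n).
Definition restrict_box n eta : config d :=
  fun x => if (pickle x < n)%N then eta x else 0%N.

Lemma mem_box n x : (pickle x < n)%N -> x \in box d n.
Proof.
move=> xn; rewrite /box mem_pmap; apply/mapP.
by exists (pickle x); rewrite ?mem_iota// pickleK_inv.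
Qed.

Lemma restrict_box_cylinder n (f : config d -> R) :
  cylinder_function (f \o restrict_box n).
Proof.
exists (box d n) => eta xi e /=; congr f; apply/funext => x.
by rewrite /restrict_box; case: ifP => // xn; apply: e; exact: mem_box.
Qed.

(** The distance to the restriction is the tail of the series of the norm. *)
Lemma restrict_box_dist eta : Y eta ->
  config_dist a eta (restrict_box n eta) @[n --> \oo] --> 0.
Proof.
move=> Yeta.
pose v m := oapp (fun x => ((eta x)%:R * a x)%:E) 0 (@pickle_inv (lattice d) m).
have v0 m : 0 <= v m.
  by rewrite /v; case: pickle_inv => //= x; rewrite lee_fin mulr_ge0.
have vlty : \sum_(m <oo) v m < +oo.
  rewrite -(esum_countE (u := fun x : lattice d => ((eta x)%:R * a x)%:E))//.
  by move=> x; rewrite lee_fin mulr_ge0.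
rewrite (_ : (fun n => _) = fun n => \sum_(n <= m <oo) v m).
  by apply: nneseries_tail_cvg => // m _.
apply/funext => n; rewrite /config_dist esum_countE; last first.
  by move=> x; rewrite lee_fin mulr_ge0.
rewrite [RHS](_ : _ = \sum_(m <oo) (if (n <= m)%N then v m else 0)).
  apply: eq_eseriesr => m _; rewrite /v.
  have := pickle_invK (T := lattice d) m.
  case: pickle_inv => [x|] /=; last by case: ifP.
  move=> <-; rewrite /restrict_box; case: (leqP n (pickle x)) => nx /=.
    by rewrite mulr0n subr0 normr_nat.
  by rewrite subrr normr0 mul0r.
apply/congr_lim/funext => N; by rewrite -big_mkcond [LHS](@big_nat_widenl _ _ _ n 0%N).
Qed.

Lemma finite_configs_restrict n eta : Y eta -> Y (restrict_box n eta).
Proof.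
apply: le_lt_trans; apply: config_norm_le => z; rewrite /restrict_box.
by case: ifP.
Qed.

Lemma measurable_lipschitz (f : config d -> R) : D f -> measurable_fun Y f.
Proof.
move=> [L [L0 fL]].
apply: (@measurable_fun_cvg _ _ _ Y (fun n => f \o restrict_box n)).
  move=> n; apply: measurable_funTS.
  by apply: measurable_cylinder_function; exact: restrict_box_cylinder.
move=> eta Yeta.
have dist0 : (`|f eta - f (restrict_box n eta)|)%:E @[n --> \oo] --> 0.
  apply: (@squeeze_cvge _ _ _ _ (cst 0) _
    (fun n => L%:E * config_dist a eta (restrict_box n eta))).
  - apply: nearW => n; rewrite lee_fin normr_ge0 /=.
    by apply: fL => //; exact: finite_configs_restrict.
  - exact: cvg_cst.
  - rewrite -[X in _ --> X](mule0 L%:E); apply: cvgeZl => //.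
    exact: restrict_box_dist.
have {}dist0 : (f eta - f (restrict_box n eta))%R @[n --> \oo] --> (0 : R)%R.
  by apply/norm_cvg0P; exact: (fine_cvg dist0).
rewrite (_ : (fun n => _) = fun n => f eta - (f eta - f (restrict_box n eta)))%R.
  by rewrite -[X in _ --> X]subr0; apply: cvgB => //; exact: cvg_cst.
by apply/funext => n /=; rewrite subKr.
Qed.

(** Extending by zero outside the configurations of finite norm costs nothing:
    adding finitely many particles does not change whether the norm is finite. *)
Lemma measurable_lipschitz_patch (f : config d -> R) : D f ->
  measurable_fun setT (f \_ Y).
Proof.
move=> Df; have mY := measurable_finite_configs aM.
by apply: (measurable_restrictT f mY).1; exact: measurable_lipschitz.
Qed.

Lemma lipschitz_patch_add (f : config d -> R) L k z xi : is_lipschitz a Y L f ->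
  (`|(f \_ Y) (add_particles k z xi) - (f \_ Y) xi| <= L * k%:R * a z)%R.
Proof.
move=> [L0 fL]; rewrite !patchE.
have [Yxi|Yxi] := pselect (Y xi).
  have Yadd : Y (add_particles k z xi) by apply/finite_configs_add.
  rewrite !mem_set// -lee_fin -mulrA EFinM -(config_dist_add k z xi).
  exact: fL.
have Yadd : ~ Y (add_particles k z xi) by move/finite_configs_add.
by rewrite !memNset// subrr normr0 !mulr_ge0// ltW.
Qed.

Lemma generator_patch g (f : config d -> R) eta : Y eta ->
  mmp_generator p g (f \_ Y) eta = mmp_generator p g f eta.
Proof.
move=> Yeta; rewrite /mmp_generator; congr unordered_sum; apply/funext => xy.
apply: eq_bigr => k _; rewrite !patchE !mem_set//.
exact: finite_configs_move.
Qed.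

Lemma config_dist_ge x eta xi : eta x != xi x -> (a x)%:E <= config_dist a eta xi.
Proof.
move=> ne; apply: le_trans (le_esum_term x _); last first.
  by move=> y; rewrite lee_fin mulr_ge0.
rewrite lee_fin ler_peMl//; case: (ltngtP (eta x) (xi x)) ne => // lt _.
  by rewrite distrC -natrB ?normr_nat ?ler1n ?subn_gt0// ltnW.
by rewrite -natrB ?normr_nat ?ler1n ?subn_gt0// ltnW.
Qed.

(** Two configurations which differ at [x] are at distance at least [a x], and only
    finitely many [x] can affect the function. *)
Lemma lipschitz_cylinder (f : config d -> R) :
  cylinder_function f -> bounded_on setT f -> D f.
Proof.
move=> [F fF] [K fK].
have K0 : (0 <= K)%R by apply: le_trans (fK (fun=> 0%N) I).
pose s := (\sum_(x <- F) (a x)^-1)%R.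
have s0 : (0 <= s)%R by apply: sumr_ge0 => x _; rewrite invr_ge0.
exists (2 * K * s + 1)%R; split; first by rewrite ltr_wpDl// !mulr_ge0.
move=> eta xi _ _.
have [agree|] := boolP (all (fun x => eta x == xi x) F).
  rewrite (fF eta xi) ?subrr ?normr0.
    by rewrite mule_ge0 ?config_dist_ge0// lee_fin addr_ge0// !mulr_ge0.
  by move=> x xF; exact/eqP/(allP agree).
rewrite -has_predC => /hasP[x xF /= ne].
apply: (@le_trans _ _ ((2 * K * s + 1)%:E * (a x)%:E)); last first.
  by rewrite lee_wpmul2l ?config_dist_ge// lee_fin addr_ge0// !mulr_ge0.
rewrite -EFinM lee_fin; apply: (@le_trans _ _ (2 * K)%R).
  have := ler_normB (f eta) (f xi); move: (fK eta I) (fK xi I); lra.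
have sx : ((a x)^-1 <= s)%R.
  rewrite /s (big_rem x)//= lerDl; apply: sumr_ge0 => y _.
  by rewrite invr_ge0.
have : (1 <= s * a x)%R by rewrite -(mulVf (lt0r_neq0 (a_gt0 x))) ler_wpM2r.
have := a_gt0 x; nra.
Qed.

Lemma lipschitz_cst (c : R) : D (fun=> c).
Proof.
exists 1%R; split=> // eta xi _ _; rewrite subrr normr0 mul1e.
exact: config_dist_ge0.
Qed.

End lipschitz_functions_theory.

(** * Invariance and the generator *)

(** A function that is continuous along sequences and whose right difference
    quotients vanish along [1 / n] is constant: below any line of slope
    [eps > 0], the set where the function stays under the line is closed and can
    always be prolonged to the right. *)
Lemma right_derivative0_constant {R : realType} (phi : R -> R) :
  (forall (u : nat -> R) (s : R), (forall n, 0 <= u n) -> 0 <= s ->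
     u n @[n --> \oo] --> s -> phi (u n) @[n --> \oo] --> phi s) ->
  (forall s, 0 <= s ->
     n.+1%:R * (phi (s + n.+1%:R^-1) - phi s) @[n --> \oo] --> (0 : R)) ->
  forall t, 0 <= t -> phi t = phi 0.
Proof.
move=> phic phid t t0.
suff dom eps : 0 < eps -> `|phi t - phi 0| <= eps * t.
  apply/eqP; rewrite -subr_eq0 -normr_le0; apply/ler_addgt0Pl => e e0.
  rewrite addr0; apply: (@le_trans _ _ (e / (1 + t) * t)).
    by apply: dom; rewrite divr_gt0// ltr_wpDr.
  by rewrite -mulrA ler_piMr ?(ltW e0)// ler_pdivrMl ?ltr_wpDr// mulr1 lerDr.
move=> eps0.
pose E := [set s | 0 <= s <= t /\ `|phi s - phi 0| <= eps * s].
have E0 : E 0 by rewrite /E /= lexx t0 subrr normr0 mulr0.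
have supE : has_sup E.
  by split; [exists 0 | exists t => s [/andP[]]].
pose s := sup E.
have s0 : 0 <= s by apply: ub_le_sup => //; case: supE.
have st : s <= t by apply: ge_sup => [|x [/andP[]]//]; case: supE.
have /boolp.choice[u Eu] n : exists x, E x /\ s - n.+1%:R^-1 < x.
  have n0 : 0 < n.+1%:R^-1 :> R by rewrite invr_gt0.
  by have [x Ex xs] := sup_adherent n0 supE; exists x.
have u_le n : u n <= s by apply: ub_le_sup; [case: supE|case: (Eu n)].
have us : u n @[n --> \oo] --> s.
  apply: (@squeeze_cvgr _ _ _ _ (fun n => s - n.+1%:R^-1) (cst s)).
  - by apply: nearW => n; rewrite u_le andbT ltW//; case: (Eu n).
  - rewrite -[X in _ --> X]subr0; apply: cvgB; first exact: cvg_cst.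
    exact: cvg_harmonic.
  - exact: cvg_cst.
have u0 n : 0 <= u n by case: (Eu n) => -[/andP[]].
have phius := phic u s u0 s0 us.
have Es : `|phi s - phi 0| <= eps * s.
  have c1 : `|phi (u n) - phi 0| @[n --> \oo] --> `|phi s - phi 0|.
    by apply: cvg_norm; apply: cvgB => //; exact: cvg_cst.
  have c2 : eps * u n @[n --> \oo] --> eps * s.
    by apply: cvgM => //; exact: cvg_cst.
  rewrite -(cvg_lim _ c1)// -(cvg_lim _ c2)//; apply: ler_lim.
  - by apply/cvg_ex; eexists; exact: c1.
  - by apply/cvg_ex; eexists; exact: c2.
  - by apply: nearW => n; case: (Eu n) => -[].
move: st; rewrite le_eqVlt => /predU1P[<-//|s_lt].
exfalso.
have : \forall n \near \oo, `|n.+1%:R * (phi (s + n.+1%:R^-1) - phi s)| < eps.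
  exact: (cvgr0_norm_lt _ (phid s s0)).
have : \forall n \near \oo, n.+1%:R^-1 < t - s.
  have := @cvg_harmonic R => /cvgr_lt; apply.
  by rewrite subr_gt0.
move=> near_t near_e; have [n [nt ne]] := filter_ex (filterI near_t near_e).
have n0 : 0 < n.+1%:R^-1 :> R by rewrite invr_gt0.
have : E (s + n.+1%:R^-1).
  split.
    rewrite addr_ge0 ?(ltW n0)//=.
    by move: nt; rewrite ltrBrDl => /ltW.
  have dn : `|phi (s + n.+1%:R^-1) - phi s| <= eps * n.+1%:R^-1.
    by move: ne; rewrite normrM normr_nat mulrC -ltr_pdivlMr// => /ltW.
  rewrite mulrDr (le_trans (ler_distD (phi s) _ _))// addrC; exact: lerD.
by move=> /(ub_le_sup supE.2); rewrite -/s gerDl leNgt n0.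
Qed.


Section semigroup_invariance.
Context {R : realType} {d : nat}.
Variables (p : lattice d -> lattice d -> R) (a : lattice d -> R) (M : R).
Hypothesis aM : admissible_weight p a M.
Variables (g : nat -> nat -> nat -> R).
Variable S : R -> (config d -> R) -> config d -> R.
Hypothesis semiS : mmp_semigroup p a g S.
Variable mubar : probability (config d) R.
Implicit Types (x y z : lattice d) (k n : nat) (eta xi : config d).
Implicit Types (f h : config d -> R) (s t : R).
Local Notation Y := (finite_configs a).
Local Notation D := (lipschitz_functions a Y).
Hypothesis mubarY : mubar Y = 1%E.
Hypothesis mean_lty : (\int[mubar]_eta config_norm a eta < +oo)%E.

Let mY : measurable Y := measurable_finite_configs aM.
Let markovS := mmp_markov semiS.

Lemma semigroup_cst t (c : R) eta : 0 <= t -> Y eta -> S t (fun=> c) eta = c.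
Proof.
move=> t0 Yeta; have Yin : eta \in Y by rewrite inE.
have D1 (r : R) : D (fun=> r) := lipschitz_cst aM r.
have S0 : S t (fun=> 0) eta = 0.
  have := semigroup_linear markovS (-1) t0 (D1 1) (D1 1) Yin.
  rewrite (semigroup_cst1 markovS t0 Yin) (_ : (fun _ => _) = fun=> 0).
    by move=> ->; rewrite mulr1 addNr.
  by apply/funext => ?; rewrite mulr1 addNr.
have := semigroup_linear markovS c t0 (D1 1) (D1 0) Yin.
rewrite (semigroup_cst1 markovS t0 Yin) S0 (_ : (fun _ => _) = fun=> c).
  by move=> ->; rewrite mulr1 addr0.
by apply/funext => ?; rewrite mulr1 addr0.
Qed.

Lemma lipschitz_affine (c r : R) f : D f -> D (fun eta => r * f eta + c).
Proof.
move=> [L [L0 fL]]; exists (`|r| * L + 1); split.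
  by rewrite ltr_wpDl// mulr_ge0// ltW.
move=> eta xi Yeta Yxi; have dist0 := config_dist_ge0 aM eta xi.
rewrite /= opprD addrACA subrr addr0 -mulrBr normrM EFinM.
apply: (@le_trans _ _ (`|r|%:E * (L%:E * config_dist a eta xi))%E).
  by rewrite lee_wpmul2l// fL.
by rewrite muleA -EFinM lee_wpmul2r// lee_fin lerDl.
Qed.

Lemma semigroup_affine t (c r : R) f eta : 0 <= t -> D f -> Y eta ->
  S t (fun eta => r * f eta + c) eta = r * S t f eta + c.
Proof.
move=> t0 Df Yeta; have Yin : eta \in Y by rewrite inE.
rewrite (semigroup_linear markovS r t0 Df (lipschitz_cst aM c) Yin).
by rewrite semigroup_cst.
Qed.

(** Positivity applied to [K - f] and [K + f]. *)
Lemma semigroup_bounded t f (K : R) : 0 <= t -> D f ->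
  (forall eta, Y eta -> `|f eta| <= K) ->
  forall eta, Y eta -> `|S t f eta| <= K.
Proof.
move=> t0 Df fK eta Yeta; rewrite ler_norml; apply/andP; split.
  have := semigroup_ge0 markovS t0 (lipschitz_affine K 1 Df) _ Yeta.
  rewrite semigroup_affine// mul1r => H.
  have {}H : 0 <= S t f eta + K.
    by apply: H => xi Yxi; have := fK _ Yxi; rewrite ler_norml mul1r => /andP[]; lra.
  by lra.
have := semigroup_ge0 markovS t0 (lipschitz_affine K (-1) Df) _ Yeta.
rewrite semigroup_affine// mulN1r => H.
have {}H : 0 <= - S t f eta + K.
  by apply: H => xi Yxi; have := fK _ Yxi; rewrite ler_norml mulN1r => /andP[]; lra.
by lra.
Qed.

Lemma config_norm_integrable : mubar.-integrable Y (fun eta => config_norm a eta).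
Proof.
have mN := measurable_config_norm aM.
apply/integrableP; split; first exact: measurable_funTS.
under eq_integral do rewrite gee0_abs ?(config_norm_ge0 aM)//.
by rewrite (integral_full mY mubarY mN)// => eta; exact: config_norm_ge0 aM eta.
Qed.

(** The difference quotients are dominated thanks to the growth estimate of the
    semigroup, since [mubar] has a finite mean norm. *)
Lemma cvg_integral_generator h : D h ->
  (\int[mubar]_(eta in Y) (n.+1%:R * (S n.+1%:R^-1 h eta - h eta))%:E @[n --> \oo]
   --> \int[mubar]_(eta in Y) (mmp_generator p g h eta)%:E)%E.
Proof.
move=> Dh; have [L hL] := Dh; have [L0 _] := hL.
have [c c0 Sbound] := mmp_bound semiS.
have inv0 n : 0 < n.+1%:R^-1 :> R by rewrite invr_gt0.
pose f_ n eta := (n.+1%:R * (S n.+1%:R^-1 h eta - h eta))%:E.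
have mf_ n : measurable_fun Y (f_ n).
  apply/measurable_EFinP; apply: measurable_funM; first exact: measurable_cst.
  apply: measurable_funB; apply: (measurable_lipschitz aM) => //.
  exact: (semigroup_stable markovS (ltW (inv0 n)) Dh).
have f_f eta : Y eta -> f_ n eta @[n --> \oo] --> (mmp_generator p g h eta)%:E.
  move=> Yeta; apply/fine_cvgP; split; first by apply: nearW.
  have /cvg_at_rightP der := mmp_derivative semiS Dh Yeta.
  have /der : (forall n, 0 < (fun n => n.+1%:R^-1) n :> R) /\
      n.+1%:R^-1 @[n --> \oo] --> (0 : R) by split=> //; exact: cvg_harmonic.
  apply: cvg_trans; apply: near_eq_cvg; apply: nearW => n /=.
  by rewrite invrK mulrC.
pose B eta := ((L * (c * expR c))%:E * config_norm a eta)%E.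
have C0 : 0 <= L * (c * expR c) by rewrite !mulr_ge0 ?expR_ge0// ltW.
have Bfin eta : Y eta -> B eta \is a fin_num.
  by move=> Yeta; rewrite fin_numM// ge0_fin_numE// (config_norm_ge0 aM).
have Bint : mubar.-integrable Y B.
  by apply: integrableZl => //; exact: config_norm_integrable.
have Bdom n eta : Y eta -> (`|f_ n eta| <= B eta)%E.
  move=> Yeta; have := Sbound h L eta _ hL Yeta (ltW (inv0 n)).
  have [r r0 re] : exists2 r, 0 <= r & config_norm a eta = r%:E.
    exists (fine (config_norm a eta)); first by rewrite fine_ge0 ?(config_norm_ge0 aM).
    by rewrite fineK// ge0_fin_numE// (config_norm_ge0 aM).
  rewrite /B /f_ re /= -!EFinM !lee_fin normrM normr_nat => Sle.
  set v : R := n.+1%:R^-1 in Sle *.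
  have v0 : 0 <= v := ltW (inv0 n).
  have nv : n.+1%:R * v = 1 by rewrite mulfV// pnatr_eq0.
  have cv0 : 0 <= c * v by rewrite mulr_ge0// ltW.
  (* Convexity of the exponential, in the form exp x - 1 <= x exp x. *)
  have e1 : expR (c * v) - 1 <= c * v * expR c.
    apply: (@le_trans _ _ (c * v * expR (c * v))).
      have := expR_ge1Dx (- (c * v)); have := expR_gt0 (c * v).
      by have := expRxMexpNx_1 (c * v); nra.
    rewrite ler_wpM2l// ler_expR ler_piMr ?(ltW c0)//.
    by rewrite invf_le1 ?ler1n// ltr0n.
  apply: (@le_trans _ _ (n.+1%:R * (r * (L * (c * v * expR c))))).
    by rewrite ler_wpM2l// (le_trans Sle)// !ler_wpM2l// ltW.
  rewrite (_ : n.+1%:R * _ = n.+1%:R * v * (L * (c * expR c) * r)).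
    by rewrite nv mul1r.
  by ring.
exact: (dominated_cvg mY mf_ f_f Bfin Bint Bdom).
Qed.

Lemma integrable_lipschitz h (K : R) : D h -> (forall eta, Y eta -> `|h eta| <= K) ->
  mubar.-integrable Y (EFin \o h).
Proof.
move=> Dh hK; apply: (@le_integrable _ _ _ mubar Y mY _ (EFin \o cst K)).
- by apply/measurable_EFinP; exact: measurable_lipschitz aM h Dh.
- by move=> eta Yeta /=; rewrite lee_fin (le_trans (hK _ Yeta))// ler_norm.
- by apply: finite_measure_integrable_cst.
Qed.

Section bounded_function.
Variables (f : config d -> R) (K : R).
Hypothesis Df : D f.
Hypothesis fK : forall eta, Y eta -> `|f eta| <= K.

Let DS t : 0 <= t -> D (S t f).
Proof. by move=> t0; exact: (semigroup_stable markovS). Qed.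

Let SK t : 0 <= t -> forall eta, Y eta -> `|S t f eta| <= K.
Proof. by move=> t0; exact: semigroup_bounded. Qed.

Let intS t : 0 <= t -> mubar.-integrable Y (EFin \o S t f).
Proof. by move=> t0; apply: integrable_lipschitz; [exact: DS|exact: SK]. Qed.

Definition semigroup_mean t : R := \int[mubar]_(eta in Y) S t f eta.

Lemma semigroup_meanE t : 0 <= t ->
  (semigroup_mean t)%:E = (\int[mubar]_(eta in Y) (S t f eta)%:E)%E.
Proof. by move=> t0; rewrite fineK//; exact: integrable_fin_num (intS t0). Qed.

Lemma semigroup_mean_diff s n : 0 <= s ->
  (\int[mubar]_(eta in Y)
     (n.+1%:R * (S n.+1%:R^-1 (S s f) eta - S s f eta))%:E)%E =
  (n.+1%:R * (semigroup_mean (s + n.+1%:R^-1) - semigroup_mean s))%:E.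
Proof.
move=> s0; have v0 : 0 <= n.+1%:R^-1 :> R by rewrite invr_ge0.
have sv0 : 0 <= s + n.+1%:R^-1 by rewrite addr_ge0.
rewrite EFinM EFinB !semigroup_meanE// -integralB_EFin//; try exact: intS.
rewrite -integralZl//; last first.
  by apply: (@integrableB _ _ _ mubar Y _ (EFin \o _) (EFin \o _)) => //; exact: intS.
apply: eq_integral => eta Yeta; rewrite (addrC s).
by rewrite (semigroupD markovS v0 s0 Df Yeta) EFinM EFinB.
Qed.

Lemma semigroup_mean_continuous (u : nat -> R) (s : R) : (forall n, 0 <= u n) ->
  0 <= s -> u n @[n --> \oo] --> s ->
  semigroup_mean (u n) @[n --> \oo] --> semigroup_mean s.
Proof.
move=> u0 s0 us.
have : (\int[mubar]_(eta in Y) (S (u n) f eta)%:E @[n --> \oo] -->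
        \int[mubar]_(eta in Y) (S s f eta)%:E)%E.
  apply: (@dominated_cvg _ _ _ mubar Y mY _ _ (EFin \o cst K)) => //.
  - by move=> n; apply/measurable_EFinP; apply: (measurable_lipschitz aM); exact: DS.
  - move=> eta Yeta; apply/fine_cvgP; split; first by apply: nearW.
    have /subspace_continuousP/(_ s) := mmp_continuous semiS Df Yeta.
    rewrite /= in_itv /= andbT => /(_ s0) cont.
    apply: (cvg_comp u (fun t => S t f eta) _ cont) => B.
    move=> /us [N _ NB]; exists N => // n Nn; apply: (NB n Nn).
    by rewrite /= in_itv /= andbT.
  - by apply: finite_measure_integrable_cst.
  - by move=> n eta Yeta; rewrite lee_fin; exact: SK.
rewrite -semigroup_meanE// => /fine_cvg /=; apply: cvg_trans.
by apply: near_eq_cvg; apply: nearW => n.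
Qed.

End bounded_function.

(** By the semigroup property, the right derivative at [s] of the mean of [S t f] is
    the mean of the generator applied to [S s f]. It vanishes because [S s f]
    is again bounded and Lipschitz, and a continuous function with vanishing
    right derivative is constant. *)
Lemma mmp_invariantP : mmp_invariant a S mubar <->
  (forall f, D f -> bounded_on Y f ->
     (\int[mubar]_(eta in Y) (mmp_generator p g f eta)%:E = 0)%E).
Proof.
have lim0 f (K : R) s : D f -> (forall eta, Y eta -> `|f eta| <= K) -> 0 <= s ->
    ((n.+1%:R * (semigroup_mean f (s + n.+1%:R^-1) - semigroup_mean f s))%:E
       @[n --> \oo] -->
     \int[mubar]_(eta in Y) (mmp_generator p g (S s f) eta)%:E)%E.
  move=> Df fK s0.
  under eq_fun do rewrite -(semigroup_mean_diff Df fK)//.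
  by apply: cvg_integral_generator; exact: (semigroup_stable markovS).
split=> [[_ inv] f Df [K fK]|gen0].
  have S0 : (\int[mubar]_(eta in Y) (mmp_generator p g (S 0 f) eta)%:E = 0)%E.
    have := lim0 f K 0 Df fK (lexx 0).
    rewrite (_ : (fun n => _) = cst 0%E) => [/cvg_lim <-//|].
      by rewrite lim_cst.
    apply/funext => n; have v0 : 0 <= n.+1%:R^-1 :> R by rewrite invr_ge0.
    have meanE t : 0 <= t ->
        (semigroup_mean f t)%:E = (\int[mubar]_(eta in Y) (f eta)%:E)%E.
      by move=> t0; rewrite (semigroup_meanE Df fK t0) inv//; exists K.
    have [e] : (semigroup_mean f (0 + n.+1%:R^-1))%:E = (semigroup_mean f 0)%:E.
      by rewrite !meanE// add0r.
    by rewrite e subrr mulr0.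
  rewrite -[RHS]S0; apply: eq_integral => eta; rewrite inE => Yeta.
  congr _%:E; rewrite /mmp_generator; congr unordered_sum; apply/funext => xy.
  have E0 xi : Y xi -> S 0 f xi = f xi.
    by move=> Yxi; apply: (semigroup0 markovS Df); rewrite inE.
  by apply: eq_bigr => k _; rewrite !E0//; exact: finite_configs_move aM _ _ _ _ _.
split=> // f t Df [K fK] t0.
have cst : semigroup_mean f t = semigroup_mean f 0.
  apply: right_derivative0_constant => // [u s u0 s0 us|s s0].
    exact: semigroup_mean_continuous Df fK u s u0 s0 us.
  have DSs := semigroup_stable markovS s0 Df.
  have := lim0 f K s Df fK s0; rewrite gen0//.
    by move=> /fine_cvg.
  by exists K; exact: semigroup_bounded.
rewrite -(semigroup_meanE Df fK)// cst (semigroup_meanE Df fK)//.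
apply: eq_integral => eta Yeta.
by rewrite (semigroup0 markovS Df Yeta).
Qed.

End semigroup_invariance.

(** * Existence of product measures *)

Section affine_lebesgue.
Context {R : realType}.
Local Open Scope ereal_scope.

(** After division by [m], the left-hand side gives every interval its length. *)
Lemma lebesgue_measure_affine (c m : R) (B : set (measurableTypeR R)) :
  (0 < m)%R -> measurable B ->
  lebesgue_measure [set w : R | B ((w - c) / m)%R] = m%:E * lebesgue_measure B.
Proof.
move=> m0 mB.
have maff : measurable_fun [set: measurableTypeR R]
    (fun w : measurableTypeR R => ((w - c) / m)%R : measurableTypeR R).
  apply: measurable_funM; last exact: measurable_cst.
  by apply: measurable_funB; [exact: measurable_id|exact: measurable_cst].
have mi0 : (0 <= m^-1)%R by rewrite invr_ge0 ltW.
pose nu : {measure set (measurableTypeR R) -> \bar R} :=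
  mscale (NngNum mi0) (measure_function_pushforward__canonical__measure_function_Measure
    (@lebesgue_measure R) maff).
have nuE A : nu A = (m^-1)%:E * lebesgue_measure [set w : R | A ((w - c) / m)%R] by [].
suff lebE : forall A, measurable A -> lebesgue_measure A = nu A.
  by rewrite (lebE B mB) nuE muleA -EFinM mulfV ?mul1e// gt_eqF.
apply: lebesgue_measure_unique.
move=> _ [[u v] /= _ <-]; rewrite nuE.
rewrite [X in _ = _ * lebesgue_measure X](_ : _ = `](c + m * u)%R, (c + m * v)%R]%classic); last first.
  apply/seteqP; split=> w /=; rewrite !in_itv /= ltr_pdivlMr// ler_pdivrMr//.
    by rewrite ltrBrDl lerBlDl (mulrC u) (mulrC v).
  by rewrite ltrBrDl lerBlDl (mulrC u) (mulrC v).
rewrite !lebesgue_measure_itv /= !lte_fin ltrD2l ltr_pM2l//.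
case: ifPn => _; last by rewrite mule0.
rewrite -!EFinB -EFinM; congr _%:E.
by field; rewrite gt_eqF.
Qed.

End affine_lebesgue.

Section digits.
Context {R : realType}.
Variable mu : probability nat R.
Hypothesis mu_gt0 : forall n, 0 < mass mu n.

Lemma mass_sum : (\sum_(n <oo) (mass mu n)%:E = 1)%E.
Proof.
rewrite -(probability_setT mu) (_ : [set: nat] = \bigcup_n [set n]); last first.
  by apply/seteqP; split=> // n _; exists n.
rewrite measure_semi_bigcup//.
  apply: eq_eseriesr => n _; rewrite /mass fineK//.
  exact: fin_num_measure.
by apply/trivIsetP => i j _ _ /eqP ij; apply/seteqP; split=> // n [/= -> /ij].
Qed.

(** A uniform point of the unit interval has independent digits of law [mu] in the
    expansion that cuts every interval into pieces of relative lengths [mass mu n];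
    the sites of the lattice, which are countably many, take these digits as their
    contents. *)
Definition cumul n : R := \sum_(0 <= i < n) mass mu i.

Lemma cumul0 : cumul 0 = 0. Proof. by rewrite /cumul big_geq. Qed.
Lemma cumulS n : cumul n.+1 = cumul n + mass mu n.
Proof. by rewrite /cumul big_nat_recr. Qed.

Lemma cumul_le : {homo cumul : m n / (m <= n)%N >-> m <= n}.
Proof.
apply: homo_leq => [//|y x z|n]; first exact: le_trans.
by rewrite cumulS lerDl ltW.
Qed.

Lemma cvg_cumul : cumul n @[n --> \oo] --> (1 : R).
Proof.
have : (\sum_(0 <= i < n) (mass mu i)%:E @[n --> \oo] --> (1%:E : \bar R))%E.
  rewrite -mass_sum; apply: is_cvg_nneseries => n _ _.
  by rewrite lee_fin ltW.
move=> /fine_cvg; apply: cvg_trans; apply: near_eq_cvg; apply: nearW => n /=.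
by rewrite sumEFin.
Qed.

Lemma cumul_le1 n : cumul n <= 1.
Proof.
rewrite -(cvg_lim _ cvg_cumul)//; apply: nondecreasing_cvgn_le.
  by move=> i j; exact: cumul_le.
by apply/cvg_ex; eexists; exact: cvg_cumul.
Qed.

Definition digit (w : R) : nat := xget 0%N [set n | cumul n <= w < cumul n.+1].
Definition digit_shift (w : R) : R := (w - cumul (digit w)) / mass mu (digit w).

Lemma digitP w : 0 <= w < 1 -> cumul (digit w) <= w < cumul (digit w).+1.
Proof.
move=> /andP[w0 w1]; rewrite /digit; case: xgetP => [n _ //|].
have [n wn] : exists n, w < cumul n.
  by have /cvgr_gt/(_ w w1)[n _ /(_ n (leqnn n))] := cvg_cumul; exists n.
have /ex_minnP[[|m] wm mmin] : exists n, w < cumul n by exists n.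
  by move: wm; rewrite cumul0 ltNge w0.
move=> none; case: (none m) => /=; rewrite wm andbT leNgt.
by apply/negP => /mmin; rewrite ltnn.
Qed.

Lemma cumul_itv w n : cumul n <= w < cumul n.+1 -> 0 <= w < 1.
Proof.
move=> /andP[nw wn]; rewrite (lt_le_trans wn (cumul_le1 _)) andbT.
by rewrite (le_trans _ nw)// -cumul0 cumul_le.
Qed.

Lemma digit_eq w n : cumul n <= w < cumul n.+1 -> digit w = n.
Proof.
move=> nwn; have /digitP/andP[dw wd] := cumul_itv nwn.
move: nwn => /andP[nw wn].
apply/eqP; rewrite eqn_leq; apply/andP; split; rewrite leqNgt; apply/negP => lt.
  by have := le_lt_trans (le_trans (cumul_le lt) dw) wn; rewrite ltxx.
by have := le_lt_trans (le_trans (cumul_le lt) nw) wd; rewrite ltxx.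
Qed.

Lemma digit_out w : ~~ (0 <= w < 1) -> digit w = 0%N.
Proof.
move=> out; rewrite /digit; case: xgetP => // n _ /= /cumul_itv.
by rewrite (negbTE out).
Qed.

Lemma digit_shift_itv w : 0 <= w < 1 -> 0 <= digit_shift w < 1.
Proof.
move=> /digitP/andP[dw wd]; rewrite /digit_shift divr_ge0 ?subr_ge0 ?(ltW (mu_gt0 _))//=.
by rewrite ltr_pdivrMr// mul1r ltrBlDl -cumulS.
Qed.

Lemma measurable_digit : measurable_fun [set: measurableTypeR R] (digit : measurableTypeR R -> nat).
Proof.
move=> _ A _; rewrite setTI.
have -> : digit @^-1` A = \bigcup_(n in A) (digit @^-1` [set n]).
  by apply/seteqP; split=> w /= => [Aw|[n An ->]//]; exists (digit w).
apply: bigcup_measurable => n _.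
have [->|n0] := eqVneq n 0%N.
  rewrite (_ : _ @^-1` _ = `[cumul 0, cumul 1[%classic `|` ~` `[0, 1[%classic).
    by apply: measurableU; [|apply: measurableC]; exact: measurable_itv.
  apply/seteqP; split=> w /=; rewrite !in_itv /=.
    move=> dw; have [w01|] := boolP (0 <= w < 1); last by right.
    by left; rewrite -dw; exact: digitP.
  by case=> [/digit_eq//|/negP/digit_out].
rewrite (_ : _ @^-1` _ = `[cumul n, cumul n.+1[%classic); first exact: measurable_itv.
apply/seteqP; split=> w /=; rewrite !in_itv /=; last exact: digit_eq.
move=> dw; have [w01|/digit_out dw0] := boolP (0 <= w < 1).
  by rewrite -dw; exact: digitP.
by move: n0; rewrite -dw dw0.
Qed.

Lemma measurable_digit_shift :
  measurable_fun [set: measurableTypeR R] (digit_shift : _ -> measurableTypeR R).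
Proof.
apply: measurable_funM.
  apply: measurable_funB; first exact: measurable_id.
  by apply: (measurableT_comp (f := cumul)) => //; exact: measurable_digit.
by apply: (measurableT_comp (f := fun n => (mass mu n)^-1)) => //; exact: measurable_digit.
Qed.

Local Open Scope ereal_scope.
Local Notation leb := (@lebesgue_measure R).

(** The shift maps each piece affinely onto the whole interval, so the first digit is
    independent of the remaining ones. *)
Lemma digit_shift_measure n (B : set (measurableTypeR R)) : measurable B ->
  B `<=` [set w | 0 <= w < 1]%R ->
  leb [set w | (0 <= w < 1)%R /\ digit w = n /\ B (digit_shift w)] =
  (mass mu n)%:E * leb B.
Proof.
move=> mB B01; rewrite -(lebesgue_measure_affine (cumul n))//.
congr (leb _); apply/seteqP; split=> w /=.
  by move=> [_ [dw]]; rewrite /digit_shift dw.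
move=> Bw; have /andP[b0 b1] := B01 _ Bw.
have nwn : (cumul n <= w < cumul n.+1)%R.
  move: b0 b1; rewrite pmulr_lge0 ?invr_gt0// subr_ge0 => -> /=.
  by rewrite ltr_pdivrMr// mul1r ltrBlDl -cumulS.
have dw := digit_eq nwn.
by rewrite (cumul_itv nwn) /digit_shift dw.
Qed.

(** The positions outside [J] are free, which covers the cylinders over arbitrary
    finite sets of sites without summing over the contents of the others. *)
Definition digit_cylinder (J : pred nat) (v : nat -> nat) (N : nat) :
    set (measurableTypeR R) :=
  [set w | (0 <= w < 1)%R /\
     forall k, (k < N)%N -> J k -> digit (iter k digit_shift w) = v k].

Lemma measurable_iter_digit k : measurable_fun [set: measurableTypeR R]
  (fun w : measurableTypeR R => digit (iter k digit_shift w)).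
Proof.
apply: (measurableT_comp (f := digit)); first exact: measurable_digit.
elim: k => [|k IH]; first exact: measurable_id.
by apply: (measurableT_comp (f := digit_shift)) => //; exact: measurable_digit_shift.
Qed.

Lemma measurable_unit_itv : measurable [set w : measurableTypeR R | 0 <= w < 1]%R.
Proof.
rewrite (_ : mkset _ = `[0%R, 1%R[%classic); first exact: measurable_itv.
by apply/seteqP; split=> w /=; rewrite in_itv.
Qed.

Lemma measurable_digit_cylinder J v N : measurable (digit_cylinder J v N).
Proof.
rewrite (_ : digit_cylinder J v N = [set w : measurableTypeR R | 0 <= w < 1]%R `&`
  \bigcap_(k in [set k | (k < N)%N /\ J k])
    ((fun w : measurableTypeR R => digit (iter k digit_shift w)) @^-1` [set v k])).
  apply: measurableI; first exact: measurable_unit_itv.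
  apply: bigcap_measurableType => k _; rewrite -[X in measurable X]setTI.
  exact: measurable_iter_digit.
apply/seteqP; split=> w /=.
  by move=> [w01 H]; split=> // k [kN Jk]; exact: H.
by move=> [w01 H]; split=> // k kN Jk; apply: H.
Qed.

Lemma digit_cylinderS J v N : digit_cylinder J v N.+1 =
  [set w | (0 <= w < 1)%R /\ (J 0%N -> digit w = v 0%N) /\
     digit_cylinder (J \o S) (v \o S) N (digit_shift w)].
Proof.
apply/seteqP; split=> w /=.
  move=> [w01 H]; split=> //; split; first exact: (H 0%N).
  split; first exact: digit_shift_itv.
  by move=> k kN Jk; rewrite -iterSr; exact: H.
move=> [w01 [H0 [_ H]]]; split=> // -[_|k kN]; first exact: H0.
by move=> Jk; rewrite iterSr; exact: H.
Qed.

Lemma digit_cylinder_measure J v N :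
  leb (digit_cylinder J v N) =
  (\prod_(0 <= k < N) (if J k then mass mu (v k) else 1))%R%:E.
Proof.
elim: N J v => [|N IH] J v.
  rewrite big_geq// (_ : digit_cylinder J v 0 = `[0%R, 1%R[%classic).
    by rewrite lebesgue_measure_itv /= lte_fin ltr01 -EFinB subr0.
  by apply/seteqP; split=> w /=; rewrite in_itv //= => -[].
rewrite big_nat_recl// digit_cylinderS.
pose B := digit_cylinder (J \o S) (v \o S) N.
have mB : measurable B by exact: measurable_digit_cylinder.
have B01 : B `<=` [set w | 0 <= w < 1]%R by move=> w [].
have [J0|J0] := boolP (J 0%N).
  rewrite EFinM -IH -digit_shift_measure//; congr (leb _).
  by apply/seteqP; split=> w /= [w01 [H0 H]]; split=> //; split=> //; exact: H0.
rewrite mul1r -IH.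
rewrite (_ : mkset _ = \bigcup_n
    [set w : measurableTypeR R | (0 <= w < 1)%R /\ digit w = n /\ B (digit_shift w)]).
  have mD n : measurable [set w : measurableTypeR R |
      (0 <= w < 1)%R /\ digit w = n /\ B (digit_shift w)].
    rewrite (_ : mkset _ = [set w : measurableTypeR R | 0 <= w < 1]%R `&`
      ((digit : measurableTypeR R -> nat) @^-1` [set n] `&`
       (digit_shift : _ -> measurableTypeR R) @^-1` B))//.
    apply: measurableI; first exact: measurable_unit_itv.
    apply: measurableI; rewrite -[X in measurable X]setTI.
      exact: measurable_digit.
    exact: measurable_digit_shift.
  rewrite measure_semi_bigcup//; first last.
  - exact: bigcupT_measurable.
  - apply/trivIsetP => i j _ _ /eqP ij; apply/seteqP; split=> // w /=.
    by move=> [[_ [-> _]] [_ [/ij]]].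
  transitivity (\sum_(n <oo) ((mass mu n)%:E * leb B)).
    by apply: eq_eseriesr => n _; exact: digit_shift_measure.
  rewrite /B IH; under eq_eseriesr do rewrite muleC.
  by rewrite nneseriesZl ?mass_sum ?mule1// => n _; rewrite lee_fin mass_ge0.
apply/seteqP; split=> w /=.
  by move=> [w01 [_ H]]; exists (digit w).
by move=> [n _ [w01 [dw H]]].
Qed.

Variable d : nat.

Definition digit_config (w : measurableTypeR R) : config d :=
  fun x => digit (iter (pickle x) digit_shift w).

Lemma measurable_digit_config : measurable_fun [set: measurableTypeR R] digit_config.
Proof.
apply: measurable_to_config => x n.
have := measurable_iter_digit (pickle x) measurableT (Y := [set n]) I.
by rewrite setTI.
Qed.

Definition product_law (A : set (config d)) : \bar R :=
  leb (digit_config @^-1` A `&` [set w | 0 <= w < 1]%R).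

Let product_law_measure : {measure set (config d) -> \bar R} :=
  measure_function_pushforward__canonical__measure_function_Measure
    (mrestr leb measurable_unit_itv) measurable_digit_config.

HB.instance Definition _ := isMeasure.Build _ _ _ product_law
  (measure0 product_law_measure) (measure_ge0 product_law_measure)
  (@measure_semi_sigma_additive _ _ _ product_law_measure).

Lemma product_law_setT : product_law setT = 1.
Proof.
rewrite /product_law preimage_setT setTI (_ : mkset _ = `[0%R, 1%R[%classic).
  by rewrite lebesgue_measure_itv /= lte_fin ltr01 -EFinB subr0.
by apply/seteqP; split=> w /=; rewrite in_itv.
Qed.

HB.instance Definition _ :=
  Measure_isProbability.Build _ _ _ product_law product_law_setT.

Lemma product_law_product : product_measure (fun=> mu) (product_law : probability _ _).
Proof.
move=> F xi uF; rewrite /= /product_law.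
pose J k := k \in [seq pickle x | x <- F].
pose v k := oapp xi 0%N (@pickle_inv (lattice d) k).
pose N := (\max_(x <- F) pickle x).+1.
have pN x : x \in F -> (pickle x < N)%N.
  by move=> xF; rewrite ltnS (@leq_bigmax_seq _ _ _ (fun x => pickle x)).
rewrite (_ : _ `&` _ = digit_cylinder J v N).
  rewrite digit_cylinder_measure -big_mkcond -big_filter; congr _%:E.
  rewrite (perm_big [seq pickle x | x <- F]).
    by rewrite big_map; apply: eq_bigr => x _; rewrite /v pickleK_inv.
  apply: uniq_perm.
  - by rewrite filter_uniq// iota_uniq.
  - by rewrite map_inj_uniq//; exact: (pcan_inj pickleK).
  move=> k; rewrite mem_filter mem_index_iota /= -/(J k) andb_idr//.
  by move=> /mapP[x xF ->]; exact: pN.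
apply/seteqP; split=> w /=.
  move=> [H w01]; split=> // k kN /mapP[x xF kx].
  by rewrite kx /v pickleK_inv /= -(H x xF).
move=> [w01 H]; split=> // x xF.
rewrite /digit_config H ?pN//; first by rewrite /v pickleK_inv.
by apply/mapP; exists x.
Qed.

End digits.

Lemma product_measure_exists {R : realType} (d : nat) (mu : probability nat R) :
  (forall n, 0 < mass mu n) ->
  exists mubar : probability (config d) R, product_measure (fun=> mu) mubar.
Proof. by move=> mu_gt0; eexists; exact: (product_law_product mu_gt0). Qed.

(** * The exponential family of a reference measure *)

Section nat_probability.
Context {R : realType}.
Variable q : nat -> R.
Hypothesis q_ge0 : forall n, 0 <= q n.
Hypothesis q_sum : (\sum_(n <oo) (q n)%:E = 1)%E.
Local Open Scope ereal_scope.

Let atom n : {measure set nat -> \bar R} := mscale (NngNum (q_ge0 n)) \d_n.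

Definition nat_law : set nat -> \bar R := mseries atom 0.

HB.instance Definition _ := Measure.on nat_law.

Let nat_lawE A : nat_law A = \sum_(n <oo) ((q n)%:E * \d_n A).
Proof. by []. Qed.

Lemma nat_law_setT : nat_law setT = 1.
Proof.
rewrite nat_lawE -q_sum; apply: eq_eseriesr => n _.
by rewrite diracE in_setT mule1.
Qed.

HB.instance Definition _ := Measure_isProbability.Build _ _ _ nat_law nat_law_setT.

Lemma nat_law_mass n : mass (nat_law : probability nat R) n = q n.
Proof.
rewrite /mass [X in fine X]nat_lawE nneseries_esumT; last first.
  by move=> m; rewrite mule_ge0 ?lee_fin.
rewrite (esum_unique (i0 := n)).
- by rewrite diracE mem_set// mule1.
- by rewrite mule_ge0 ?lee_fin.
move=> m mn; rewrite diracE memNset ?mule0//= => /eqP.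
by rewrite (negbTE mn).
Qed.

End nat_probability.

Lemma nat_probability_exists {R : realType} (q : nat -> R) :
  (forall n, 0 <= q n) -> (\sum_(n <oo) (q n)%:E = 1)%E ->
  exists m : probability nat R, forall n, mass m n = q n.
Proof. by move=> q0 q1; eexists; exact: (nat_law_mass q0 q1). Qed.

Section exponential_family.
Context {R : realType}.
Variables (g : nat -> nat -> R) (mu : probability nat R).
Hypothesis g1_gt0 : forall alpha, (1 <= alpha)%N -> 0 < g 1%N alpha.
Hypothesis mu_ref : reference_measure g mu.
Implicit Types (phi psi : R) (n : nat).

Lemma rate_fact_gt0 n : 0 < rate_fact g n.
Proof.
rewrite /rate_fact big_nat; apply: prodr_gt0 => i /andP[i0 _].
exact: g1_gt0.
Qed.

Lemma reference_mass0_gt0 : 0 < mass mu 0.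
Proof.
have [fug _] := mu_ref; rewrite lt_neqAle mass_ge0 andbT eq_sym.
by apply: contraTneq fug => e; rewrite /fugacity e invr0 mulr0 ltxx.
Qed.

Lemma power_mass phi n : phi ^+ n * mass mu n =
  mass mu 0 * ((phi * fugacity g mu) ^+ n / rate_fact g n).
Proof.
have [_ ->] := mu_ref; move: (fugacity g mu) => fug.
by rewrite exprMn !mulrA (mulrC (phi ^+ n)).
Qed.

Lemma Zterm_ge0 phi n : 0 <= phi -> 0 <= phi ^+ n * mass mu n.
Proof. by move=> phi0; rewrite mulr_ge0 ?exprn_ge0 ?mass_ge0. Qed.

Local Open Scope ereal_scope.

Lemma Zpartition_series phi : (0 <= phi)%R -> Zpartition g mu phi = Zseries mu phi.
Proof.
move=> phi0; have [fug _] := mu_ref.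
rewrite /Zpartition -nneseriesZl; last first.
  move=> n _; rewrite lee_fin divr_ge0 ?(ltW (rate_fact_gt0 _))//.
  by rewrite exprn_ge0// mulr_ge0// ltW.
by apply: eq_eseriesr => n _; rewrite power_mass EFinM.
Qed.

Lemma lee_Zseries phi psi : (0 <= phi <= psi)%R -> Zseries mu phi <= Zseries mu psi.
Proof.
move=> /andP[phi0 le]; apply: lee_nneseries => n _.
  by rewrite lee_fin Zterm_ge0.
by rewrite lee_fin ler_wpM2r ?mass_ge0// lerXn2r// nnegrE (le_trans phi0).
Qed.

Lemma lt_phi_c phi : (0 <= phi)%R -> phi%:E < phi_c mu ->
  exists2 psi, (phi < psi)%R & Zseries mu psi < +oo.
Proof.
move=> phi0 /ereal_sup_gt[_ [psi [psi0 Zpsi] <-]]; rewrite lte_fin => lt.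
by exists psi.
Qed.

Lemma RadZ_lty phi : RadZ mu phi -> Zseries mu phi < +oo.
Proof.
move=> [phi0 [/lt_phi_c H|[_ //]]].
have [psi lt Zpsi] := H (ltW phi0).
by apply: le_lt_trans Zpsi; rewrite lee_Zseries// (ltW phi0) ltW.
Qed.

(** A larger convergent power series dominates the differentiated one, by
    Bernoulli's inequality. *)
Lemma Zseries'_lty phi psi : (0 < phi < psi)%R -> Zseries mu psi < +oo ->
  Zseries' mu phi < +oo.
Proof.
move=> /andP[phi0 lt] Zpsi.
pose x := (psi / phi - 1)%R.
have x0 : (0 < x)%R by rewrite subr_gt0 ltr_pdivlMr// mul1r.
have bern n : (n%:R * x <= (1 + x) ^+ n)%R.
  elim: n => [|n IH]; first by rewrite mul0r expr0.
  have : (1 <= (1 + x) ^+ n)%R by rewrite exprn_ege1// lerDl ltW.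
  by rewrite exprS -natr1; nra.
have psiE : (psi = (1 + x) * phi)%R.
  by rewrite addrC subrK divfK// gt_eqF.
apply: (@le_lt_trans _ _ (\sum_(n <oo) ((x^-1)%:E * (psi ^+ n * mass mu n)%:E))).
  apply: lee_nneseries => n _; first by rewrite lee_fin -mulrA mulr_ge0 ?Zterm_ge0// ltW.
  rewrite -EFinM lee_fin !mulrA ler_wpM2r ?mass_ge0//.
  rewrite ler_pdivlMl// psiE exprMn mulrA ler_wpM2r ?exprn_ge0 ?(ltW phi0)//.
  by rewrite mulrC.
rewrite nneseriesZl; last first.
  by move=> n _; rewrite lee_fin Zterm_ge0// ltW// (lt_trans phi0).
by apply: lte_mul_pinfty => //; rewrite lee_fin invr_ge0 ltW.
Qed.

Lemma RadZ'_lty phi : RadZ' mu phi -> Zseries' mu phi < +oo.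
Proof.
move=> [phi0 [/lt_phi_c H|[_ //]]].
have [psi lt Zpsi] := H (ltW phi0).
by apply: Zseries'_lty Zpsi; rewrite phi0.
Qed.

(** Except for the first one, the terms of [Zseries] are dominated by those of
    [Zseries']. *)
Lemma RadZ'_RadZ phi : RadZ' mu phi -> RadZ mu phi.
Proof.
move=> [phi0 [lt|[phiE Z'lty]]]; split=> //; [by left|right; split=> //].
have Z0 n : 0 <= (n%:R * phi ^+ n * mass mu n)%:E.
  by rewrite lee_fin -mulrA mulr_ge0 ?Zterm_ge0// ltW.
pose u n : \bar R := if n == 0%N then (mass mu 0)%:E else 0.
have u0 n : 0 <= u n by rewrite /u; case: ifP => //; rewrite lee_fin mass_ge0.
rewrite /Zseries nneseries_esumT; last by move=> n; rewrite lee_fin Zterm_ge0// ltW.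
apply: (@le_lt_trans _ _ (\esum_(n in [set: nat])
    (u n + (n%:R * phi ^+ n * mass mu n)%:E))).
  apply: le_esum => -[|n] _; rewrite /u /= -?EFinD ?add0e lee_fin.
    by rewrite expr0 mul1r !mul0r addr0.
  by rewrite ?add0r -mulrA ler_peMl ?Zterm_ge0 ?(ltW phi0)// ler1n.
rewrite esumD// (esum_unique (i0 := 0%N)) ?u0//; last by move=> n /negbTE n0; rewrite /u n0.
by rewrite -nneseries_esumT// lte_add_pinfty ?ltry.
Qed.

Lemma Zseries_gt0 phi : (0 < phi)%R -> 0 < Zseries mu phi.
Proof.
move=> phi0; rewrite /Zseries nneseries_esumT; last first.
  by move=> n; rewrite lee_fin Zterm_ge0// ltW.
apply: (@lt_le_trans _ _ (phi ^+ 0 * mass mu 0)%:E).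
  by rewrite expr0 mul1r lte_fin reference_mass0_gt0.
apply: (@le_esum_term _ _ 0%N (fun n => (phi ^+ n * mass mu n)%:E)).
by move=> n; rewrite lee_fin Zterm_ge0// ltW.
Qed.

Lemma mu_phiE phi n : (0 <= phi)%R ->
  mu_phi g mu phi n = ((fine (Zseries mu phi))^-1 * (phi ^+ n * mass mu n))%R.
Proof. by move=> phi0; rewrite /mu_phi Zpartition_series// power_mass; ring. Qed.

Lemma mu_phi_gt0 phi n : RadZ mu phi -> (0 < mu_phi g mu phi n)%R.
Proof.
move=> phiR; have [phi0 _] := phiR; have [fug massE] := mu_ref.
rewrite mu_phiE ?(ltW phi0)// mulr_gt0//.
  by rewrite invr_gt0 fine_gt0// Zseries_gt0// RadZ_lty.
rewrite power_mass mulr_gt0 ?reference_mass0_gt0// divr_gt0 ?rate_fact_gt0//.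
by rewrite exprn_gt0// mulr_gt0.
Qed.

Lemma mu_phi_sum phi : RadZ mu phi -> \sum_(n <oo) (mu_phi g mu phi n)%:E = 1.
Proof.
move=> phiR; have [phi0 _] := phiR.
have Zfin : Zseries mu phi \is a fin_num.
  by rewrite ge0_fin_numE ?RadZ_lty// ltW// Zseries_gt0.
under eq_eseriesr do rewrite mu_phiE ?(ltW phi0)// EFinM.
rewrite nneseriesZl; last by move=> n _; rewrite lee_fin Zterm_ge0// ltW.
rewrite -[X in _ * X](fineK Zfin) -EFinM mulVf// gt_eqF// fine_gt0//.
by rewrite Zseries_gt0// RadZ_lty.
Qed.

Lemma mu_phi_finite_mean phi (m : probability nat R) : RadZ' mu phi ->
  (forall n, mass m n = mu_phi g mu phi n) -> finite_mean m.
Proof.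
move=> phiR mE; have [phi0 _] := phiR.
have Z0 : (0 <= (fine (Zseries mu phi))^-1)%R.
  by rewrite invr_ge0 fine_ge0// ltW// Zseries_gt0.
rewrite /finite_mean (_ : \sum_(0 <= n <oo) _ =
    \sum_(n <oo) (((fine (Zseries mu phi))^-1)%:E * (n%:R * phi ^+ n * mass mu n)%:E)).
  rewrite nneseriesZl; last first.
    by move=> n _; rewrite lee_fin -mulrA mulr_ge0 ?Zterm_ge0// ltW.
  by apply: lte_mul_pinfty => //; exact: RadZ'_lty.
apply: eq_eseriesr => n _; rewrite mE mu_phiE ?(ltW phi0)// -EFinM.
by congr _%:E; ring.
Qed.

End exponential_family.

(** * Necessity of the factorization *)

Section cylinder_gain.
Context {R : realType} {d : nat}.
Variables (p : lattice d -> lattice d -> R) (g : nat -> nat -> R).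
Hypothesis p_ge0 : forall x y, 0 <= p x y.
Hypothesis p_row : forall x, \esum_(y in [set: lattice d]) (p x y)%:E = 1%E.
Hypothesis p_col : forall y, \esum_(x in [set: lattice d]) (p x y)%:E = 1%E.
Hypothesis g_rates : mmp_rates (zrp g).
Variables (mu : probability nat R) (mubar : probability (config d) R).
Hypothesis mubarE : product_measure (fun=> mu) mubar.
Hypothesis mu_gt0 : forall n, 0 < mass mu n.
Implicit Types (x y z : lattice d) (k n : nat) (eta xi : config d).
Implicit Types (F : seq (lattice d)) (zeta : lattice d -> nat).

Definition cylinder_ind F zeta (xi : config d) : R :=
  (all (fun z => xi z == zeta z) F)%:R.
Definition cylinder_mass F zeta : R := \prod_(z <- F) mass mu (zeta z).
Definition update zeta y n : lattice d -> nat := fun z => if z == y then n else zeta z.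
Definition site_ind F x : R := (x \in F)%:R.

Lemma cylinder_ind_ge0 F zeta xi : 0 <= cylinder_ind F zeta xi.
Proof. exact: ler0n. Qed.

Lemma cylinder_ind_le1 F zeta xi : cylinder_ind F zeta xi <= 1.
Proof. by rewrite /cylinder_ind; case: all. Qed.

Lemma cylinder_ind_cylinder F zeta : cylinder_function (cylinder_ind F zeta).
Proof.
exists F => eta xi e; rewrite /cylinder_ind; congr _%:R.
by congr nat_of_bool; apply: eq_in_all => z zF; rewrite e.
Qed.

Lemma measurable_cylinder_ind F zeta : measurable_fun setT (cylinder_ind F zeta).
Proof. by apply: measurable_cylinder_function; exact: cylinder_ind_cylinder. Qed.

Lemma cylinder_ind_add_notin F zeta k y xi : y \notin F ->
  cylinder_ind F zeta (add_particles k y xi) = cylinder_ind F zeta xi.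
Proof.
move=> yF; rewrite /cylinder_ind; congr _%:R; congr nat_of_bool.
apply: eq_in_all => z zF; rewrite /add_particles.
by have [zy|//] := eqVneq z y; move: yF; rewrite -zy zF.
Qed.

Lemma cylinder_ind_add F zeta k y xi : y \in F ->
  cylinder_ind F zeta (add_particles k y xi) =
  if (k <= zeta y)%N then cylinder_ind F (update zeta y (zeta y - k)) xi else 0.
Proof.
move=> yF; case: (leqP k (zeta y)) => ky.
  rewrite /cylinder_ind; congr _%:R; congr nat_of_bool; apply: eq_in_all => z zF.
  rewrite /add_particles /update; have [->|//] := eqVneq z y.
  by rewrite ?eqxx -[in RHS](eqn_add2r k) subnK.
rewrite /cylinder_ind (_ : all _ _ = false)//; apply/negbTE/negP => /allP/(_ y yF).
rewrite /add_particles eqxx => /eqP e; move: ky.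
by rewrite -e ltnNge leq_addl.
Qed.

Lemma cylinder_ind_diff F zeta k y xi :
  `|cylinder_ind F zeta (add_particles k y xi) - cylinder_ind F zeta xi| <=
  (fun=> 1) k * site_ind F y.
Proof.
rewrite mul1r /site_ind; have [yF|yF] := boolP (y \in F); last first.
  by rewrite cylinder_ind_add_notin// subrr normr0.
rewrite /= ler_norml; apply/andP; split.
  have := cylinder_ind_ge0 F zeta (add_particles k y xi).
  have := cylinder_ind_le1 F zeta xi; lra.
have := cylinder_ind_le1 F zeta (add_particles k y xi).
have := cylinder_ind_ge0 F zeta xi; lra.
Qed.

Local Open Scope ereal_scope.

Lemma integral_cylinder_ind F zeta : uniq F ->
  \int[mubar]_xi (cylinder_ind F zeta xi)%:E = (cylinder_mass F zeta)%:E.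
Proof.
move=> uF; have mC := measurable_cylinder_set F zeta.
transitivity (mubar (cylinder_set F zeta `&` setT)); last first.
  by rewrite setIT (product_cylinder mubarE).
rewrite -integral_indic//.
apply: eq_integral => xi _; rewrite indicE; congr _%:E; congr _%:R.
congr nat_of_bool; apply/allP/idP => [H|/set_mem H z zF].
  by rewrite inE => z zF; exact/eqP/H.
exact/eqP/H.
Qed.

(** On the cylinder, the content of a site of [F] is known. *)
Lemma integral_rate_cylinder_in F zeta (w : nat -> R) x : uniq F -> x \in F ->
  (forall n, 0 <= w n)%R ->
  \int[mubar]_xi ((w (xi x))%:E * (cylinder_ind F zeta xi)%:E) =
  (cylinder_mass F zeta * w (zeta x))%:E.
Proof.
move=> uF xF w0; rewrite mulrC EFinM -integral_cylinder_ind//.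
rewrite -ge0_integralZl_EFin//; first last.
- by apply/measurable_EFinP; exact: measurable_cylinder_ind.
- by move=> xi _; rewrite lee_fin cylinder_ind_ge0.
apply: eq_integral => xi _; rewrite /cylinder_ind.
have [/allP/(_ x xF)/eqP ->//|_] := boolP (all _ F).
by rewrite !mule0.
Qed.

(** The content of a site outside [F] is independent of the cylinder. *)
Lemma integral_rate_cylinder_notin F zeta (w : nat -> R) x : uniq F -> x \notin F ->
  (forall n, 0 <= w n)%R ->
  \int[mubar]_xi ((w (xi x))%:E * (cylinder_ind F zeta xi)%:E) =
  (cylinder_mass F zeta)%:E * \esum_(n in [set: nat]) (w n * mass mu n)%:E.
Proof.
move=> uF xF w0.
have pi0 : (0 <= cylinder_mass F zeta)%R.
  by apply: prodr_ge0 => z _; exact: mass_ge0.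
transitivity (\int[mubar]_xi \esum_(n in [set: nat])
    ((w n)%:E * (cylinder_ind (x :: F) (update zeta x n) xi)%:E)).
  apply: eq_integral => xi _.
  have indE n : cylinder_ind (x :: F) (update zeta x n) xi =
      ((xi x == n)%:R * cylinder_ind F zeta xi)%R.
    rewrite /cylinder_ind /= {1}/update eqxx.
    rewrite (eq_in_all (a2 := fun z => xi z == zeta z)).
      by case: (xi x == n); rewrite ?mul1r ?mul0r.
    by move=> z zF; rewrite /update; have [zx|//] := eqVneq z x; move: xF; rewrite -zx zF.
  rewrite (esum_unique (i0 := xi x)).
  - by rewrite indE eqxx mul1r.
  - by rewrite mule_ge0 ?lee_fin// cylinder_ind_ge0.
  by move=> n /negbTE nx; rewrite indE eq_sym nx mul0r mule0.
rewrite ge0_integral_esum//; first last.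
- by move=> n xi _; rewrite mule_ge0 ?lee_fin// cylinder_ind_ge0.
- move=> n; apply: measurable_funeM; apply/measurable_EFinP.
  exact: measurable_cylinder_ind.
rewrite -esumZl//; last by move=> n; rewrite lee_fin mulr_ge0 ?mass_ge0.
apply: eq_esum => n _; rewrite ge0_integralZl_EFin//; first last.
- by apply/measurable_EFinP; exact: measurable_cylinder_ind.
- by move=> xi _; rewrite lee_fin cylinder_ind_ge0.
rewrite integral_cylinder_ind /= ?xF// -!EFinM; congr _%:E.
have -> : cylinder_mass (x :: F) (update zeta x n) =
    (mass mu n * cylinder_mass F zeta)%R.
  rewrite /cylinder_mass big_cons {1}/update eqxx; congr (_ * _)%R.
  apply: eq_big_seq => z zF; rewrite /update.
  by have [zx|//] := eqVneq z x; move: xF; rewrite -zx zF.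
by rewrite mulrA mulrC.
Qed.

Variable vbar : R.
Hypothesis site_rate_mean :
  forall x, \int[mubar]_eta (site_rate g (fun=> 1%R) x eta)%:E = vbar%:E.

Local Notation w := (back_rate g mu).
Let w_ge0 k n : (0 <= w k n)%R := back_rate_ge0 g_rates mu k n.

Definition mean_back_rate k : R :=
  fine (\esum_(n in [set: nat]) (w k n * mass mu n)%:E).
Definition total_back_rate n : R := fine (\esum_(k in [set: nat]) (w k n)%:E).

Let wb_ge0 k : 0 <= \esum_(n in [set: nat]) (w k n * mass mu n)%:E.
Proof. by apply: esum_ge0 => n _; rewrite lee_fin mulr_ge0 ?mass_ge0. Qed.

Let wb_sum : \esum_(k in [set: nat]) \esum_(n in [set: nat]) (w k n * mass mu n)%:E =
  vbar%:E.
Proof.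
rewrite -(site_rate_mean (0 : lattice d)%R).
have m1 k : measurable_fun setT (fun eta : config d => (g k (eta (0 : lattice d)%R) * 1)%:E).
  exact: (measurable_fun_coord (fun n => (g k n * 1)%:E)).
under [RHS]eq_integral => eta _ do rewrite (site_rateE g_rates (fun=> ler01)).
rewrite ge0_integral_esum//; last first.
  by move=> k eta _; rewrite lee_fin mulr1 (rate_ge0 g_rates).
apply: eq_esum => k _.
transitivity (\int[mubar]_eta ((w k (eta (0 : lattice d)%R))%:E * 1)).
  rewrite (integral_coord mubarE (0 : lattice d)%R (h := fun n => (w k n)%:E * 1)).
    by apply: eq_esum => n _; rewrite mule1 EFinM.
  by move=> n; rewrite mule1 lee_fin.
rewrite -(integral_rem_particles mubarE mu_gt0 k 0%R (rate_ge0 g_rates k) (h := fun=> 1))//.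
rewrite [LHS]integral_mkcond; apply: eq_integral => eta _; rewrite patchE.
case: ifPn => [_|]; first by rewrite mule1 mulr1.
move=> /negP; rewrite inE /= => /negP; rewrite -ltnNge => kx.
by have [_ _ _ /(_ k (eta 0%R) 0%N kx)] := g_rates; rewrite /zrp => ->; rewrite mul0r.
Qed.

Lemma mean_back_rateE k :
  \esum_(n in [set: nat]) (w k n * mass mu n)%:E = (mean_back_rate k)%:E.
Proof.
rewrite fineK// ge0_fin_numE ?wb_ge0//.
by apply: le_lt_trans (le_esum_term k wb_ge0) _; rewrite wb_sum ltry.
Qed.

Lemma mean_back_rate_ge0 k : (0 <= mean_back_rate k)%R.
Proof. by rewrite fine_ge0. Qed.

Lemma mean_back_rate_sum : \esum_(k in [set: nat]) (mean_back_rate k)%:E = vbar%:E.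
Proof. by rewrite -wb_sum; apply: eq_esum => k _; rewrite mean_back_rateE. Qed.

(** Finiteness of the mean, in which [n] has positive mass, forces the sum to be
    finite for every [n]. *)
Lemma total_back_rateE n :
  \esum_(k in [set: nat]) (w k n)%:E = (total_back_rate n)%:E.
Proof.
have s0 : 0 <= \esum_(k in [set: nat]) (w k n)%:E.
  by apply: esum_ge0 => k _; rewrite lee_fin.
rewrite fineK// ge0_fin_numE//.
have : (\esum_(k in [set: nat]) (w k n)%:E) * (mass mu n)%:E < +oo.
  rewrite -esumZr ?mass_ge0//; last by move=> k; rewrite lee_fin.
  apply: le_lt_trans (ltry vbar); rewrite -wb_sum; apply: le_esum => k _.
  rewrite -EFinM; apply: (le_esum_term n (u := fun n => (w k n * mass mu n)%:E)) => m.
  by rewrite lee_fin mulr_ge0 ?mass_ge0.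
move: s0; case: (\esum_(k in _) _) => [r _ _|_|//]; first exact: ltry.
by rewrite gt0_mulye ?lte_fin.
Qed.

(** The conditional mean of the backward rate at [x], given the cylinder. *)
Definition rate_at F zeta k x : R := if x \in F then w k (zeta x) else mean_back_rate k.
Definition total_at F zeta x : R := if x \in F then total_back_rate (zeta x) else vbar.

Lemma rate_at_ge0 F zeta k x : (0 <= rate_at F zeta k x)%R.
Proof. by rewrite /rate_at; case: ifP; rewrite ?mean_back_rate_ge0. Qed.

Lemma cylinder_mass_ge0 F zeta : (0 <= cylinder_mass F zeta)%R.
Proof. by apply: prodr_ge0 => z _; exact: mass_ge0. Qed.

Lemma integral_rate_cylinder F zeta k x : uniq F ->
  \int[mubar]_xi ((w k (xi x))%:E * (cylinder_ind F zeta xi)%:E) =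
  (cylinder_mass F zeta * rate_at F zeta k x)%:E.
Proof.
move=> uF; rewrite /rate_at; case: ifPn => xF.
  by rewrite integral_rate_cylinder_in.
by rewrite integral_rate_cylinder_notin// mean_back_rateE.
Qed.

Lemma total_atE F zeta x :
  \esum_(k in [set: nat]) (rate_at F zeta k x)%:E = (total_at F zeta x)%:E.
Proof.
rewrite /rate_at /total_at; case: ifP => _; first exact: total_back_rateE.
exact: mean_back_rate_sum.
Qed.

(** The adjoint of one particle move from [x] to [y], evaluated on the cylinder: the
    sum runs over the contents from which [k] arrivals at [y] lead into the
    cylinder, and the subtracted term is the exit from it. *)
Definition cylinder_flow F zeta x y : R :=
  (\sum_(0 <= k < (zeta y).+1)
     cylinder_mass F (update zeta y (zeta y - k)) *
     rate_at F (update zeta y (zeta y - k)) k x -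
   cylinder_mass F zeta * total_at F zeta x)%R.

Local Notation cgain F zeta :=
  (gain g (cylinder_ind F zeta) (fun=> 1%R) (site_ind F) mubar).

Lemma cylinder_gain_notin F zeta x y : y \notin F -> cgain F zeta x y = 0.
Proof.
move=> yF; rewrite (gainE g_rates mubarE mu_gt0 (measurable_cylinder_ind F zeta)
  (@cylinder_ind_diff F zeta)).
apply: esum1 => k _; rewrite -[RHS](integral0 mubar setT).
apply: eq_integral => xi _; rewrite /shifted_gain cylinder_ind_add_notin//.
by rewrite subrr add0r /site_ind (negbTE yF) mulr0 mule0.
Qed.

(** The bound that makes gains nonnegative contributes the mean rate [vbar]. *)
Lemma cylinder_gain_in F zeta x y : uniq F -> y \in F ->
  cgain F zeta x y = (cylinder_flow F zeta x y + vbar)%:E.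
Proof.
move=> uF yF; pose J := (cylinder_mass F zeta * total_at F zeta x)%R.
have mw k : measurable_fun setT (fun xi : config d => (w k (xi x))%:E).
  exact: (measurable_fun_coord (fun n => (w k n)%:E)).
have mI F' zeta' : measurable_fun setT (fun xi => (cylinder_ind F' zeta' xi)%:E).
  by apply/measurable_EFinP; exact: measurable_cylinder_ind.
have JE : \esum_(k in [set: nat])
    \int[mubar]_xi ((w k (xi x))%:E * (cylinder_ind F zeta xi)%:E) = J%:E.
  under eq_esum do rewrite integral_rate_cylinder// EFinM.
  rewrite esumZl ?cylinder_mass_ge0// ?total_atE//.
  by move=> k; rewrite lee_fin rate_at_ge0.
pose A k xi := (w k (xi x))%:E * (cylinder_ind F zeta (add_particles k y xi))%:E.
pose K := (\sum_(0 <= k < (zeta y).+1)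
     cylinder_mass F (update zeta y (zeta y - k)) *
     rate_at F (update zeta y (zeta y - k)) k x)%R.
have A0 k xi : 0 <= A k xi by rewrite mule_ge0 ?lee_fin ?cylinder_ind_ge0.
have mA k : measurable_fun setT (A k).
  apply: emeasurable_funM => //; apply/measurable_EFinP.
  apply: measurableT_comp; first exact: measurable_cylinder_ind.
  exact: measurable_add_particles.
have KE : \esum_(k in [set: nat]) \int[mubar]_xi A k xi = K%:E.
  rewrite (esum_seq (F := index_iota 0 (zeta y).+1)).
  - rewrite -sumEFin; apply: eq_big_nat => k /andP[_ ky].
    rewrite -integral_rate_cylinder//; apply: eq_integral => xi _.
    by rewrite /A cylinder_ind_add// -ltnS ky.
  - exact: iota_uniq.
  - by move=> k; apply: integral_ge0.
  move=> k; rewrite mem_index_iota /= -leqNgt => ky.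
  rewrite -[RHS](integral0 mubar setT); apply: eq_integral => xi _.
  by rewrite /A cylinder_ind_add// leqNgt ky mule0.
have WE : \esum_(k in [set: nat]) \int[mubar]_xi (w k (xi x))%:E = vbar%:E.
  rewrite -wb_sum; apply: eq_esum => k _.
  rewrite (integral_coord mubarE x (h := fun n => (w k n)%:E))//.
  by move=> n; rewrite lee_fin.
suff : cgain F zeta x y + J%:E = K%:E + vbar%:E.
  rewrite -EFinD => E.
  have : cgain F zeta x y \is a fin_num.
    by move: E; case: (gain _ _ _ _ _ _ _).
  move=> /fineK gE; move: E; rewrite -gE -EFinD => -[] E; congr _%:E.
  by rewrite /cylinder_flow -/K -/J; move: E; lra.
have D := @cylinder_ind_diff F zeta.
rewrite (gainE g_rates mubarE mu_gt0 (measurable_cylinder_ind F zeta) D).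
have P0 k xi : (0 <= shifted_gain (cylinder_ind F zeta) (fun=> 1) (site_ind F) k y xi)%R.
  exact: shifted_gain_ge0.
have mwP k : measurable_fun setT (fun xi => (w k (xi x))%:E *
    (shifted_gain (cylinder_ind F zeta) (fun=> 1%R) (site_ind F) k y xi)%:E).
  apply: emeasurable_funM => //; apply/measurable_EFinP.
  exact: measurable_shifted_gain (measurable_cylinder_ind F zeta) _ _.
have mwI k : measurable_fun setT (fun xi => (w k (xi x))%:E * (cylinder_ind F zeta xi)%:E).
  by apply: emeasurable_funM.
have wP0 k xi : 0 <= (w k (xi x))%:E *
    (shifted_gain (cylinder_ind F zeta) (fun=> 1%R) (site_ind F) k y xi)%:E.
  by rewrite mule_ge0 ?lee_fin.
have wI0 k xi : 0 <= (w k (xi x))%:E * (cylinder_ind F zeta xi)%:E.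
  by rewrite mule_ge0 ?lee_fin ?cylinder_ind_ge0.
have we0 k xi : 0 <= (w k (xi x))%:E by rewrite lee_fin.
rewrite -JE -KE -WE -esumD; [|by move=> k _; exact: integral_ge0..].
rewrite -esumD; [|by move=> k _; exact: integral_ge0..].
apply: eq_esum => k _; rewrite -ge0_integralD//.
rewrite -ge0_integralD//.
apply: eq_integral => xi _; rewrite /A /shifted_gain /site_ind yF /=.
by rewrite -!EFinM -!EFinD; congr _%:E; ring.
Qed.

Variable Y : set (config d).
Hypothesis mY : measurable Y.
Hypothesis mubarY : mubar Y = 1.

(** Each column of [p] has sum one, so a constant weight contributes itself and only
    the deviations from it on [F] remain. *)
Lemma esum_col_const F y (v : lattice d -> R) (c : R) : uniq F -> (0 <= c)%R ->
  (forall x, 0 <= v x)%R -> (forall x, x \notin F -> v x = c) ->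
  \esum_(x in [set: lattice d]) (p x y * v x)%:E =
  (c + \sum_(x <- F) p x y * (v x - c))%R%:E.
Proof.
move=> uF c0 v0 vc.
have sumF (u : lattice d -> R) : (forall x, 0 <= u x)%R ->
    \esum_(x in [set: lattice d]) (if x \in F then (p x y * u x)%:E else 0) =
    (\sum_(x <- F) p x y * u x)%R%:E.
  move=> u0; rewrite (esum_seq uF).
  - by rewrite -sumEFin; apply: eq_big_seq => x xF; rewrite xF.
  - by move=> x; case: ifP => // _; rewrite lee_fin mulr_ge0.
  - by move=> x /negbTE ->.
have pc : \esum_(x in [set: lattice d]) (p x y * c)%:E = c%:E.
  under eq_esum do rewrite EFinM.
  by rewrite esumZr// ?p_col ?mul1e// => x; rewrite lee_fin.
have E : \esum_(x in [set: lattice d]) (p x y * v x)%:E +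
    (\sum_(x <- F) p x y * c)%R%:E = c%:E + (\sum_(x <- F) p x y * v x)%R%:E.
  rewrite -pc -(sumF v v0) -(sumF (fun=> c))// -!esumD.
  - apply: eq_esum => x _; case: ifPn => [_|/vc ->]; last by [].
    by rewrite addeC.
  - by move=> x _; rewrite lee_fin mulr_ge0.
  - by move=> x _; case: ifP => // _; rewrite lee_fin mulr_ge0.
  - by move=> x _; rewrite lee_fin mulr_ge0.
  - by move=> x _; case: ifP => // _; rewrite lee_fin mulr_ge0.
move: E; set X := esum _ _ => E.
have Xfin : X \is a fin_num by move: E; case: X.
move: E; rewrite -(fineK Xfin) -!EFinD => -[] E; congr _%:E.
under eq_bigr do rewrite mulrBr.
by rewrite sumrB; move: E; lra.
Qed.

(** Only arrivals at sites of [F] affect the indicator of the cylinder, and all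
    departure sites outside [F] act on it alike; stationarity therefore becomes an
    identity between finite sums, from which the constants [vbar] drop out. The
    site [x0] certifies that the common flow [c], increased by [vbar], is a gain
    and hence nonnegative. *)
Lemma cylinder_balance F zeta x0 : uniq F -> x0 \notin F ->
  admissible_bound p g mubar (fun=> 1%R) (site_ind F) Y vbar ->
  \int[mubar]_(eta in Y) (mmp_generator p (zrp g) (cylinder_ind F zeta) eta)%:E = 0 ->
  forall c : lattice d -> R, (forall x y, x \notin F -> y \in F ->
    cylinder_flow F zeta x y = c y) ->
  (\sum_(y <- F) (c y + \sum_(x <- F) p x y * (cylinder_flow F zeta x y - c y) -
    cylinder_flow F zeta y y) = 0)%R.
Proof.
move=> uF x0F [_ bsum brow bcol] + c flowc.
have mf := measurable_cylinder_ind F zeta.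
have fD := @cylinder_ind_diff F zeta.
have om0 k : (0 <= (fun=> 1 : R) k)%R by [].
have b0 x : (0 <= site_ind F x)%R by exact: ler0n.
rewrite (integral_generator p_ge0 p_row p_col g_rates mf om0 b0 fD mY mubarY
  site_rate_mean bsum brow bcol).
have diag_lty := gain_diag_lty g_rates mf om0 b0 fD site_rate_mean bsum.
have g0 x y : 0 <= cgain F zeta x y := gain_ge0 g_rates fD mubar x y.
have diagE : \esum_(x in [set: lattice d]) cgain F zeta x x =
    (\sum_(y <- F) (cylinder_flow F zeta y y + vbar))%R%:E.
  rewrite (esum_seq uF).
  - by rewrite -sumEFin; apply: eq_big_seq => x xF; rewrite cylinder_gain_in.
  - by move=> x; exact: g0.
  - by move=> x xF; rewrite cylinder_gain_notin.
have sumE : \esum_(xy in [set: lattice d * lattice d])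
      ((p xy.1 xy.2)%:E * cgain F zeta xy.1 xy.2) =
    (\sum_(y <- F) (c y + vbar + \sum_(x <- F) p x y * (cylinder_flow F zeta x y - c y)))%R%:E.
  rewrite (esum_prod (u := fun x y => (p x y)%:E * cgain F zeta x y)); last first.
    by move=> x y; rewrite mule_ge0 ?lee_fin.
  rewrite esumC; last by move=> x y; rewrite mule_ge0 ?lee_fin.
  rewrite (esum_seq uF).
  - rewrite -sumEFin; apply: eq_big_seq => y yF.
    under eq_esum do rewrite cylinder_gain_in// -EFinM.
    have fv0 x : (0 <= cylinder_flow F zeta x y + vbar)%R.
      by rewrite -lee_fin -cylinder_gain_in.
    rewrite (@esum_col_const F y _ (c y + vbar)%R)//; last 2 first.
    + by rewrite -(flowc x0 y).
    + by move=> x xF; rewrite flowc.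
    congr (_ + _)%R%:E; apply: eq_bigr => x _; congr (_ * _)%R.
    by rewrite /=; ring.
  - by move=> y; apply: esum_ge0 => x _; rewrite mule_ge0 ?lee_fin.
  move=> y yF; apply: esum1 => x _; rewrite cylinder_gain_notin//.
  by rewrite mule0.
rewrite sumE diagE -EFinB => -[]; rewrite -sumrB => E; rewrite -[RHS]E.
by apply: eq_bigr => y _; ring.
Qed.

End cylinder_gain.

Section necessity.
Context {R : realType} {d : nat}.
Variables (p : lattice d -> lattice d -> R) (g : nat -> nat -> R).
Hypothesis d_gt0 : (0 < d)%N.
Hypothesis p_ge0 : forall x y, 0 <= p x y.
Hypothesis p_row : forall x, \esum_(y in [set: lattice d]) (p x y)%:E = 1%E.
Hypothesis p_inv : kernel_translation_invariant p.
Hypothesis g_rates : mmp_rates (zrp g).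
Variables (mu : probability nat R) (mubar : probability (config d) R).
Hypothesis mubarE : product_measure (fun=> mu) mubar.
Hypothesis mu_gt0 : forall n, 0 < mass mu n.
Variables (Y : set (config d)) (vbar : R).
Hypothesis mY : measurable Y.
Hypothesis mubarY : mubar Y = 1%E.
Hypothesis bound : forall F : seq (lattice d),
  admissible_bound p g mubar (fun=> 1) (site_ind F) Y vbar.
Hypothesis stationary : forall (F : seq (lattice d)) zeta,
  (\int[mubar]_(eta in Y) (mmp_generator p (zrp g) (cylinder_ind F zeta) eta)%:E = 0)%E.

Let p_col := translation_invariant_col p_inv p_row.
Let site_rate_mean := bound_mean (bound [::]).
Local Notation w := (back_rate g mu).
Local Notation wb := (mean_back_rate g mu).
Local Notation s := (total_back_rate g mu).
Local Notation m := (mass mu).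

Lemma lattice_notin (F : seq (lattice d)) : exists x, x \notin F.
Proof.
pose f (n : nat) : lattice d := const_mx (n%:Z).
have finj : injective f.
  move=> i j /matrixP/(_ 0 (Ordinal d_gt0)); rewrite !mxE => -[].
  by [].
have [/allP all_in|] := boolP (all (mem F) [seq f n | n <- iota 0 (size F).+1]).
  have := uniq_leq_size _ all_in.
  rewrite map_inj_uniq// iota_uniq => /(_ isT).
  by rewrite size_map size_iota ltnn.
by move=> /allPn[x _ xF]; exists x.
Qed.

(** The flows into a site holding [b] particles from a site holding [a], from a
    distant site, and from itself. *)
Definition pair_flow a b : R := \sum_(0 <= k < b.+1) m (b - k) * w k a - m b * s a.
Definition far_flow b : R := \sum_(0 <= k < b.+1) m (b - k) * wb k - m b * vbar.
Definition self_flow b : R :=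
  \sum_(0 <= k < b.+1) m (b - k) * w k (b - k) - m b * s b.

Lemma diag_lt1 u v : u != v -> 0 < p u v -> p u u < 1.
Proof.
move=> uv puv; rewrite -lte_fin -(p_row u).
apply: (@lt_le_trans _ _ (p u u + p u v)%:E); first by rewrite lte_fin ltrDl.
apply: esum_ge; exists [set` [:: u; v]]; first by split=> //; exact: finite_seq.
have uF : uniq [:: u; v] by rewrite /= inE uv.
by rewrite -fsbig_seq// !big_cons big_nil /= adde0 EFinD.
Qed.

Lemma diag_eq u v : p u u = p v v.
Proof.
by have := p_inv v v (u - v); rewrite addrC subrK.
Qed.

(** The test with one site: the jumps from [u] to itself carry [self_flow], all
    others carry [far_flow], and the former have total weight less than one. *)
Lemma self_flowE u b : p u u < 1 -> self_flow b = far_flow b.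
Proof.
move=> pu; have [x0 x0F] := lattice_notin [:: u].
have uF : uniq [:: u] by [].
pose zeta : lattice d -> nat := fun=> b.
have massE n : cylinder_mass mu [:: u] (update zeta u n) = m n.
  by rewrite /cylinder_mass big_seq1 /update eqxx.
have massz : cylinder_mass mu [:: u] zeta = m b.
  by rewrite /cylinder_mass big_seq1.
have far x y : x \notin [:: u] -> y \in [:: u] ->
    cylinder_flow g mu vbar [:: u] zeta x y = (fun=> far_flow b) y.
  move=> xF; rewrite inE => /eqP ->; rewrite /cylinder_flow /far_flow.
  rewrite massz /total_at (negbTE xF); congr (_ - _).
  by apply: eq_bigr => k _; rewrite massE /rate_at (negbTE xF).
have := cylinder_balance p_ge0 p_row p_col g_rates mubarE mu_gt0 site_rate_mean
  mY mubarY uF x0F (bound _) (stationary _ zeta) far.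
rewrite !big_seq1 (_ : cylinder_flow _ _ _ _ _ u u = self_flow b).
  by move=> H; apply/eqP; rewrite eq_sym -subr_eq0; nra.
rewrite /cylinder_flow /self_flow massz /total_at inE eqxx; congr (_ - _).
by apply: eq_bigr => k _; rewrite massE /rate_at inE eqxx /update eqxx.
Qed.

(** The test with two sites. The flows of each site to itself and from distant
    sites cancel by the test with one site, which leaves the two jumps between
    [u] and [v]. *)
Lemma pair_balance u v a b : u != v -> p u u < 1 ->
  p u v * (m a * (pair_flow a b - far_flow b)) +
  p v u * (m b * (pair_flow b a - far_flow a)) = 0.
Proof.
move=> uv pu; have [x0 x0F] := lattice_notin [:: u; v].
have vu : v != u by rewrite eq_sym.
pose zeta : lattice d -> nat := fun z => if z == u then a else b.
have zu : zeta u = a by rewrite /zeta eqxx.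
have zv : zeta v = b by rewrite /zeta (negbTE vu).
pose F := [:: u; v].
have uF : uniq F by rewrite /= inE uv.
have inF x : x \in F = (x == u) || (x == v) by rewrite !inE.
have massz : cylinder_mass mu F zeta = m a * m b.
  by rewrite /cylinder_mass !big_cons big_nil mulr1 zu zv.
have massu n : cylinder_mass mu F (update zeta u n) = m n * m b.
  by rewrite /cylinder_mass !big_cons big_nil mulr1 /update eqxx (negbTE vu) zv.
have massv n : cylinder_mass mu F (update zeta v n) = m a * m n.
  by rewrite /cylinder_mass !big_cons big_nil mulr1 /update eqxx (negbTE uv) zu.
pose c y := if y == u then m b * far_flow a else m a * far_flow b.
have far x y : x \notin F -> y \in F -> cylinder_flow g mu vbar F zeta x y = c y.
  move=> xF; rewrite inF => /orP[/eqP ->|/eqP ->]; rewrite /cylinder_flow /far_flow /c.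
    rewrite eqxx zu massz /total_at (negbTE xF) mulrBr mulr_sumr; congr (_ - _).
      by apply: eq_bigr => k _; rewrite massu /rate_at (negbTE xF); ring.
    by ring.
  rewrite (negbTE vu) zv massz /total_at (negbTE xF) mulrBr mulr_sumr; congr (_ - _).
    by apply: eq_bigr => k _; rewrite massv /rate_at (negbTE xF); ring.
  by ring.
have flow_vu : cylinder_flow g mu vbar F zeta v u = m b * pair_flow b a.
  rewrite /cylinder_flow /pair_flow zu massz /total_at inF eqxx orbT zv.
  rewrite mulrBr mulr_sumr; congr (_ - _); last by ring.
  apply: eq_bigr => k _; rewrite massu /rate_at inF eqxx orbT.
  by rewrite /update (negbTE vu) zv; ring.
have flow_uv : cylinder_flow g mu vbar F zeta u v = m a * pair_flow a b.
  rewrite /cylinder_flow /pair_flow zv massz /total_at inF eqxx /= zu.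
  rewrite mulrBr mulr_sumr; congr (_ - _); last by ring.
  apply: eq_bigr => k _; rewrite massv /rate_at inF eqxx /=.
  by rewrite /update (negbTE uv) zu; ring.
have flow_uu : cylinder_flow g mu vbar F zeta u u = m b * far_flow a.
  rewrite -(self_flowE a pu) /cylinder_flow /self_flow massz /total_at inF eqxx /= zu.
  rewrite mulrBr mulr_sumr; congr (_ - _); last by ring.
  apply: eq_bigr => k _; rewrite massu /rate_at inF eqxx /=.
  by rewrite /update eqxx; ring.
have flow_vv : cylinder_flow g mu vbar F zeta v v = m a * far_flow b.
  rewrite -(self_flowE b pu) /cylinder_flow /self_flow massz /total_at inF eqxx orbT zv.
  rewrite mulrBr mulr_sumr; congr (_ - _); last by ring.
  apply: eq_bigr => k _; rewrite massv /rate_at inF eqxx orbT.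
  by rewrite /update eqxx; ring.
have := cylinder_balance p_ge0 p_row p_col g_rates mubarE mu_gt0 site_rate_mean
  mY mubarY uF x0F (bound _) (stationary _ zeta) far.
rewrite !big_cons !big_nil flow_uu flow_uv flow_vu flow_vv /c eqxx (negbTE vu) => H.
by rewrite -[RHS]H; ring.
Qed.

(** By asymmetry, the two-site equation and the one with the contents of the two
    sites exchanged form an invertible linear system. *)
Lemma pair_flowE : asymmetric_kernel p -> forall a b, pair_flow a b = far_flow b.
Proof.
move=> [u [v puv]] a b.
have uv : u != v by apply: contraNneq puv => ->.
have vu : v != u by rewrite eq_sym.
have pu : p u u < 1.
  have [Pu|] := ltP 0 (p u v); first exact: diag_lt1 uv Pu.
  move=> Pu; rewrite (diag_eq u v); apply: (diag_lt1 vu).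
  rewrite lt_neqAle p_ge0 andbT eq_sym; apply: contraNneq puv => ->.
  by apply/eqP/le_anti; rewrite Pu p_ge0.
have := pair_balance a b uv pu; have := pair_balance b a uv pu.
set h := m a * _; set h' := m b * _ => E1 E2.
have h0 : h = 0.
  have : (p u v - p v u) * (p u v + p v u) * h = 0.
    transitivity (p u v * (p u v * h + p v u * h') - p v u * (p u v * h' + p v u * h)).
      by ring.
    by rewrite E1 E2 !mulr0 subrr.
  move=> /eqP; rewrite mulf_eq0 => /orP[|/eqP//].
  rewrite mulf_eq0 subr_eq0 (negbTE puv) /= paddr_eq0// => /andP[/eqP e1 /eqP e2].
  by move: puv; rewrite e1 e2 eqxx.
move: h0 => /eqP; rewrite /h mulf_eq0 gt_eqF//= subr_eq0.
by move=> /eqP.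
Qed.

Lemma back_rate0 n : w 0%N n = 0.
Proof.
by have [_ g0 _ _] := g_rates; rewrite /back_rate [g _ _](g0 _ 0%N) !mul0r.
Qed.

Lemma mean_back_rate0 : wb 0%N = 0.
Proof.
rewrite /mean_back_rate esum1// => n _.
by rewrite back_rate0 mul0r.
Qed.

(** The equations for successive contents of the target site are triangular in
    the numbers of particles which arrive. *)
Lemma back_rate_mean : asymmetric_kernel p -> forall k n, w k n = wb k.
Proof.
move=> asym k n.
have s_vbar : s n = vbar.
  have := pair_flowE asym n 0; rewrite /pair_flow /far_flow !big_nat1.
  rewrite back_rate0 mean_back_rate0 !mulr0 !sub0r => /oppr_inj/mulfI; apply.
  by rewrite gt_eqF.
elim/ltn_ind: k => k IH.
have := pair_flowE asym n k; rewrite /pair_flow /far_flow s_vbar => /addIr.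
rewrite !big_nat_recr//= subnn (eq_big_nat _ _ (F2 := fun i => m (k - i) * wb i)).
  by move=> /addrI/mulfI; apply; rewrite gt_eqF.
by move=> i /andP[_ ik]; rewrite IH.
Qed.

(** For [k = 1], constancy of the backward rates determines the masses as
    [phi ^+ n] over the factorial of the rates, up to normalization; for the other
    [k] it then gives the factorized rates, where the powers of [phi] cancel. *)
Lemma necessary_factorization : asymmetric_kernel p ->
  (forall alpha, (1 <= alpha)%N -> 0 < g 1%N alpha) -> factorized_rates g.
Proof.
move=> asym g1_gt0.
have m_neq0 n : m n != 0 by rewrite gt_eqF.
have wE k n : g k (n + k)%N * m (n + k) / m n = g k k * m k / m 0.
  by have := back_rate_mean asym k n; rewrite -(back_rate_mean asym k 0).
have fact_gt0 n : 0 < rate_fact g n.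
  rewrite /rate_fact big_nat; apply: prodr_gt0 => i /andP[i0 _].
  exact: g1_gt0.
pose phi := g 1%N 1%N * m 1 / m 0.
have massE n : m n = m 0 * phi ^+ n / rate_fact g n.
  elim: n => [|n IH].
    by rewrite expr0 mulr1 /rate_fact big_geq// divr1.
  have := wE 1%N n; rewrite addn1 -/phi => e.
  have -> : m n.+1 = phi * m n / g 1%N n.+1.
    by rewrite -e divfK// mulrAC divff ?mul1r// gt_eqF// g1_gt0.
  rewrite IH /rate_fact [in RHS]big_nat_recr//= exprS -/(rate_fact g n).
  by field; rewrite !gt_eqF ?g1_gt0.
have phi0 : phi != 0 by rewrite gt_eqF// divr_gt0// mulr_gt0// g1_gt0.
move=> k alpha /andP[k1 ka].
have := wE k (alpha - k)%N; rewrite subnK// => e.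
have -> : g k alpha = g k k * (m k * m (alpha - k) / (m 0 * m alpha)).
  apply: (mulIf (m_neq0 alpha)); apply: (divIf (m_neq0 (alpha - k)%N)).
  rewrite e; field.
  by rewrite !m_neq0.
rewrite [g k k * _]mulrC; congr (_ * _).
rewrite (massE k) (massE (alpha - k)%N) (massE alpha) -{3}(subnK ka) exprD.
by field; rewrite m_neq0 !expf_neq0// !gt_eqF.
Qed.

End necessity.

(** * Invariance of product measures *)

Section product_invariance.
Context {R : realType} {d : nat}.
Variables (p : lattice d -> lattice d -> R) (g : nat -> nat -> R).
Hypothesis p_ge0 : forall x y, 0 <= p x y.
Hypothesis p_row : forall x, \esum_(y in [set: lattice d]) (p x y)%:E = 1%E.
Hypothesis p_inv : kernel_translation_invariant p.
Hypothesis g_rates : mmp_rates (zrp g).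
Variables (mu : probability nat R) (mubar : probability (config d) R).
Hypothesis mubarE : product_measure (fun=> mu) mubar.
Hypothesis mu_gt0 : forall n, 0 < mass mu n.
Variables (a : lattice d -> R) (M : R).
Hypothesis aM : admissible_weight p a M.
Implicit Types (x y z : lattice d) (F : seq (lattice d)).

Let p_col := translation_invariant_col p_inv p_row.

Lemma site_ind_sum F : (\esum_(x in [set: lattice d]) (@site_ind R d F x)%:E < +oo)%E.
Proof.
rewrite (esum_seq (undup_uniq F)); first by rewrite sumEFin ltry.
  by move=> x; rewrite lee_fin.
by move=> x; rewrite mem_undup /site_ind => /negbTE ->.
Qed.

(** Finitely many positive weights are bounded from below. *)
Lemma site_ind_weight F : exists2 c : R, 0 <= c & forall x, site_ind F x <= c * a x.
Proof.
have a0 := weight_gt0 aM.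
exists (\sum_(x <- F) (a x)^-1).
  by apply: sumr_ge0 => x _; rewrite invr_ge0 ltW.
move=> x; rewrite /site_ind; have [xF|xF] := boolP (x \in F).
  rewrite -(mulVf (lt0r_neq0 (a0 x))); apply: ler_wpM2r; first exact: ltW.
  rewrite (big_rem x)//= lerDl.
  by apply: sumr_ge0 => y _; rewrite invr_ge0 ltW.
by rewrite mulr_ge0 ?(ltW (a0 x))// sumr_ge0// => y _; rewrite invr_ge0 ltW.
Qed.

Section constant_back_rate.
Hypothesis back_rate_const : forall k n, back_rate g mu k n = back_rate g mu k 0.

(** Adding [k] particles at [x] changes an [L]-Lipschitz function by at most
    [L * k * a x]. *)
Lemma mmp_invariant_constant_back_rate S : growth_bound (zrp g) -> finite_mean mu ->
  mmp_semigroup p a (zrp g) S -> mmp_invariant a S mubar.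
Proof.
move=> gC mean semiS.
have mubarY := mubar_finite_configs mubarE aM mean.
apply/(mmp_invariantP aM semiS mubarY (config_norm_mean mubarE aM mean)).
move=> f Df _; have [L fL] := Df; have [L0 _] := fL.
under eq_integral => eta /[!inE] Yeta do rewrite -(generator_patch aM)//.
have a0 := weight_ge0 aM.
have om0 k : 0 <= L * k%:R by rewrite mulr_ge0// ltW.
have a1 x : a x <= 1 * a x by rewrite mul1r.
have [vbar [vE bsum brow bcol]] := growth_admissible p_ge0 g_rates mubarE aM mean
  gC om0 (fun k _ => lexx (L * k%:R)) ler01 a0 a1.
exact: (stationary_constant_back_rate p_ge0 p_row p_col g_rates mubarE mu_gt0
  (measurable_lipschitz_patch aM Df) om0 a0
  (fun k x xi => lipschitz_patch_add aM k x xi fL)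
  (measurable_finite_configs aM) mubarY vE bsum brow bcol).
Qed.

(** Adding particles at [x] changes a cylinder function bounded by [K] by at most
    [2 * K], and only if [x] is one of its sites. *)
Lemma alt_invariant_constant_back_rate S : bounded_rates (zrp g) ->
  alt_semigroup p a (zrp g) S -> alt_invariant a S mubar.
Proof.
move=> gC semiS; apply/(alt_invariantP semiS) => f fcyl [K fK].
have mf := measurable_cylinder_function fcyl.
have [F fF] := fcyl.
have K0 : 0 <= K by apply: le_trans (fK (fun=> 0%N) I).
pose b x : R := 2 * K * site_ind F x.
have b0 x : 0 <= b x by rewrite !mulr_ge0.
have bsum : (\esum_(x in [set: lattice d]) (b x)%:E < +oo)%E.
  under eq_esum do rewrite EFinM.
  rewrite esumZl ?mulr_ge0//; last by move=> x; rewrite lee_fin.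
  by apply: lte_mul_pinfty; rewrite ?lee_fin ?mulr_ge0 ?site_ind_sum.
have fD k x xi : `|f (add_particles k x xi) - f xi| <= (fun=> 1) k * b x.
  rewrite mul1r /b /site_ind; have [xF|xF] := boolP (x \in F).
    have := ler_normB (f (add_particles k x xi)) (f xi).
    by move: (fK (add_particles k x xi) I) (fK xi I); rewrite /=; lra.
  rewrite (fF _ xi) ?subrr ?normr0 ?mulr0// => z zF.
  rewrite /add_particles; have [zx|//] := eqVneq z x.
  by move: xF; rewrite -zx zF.
have [vbar [vE _ brow bcol]] := bounded_admissible p_ge0 p_col g_rates mubarE gC b0 bsum.
exact: (stationary_constant_back_rate p_ge0 p_row p_col g_rates mubarE mu_gt0
  mf (fun=> ler01) b0 fD measurableT (probability_setT mubar) vE bsum brow bcol).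
Qed.

End constant_back_rate.

Hypothesis d_gt0 : (0 < d)%N.

(** The mean rate does not depend on the tested cylinder, so the bounds for all
    finite sets of sites share one value [vbar]. *)
Lemma factorized_of_admissible (Y : set (config d)) : measurable Y ->
  mubar Y = 1%E ->
  (forall F, exists vbar, admissible_bound p g mubar (fun=> 1) (site_ind F) Y vbar) ->
  (forall F zeta, (\int[mubar]_(eta in Y)
     (mmp_generator p (zrp g) (cylinder_ind F zeta) eta)%:E = 0)%E) ->
  asymmetric_kernel p -> (forall alpha, (1 <= alpha)%N -> 0 < g 1%N alpha) ->
  factorized_rates g.
Proof.
move=> mY mubarY adm stat asym g1; have [vbar bound0] := adm [::].
apply: (necessary_factorization d_gt0 p_ge0 p_row p_inv g_rates mubarE mu_gt0 mY
  mubarY (vbar := vbar) _ stat asym g1) => F.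
have [vbar' bound'] := adm F.
have [<-] : vbar'%:E = vbar%:E.
  by rewrite -(bound_mean bound' 0) (bound_mean bound0 0).
exact: bound'.
Qed.

Lemma cylinder_ind_bounded F zeta (Y : set (config d)) :
  bounded_on Y (@cylinder_ind R d F zeta).
Proof.
exists 1 => eta _; rewrite ger0_norm; first exact: cylinder_ind_le1.
exact: cylinder_ind_ge0.
Qed.

Lemma factorized_of_mmp_invariant S : growth_bound (zrp g) -> finite_mean mu ->
  mmp_semigroup p a (zrp g) S -> mmp_invariant a S mubar ->
  asymmetric_kernel p -> (forall alpha, (1 <= alpha)%N -> 0 < g 1%N alpha) ->
  factorized_rates g.
Proof.
move=> gC mean semiS inv.
have mubarY := mubar_finite_configs mubarE aM mean.
apply: (factorized_of_admissible (measurable_finite_configs aM) mubarY).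
  move=> F; have [c c0 cF] := site_ind_weight F.
  have s0 x : 0 <= @site_ind R d F x by exact: ler0n.
  have om1 k : (0 < k)%N -> (fun=> 1 : R) k <= 1 * k%:R by rewrite mul1r ler1n.
  exact: (growth_admissible p_ge0 g_rates mubarE aM mean gC (fun=> ler01) om1 c0 s0 cF).
move=> F zeta.
have /(mmp_invariantP aM semiS mubarY (config_norm_mean mubarE aM mean)) := inv.
apply; last exact: cylinder_ind_bounded.
apply: (lipschitz_cylinder aM); first exact: cylinder_ind_cylinder.
exact: cylinder_ind_bounded.
Qed.

Lemma factorized_of_alt_invariant S : bounded_rates (zrp g) ->
  alt_semigroup p a (zrp g) S -> alt_invariant a S mubar ->
  asymmetric_kernel p -> (forall alpha, (1 <= alpha)%N -> 0 < g 1%N alpha) ->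
  factorized_rates g.
Proof.
move=> gC semiS inv.
apply: (factorized_of_admissible measurableT (probability_setT mubar)).
  move=> F; apply: (bounded_admissible p_ge0 p_col g_rates mubarE gC).
    by move=> x; exact: ler0n.
  exact: site_ind_sum.
move=> F zeta; have /(alt_invariantP semiS) := inv; apply.
  exact: cylinder_ind_cylinder.
exact: cylinder_ind_bounded.
Qed.

End product_invariance.

Lemma translation_invariant_marginals {R : realType} (d : nat)
    (m : lattice d -> probability nat R) (mubar : probability (config d) R) :
  product_measure m mubar -> translation_invariant mubar ->
  forall x n, mass (m x) n = mass (m 0) n.
Proof.
move=> mubarE inv x n.
have siteE y : mubar [set eta | eta y = n] = (mass (m y) n)%:E.
  have := mubarE [:: y] (fun=> n) isT; rewrite big_seq1 => <-; congr (mubar _).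
  apply/seteqP; split=> eta /=; last by apply; rewrite inE.
  by move=> ey z; rewrite inE => /eqP ->.
have := inv x _ (measurable_coord_set 0 n).
rewrite (_ : _ @^-1` _ = [set eta : config d | eta x = n]) ?siteE; first by case.
by apply/seteqP; split=> eta /=; rewrite /shift_config add0r.
Qed.

(** The ratio of the masses of [n + k] and [n] contains the inverse of those factors
    of the factorized rate that depend on [n]. *)
Lemma back_rate_mu_phi {R : realType} (g : nat -> nat -> R) (mu nu : probability nat R) phi :
  mmp_rates (zrp g) -> (forall alpha, (1 <= alpha)%N -> 0 < g 1%N alpha) ->
  factorized_rates g -> reference_measure g mu -> RadZ mu phi ->
  (forall n, mass nu n = mu_phi g mu phi n) ->
  forall k n, back_rate g nu k n = back_rate g nu k 0.
Proof.
move=> g_rates g1 gfact ref phiR nuE k n.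
case: k => [|k].
  by have [_ g0 _ _] := g_rates; rewrite /back_rate [g _ _](g0 _ 0%N)
    [X in _ = X * _ / _](g0 _ 0%N) !mul0r.
have rf i := rate_fact_gt0 g1 i.
have [phi0 _] := phiR; have [fug _] := ref.
have c0 : 0 < mass mu 0 / fine (Zpartition g mu phi).
  have := mu_phi_gt0 g1 ref 0 phiR.
  by rewrite /mu_phi expr0 pmulr_lgt0// div1r invr_gt0.
rewrite /back_rate !nuE /mu_phi !add0n gfact; last by rewrite leq_addl.
rewrite addnK exprD.
have r0 : rate_fact g 0 = 1 by rewrite /rate_fact big_geq.
have Z0 : fine (Zpartition g mu phi) != 0.
  by apply: contraTneq c0 => ->; rewrite invr0 mulr0 ltxx.
have m0 : mass mu 0 != 0 by apply: contraTneq c0 => ->; rewrite mul0r ltxx.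
have pf n' : (phi * fugacity g mu) ^+ n' != 0.
  by rewrite expf_neq0// gt_eqF// mulr_gt0.
rewrite expr0 r0; field.
by rewrite Z0 m0 pf !gt_eqF.
Qed.

Theorem proposition3p13 (R : realType) (d : nat)
    (p : lattice d -> lattice d -> R) (a : lattice d -> R) (M : R) :
  (0 < d)%N ->
  transition_probability p ->
  kernel_translation_invariant p ->
  irreducible_kernel p ->
  admissible_weight p a M ->
  (forall (mu : probability nat R) (g : nat -> nat -> R),
    (forall alpha, 0 < mass mu alpha) ->
    mmp_rates (zrp g) ->
    (forall k, (1 <= k)%N -> 0 < g k k) ->
    (forall k alpha, (1 <= k)%N -> (1 <= alpha)%N ->
      g k (alpha + k)%N * mass mu (alpha + k) =
        mass mu alpha * (mass mu k / mass mu 0) * g k k) ->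
    growth_bound (zrp g) ->
    exists mubar : probability (config d) R,
      [/\ product_measure (fun=> mu) mubar,
          finite_mean mu ->
            forall S, mmp_semigroup p a (zrp g) S -> mmp_invariant a S mubar &
          bounded_rates (zrp g) ->
            forall S, alt_semigroup p a (zrp g) S -> alt_invariant a S mubar])
  /\
  (forall (g : nat -> nat -> R) (mu : probability nat R),
    mmp_rates (zrp g) ->
    growth_bound (zrp g) ->
    (forall alpha, (1 <= alpha)%N -> 0 < g 1%N alpha) ->
    factorized_rates g ->
    reference_measure g mu ->
    exists (m : R -> probability nat R) (mubar : R -> probability (config d) R),
      [/\ forall phi, RadZ mu phi ->
            (forall alpha, mass (m phi) alpha = mu_phi g mu phi alpha) /\
            product_measure (fun=> m phi) (mubar phi),
          forall phi, RadZ' mu phi ->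
            forall S, mmp_semigroup p a (zrp g) S -> mmp_invariant a S (mubar phi) &
          forall phi, RadZ mu phi -> bounded_rates (zrp g) ->
            forall S, alt_semigroup p a (zrp g) S ->
              alt_invariant a S (mubar phi)])
  /\
  (forall g : nat -> nat -> R,
    asymmetric_kernel p ->
    mmp_rates (zrp g) ->
    growth_bound (zrp g) ->
    (forall alpha, (1 <= alpha)%N -> 0 < g 1%N alpha) ->
    forall (m : lattice d -> probability nat R)
           (mubar : probability (config d) R),
      product_measure m mubar ->
      translation_invariant mubar ->
      (forall x alpha, 0 < mass (m x) alpha) ->
      ((forall x, finite_mean (m x)) /\
         (exists2 S, mmp_semigroup p a (zrp g) S & mmp_invariant a S mubar)
       \/
       bounded_rates (zrp g) /\
         (exists2 S, alt_semigroup p a (zrp g) S & alt_invariant a S mubar)) ->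
      factorized_rates g).
Proof.
move=> d0 [p0 prow] pinv _ aM; split; [|split].
- move=> mu g mu0 g_rates _ gE gC.
  have [mubar mubarE] := product_measure_exists d mu0.
  have g0 n : g 0%N n = 0 by have [_ z _ _] := g_rates; exact: (z n 0%N).
  have wconst k n : back_rate g mu k n = back_rate g mu k 0.
    rewrite /back_rate; case: k => [|k]; first by rewrite !g0 !mul0r.
    case: n => [//|n]; rewrite gE// add0n.
    by field; rewrite !gt_eqF.
  exists mubar; split=> //.
      move=> mean S.
    exact: (mmp_invariant_constant_back_rate p0 prow pinv g_rates mubarE mu0 aM
      wconst gC mean).
  move=> gB S.
  exact: (alt_invariant_constant_back_rate p0 prow pinv g_rates mubarE mu0 wconst gB).
- move=> g mu g_rates gC g1 gfact ref.
  have /boolp.choice[m mE] : forall phi, exists m : probability nat R,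
      RadZ mu phi -> forall n, mass m n = mu_phi g mu phi n.
    move=> phi; have [phiR|notR] := pselect (RadZ mu phi); last by exists mu.
    have [|m mE] := @nat_probability_exists R (mu_phi g mu phi) _ (mu_phi_sum g1 ref phiR).
      by move=> n; exact/ltW/(mu_phi_gt0 g1 ref).
    by exists m.
  have m_gt0 phi : RadZ mu phi -> forall n, 0 < mass (m phi) n.
    by move=> phiR n; rewrite mE//; exact: (mu_phi_gt0 g1 ref).
  have /boolp.choice[mubar mubarE] : forall phi, exists mubar : probability (config d) R,
      RadZ mu phi -> product_measure (fun=> m phi) mubar.
    move=> phi; have [phiR|notR] := pselect (RadZ mu phi).
      by have [mubar mubarE] := product_measure_exists d (m_gt0 phi phiR); exists mubar.
    (* Outside the radius of convergence, any probability will do. *)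
    by exists (\d_((fun=> 0%N) : config d) : probability (config d) R).
  have wconst phi (phiR : RadZ mu phi) :=
    back_rate_mu_phi g_rates g1 gfact ref phiR (mE phi phiR).
  exists m, mubar; split=> [phi phiR|phi phiR' S|phi phiR gB S].
  + by split; [exact: mE|exact: mubarE].
  + have phiR : RadZ mu phi by apply: RadZ'_RadZ phiR'.
    exact: (mmp_invariant_constant_back_rate p0 prow pinv g_rates (mubarE phi phiR)
      (m_gt0 phi phiR) aM (wconst phi phiR) gC
      (mu_phi_finite_mean g1 ref phiR' (mE phi phiR))).
  + exact: (alt_invariant_constant_back_rate p0 prow pinv g_rates (mubarE phi phiR)
      (m_gt0 phi phiR) (wconst phi phiR) gB).
- move=> g asym g_rates gC g1 m mubar mubarE inv mpos.
  have mE := translation_invariant_marginals mubarE inv.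
  have mubarE0 : product_measure (fun=> m 0) mubar.
    by move=> F xi uF; rewrite mubarE//; congr _%:E; apply: eq_bigr => x _; rewrite mE.
  case=> [[mean [S semiS invS]]|[gB [S semiS invS]]].
    exact: (factorized_of_mmp_invariant p0 prow pinv g_rates mubarE0 (mpos 0) aM d0
      gC (mean 0) semiS invS asym g1).
  exact: (factorized_of_alt_invariant p0 prow pinv g_rates mubarE0 (mpos 0) d0
    gB semiS invS asym g1).
Qed.
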